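(* For $0<\epsilon<1$ let $$\kappa(\epsilon)=\Big\{(x,y)\in(0,+\infty)^2 : 1-\epsilon<\frac{y}{x}<\frac{1}{1-\epsilon}\Big\}.$$ Let $\mu\in \mathrm{M}(S^{2n-1})$ be such that $\operatorname{spec}(\mu)\cap\kappa(\epsilon)$ is finite or empty for some $\epsilon\in(0,1)$. Then $$\dim_{\mathcal H}(\mu)\ge 2n-2.$$
   Context: $S^{2n-1}=\{z\in\mathbb{C}^n:|z|=1\}$, regarded as a submanifold of $\mathbb{R}^{2n}$; Hausdorff dimension is computed with respect to the Euclidean metric of $\mathbb{R}^{2n}$. $\mathrm{M}(S^{2n-1})$ is the set of finite (complex-valued) Borel regular measures on $S^{2n-1}$. Lower Hausdorff dimension of a measure: $\dim_{\mathcal H}(\mu)=\inf\{\alpha : \text{there exists a Borel set } E \text{ with } \dim_{\mathcal H}E\le\alpha \text{ and } \mu(E)\ne 0\}$. Spectrum: $\mathbb{Z}_+$ is the set of non-negative integers. For $(p,q)\in\mathbb{Z}_+^2$, $H(p,q)$ is the space of restrictions to $S^{2n-1}$ of harmonic polynomials on $\mathbb{C}^n$ that are homogeneous of degree $p$ in $z_1,\dots,z_n$ and homogeneous of degree $q$ in $\bar z_1,\dots,\bar z_n$. With $\sigma$ the rotation-invariant (Haar) measure on $S^{2n-1}$, $L^2(S^{2n-1},\sigma)=\bigoplus_{p,q\ge0}H(p,q)$ orthogonally. Let $\pi_{p,q}:L^2(S^{2n-1},\sigma)\to H(p,q)$ be the orthogonal projection and $K_{p,q}$ its reproducing kernel,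 i.e. $\pi_{p,q}f(z)=\int_{S^{2n-1}}K_{p,q}(z,w)f(w)\,d\sigma(w)$. For $\mu\in \mathrm{M}(S^{2n-1})$ put $\pi_{p,q}\mu(z)=\int_{S^{2n-1}}K_{p,q}(z,w)\,d\mu(w)$ and $\operatorname{spec}(\mu)=\{(p,q)\in\mathbb{Z}_+^2:\pi_{p,q}\mu\not\equiv0\}$. *)

(* Defs.v *)
From HB Require Import structures.
From mathcomp Require Import all_boot all_order all_algebra.
From mathcomp Require Import complex.
From mathcomp Require mpoly.

Set Implicit Arguments.
Unset Strict Implicit.
Unset Printing Implicit Defensive.

(* mpoly is imported inside this module only: some of its notations clash with
   those of mathcomp-analysis, which is imported below. *)
Module MPolyDefs.
Import GRing.Theory Num.Theory mpoly.
Local Open Scope ring_scope.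
Local Open Scope complex_scope.

Section defs.
Variables (R : rcfType) (n : nat).

(* Of the [n + n] variables of a polynomial of type [{mpoly R[i][n + n]}], the
   first [n] are read either as z_1, .., z_n or as x_1, .., x_n, the last [n] as
   their conjugates or as y_1, .., y_n, where z_j = x_j + i y_j. *)

Definition bihomogeneous (p q : nat) (P : {mpoly R[i][n + n]}) : Prop :=
  forall m, m \in msupp P ->
    (\sum_(j < n) m (lshift n j) = p)%N /\ (\sum_(j < n) m (rshift n j) = q)%N.

(* substitution of x_j + i y_j for z_j and of x_j - i y_j for its conjugate *)
Definition real_coordinates (P : {mpoly R[i][n + n]}) : {mpoly R[i][n + n]} :=
  P \mPo [tuple match split k with
                | inl j => 'X_(lshift n j) + 'i%C *: 'X_(rshift n j)
                | inr j => 'X_(lshift n j) - 'i%C *: 'X_(rshift n j)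
                end | k < n + n].

Definition laplacian (Q : {mpoly R[i][n + n]}) : {mpoly R[i][n + n]} :=
  \sum_(k < n + n) (Q^`M(k))^`M(k).

Definition harmonic (P : {mpoly R[i][n + n]}) : Prop :=
  laplacian (real_coordinates P) = 0.

Definition poly_fun (P : {mpoly R[i][n + n]}) (x : 'rV[R]_(n + n)) : R[i] :=
  (real_coordinates P).@[fun k => (x ord0 k)%:C].

End defs.
End MPolyDefs.

From mathcomp Require Import all_classical all_reals all_analysis.
Import Order.TTheory GRing.Theory Num.Theory.
Import numFieldNormedType.Exports.
Local Open Scope classical_set_scope.
Local Open Scope ring_scope.
Local Open Scope complex_scope.

Section hausdorff.
Local Open Scope ereal_scope.
Context {R : realType} {T : Type} (dist : T -> T -> R).

Definition diameter (A : set T) : \bar R :=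
  ereal_sup [set (dist x.1 x.2)%:E | x in A `*` A].

(* The empty set has gauge 0 also when s = 0, where [_ `^ 0] is constantly 1. *)
Definition hausdorff_gauge (s : R) (A : set T) : \bar R :=
  if A == set0 then 0 else poweR (diameter A) s.

Definition hausdorff_premeasure (s delta : R) (E : set T) : \bar R :=
  ereal_inf [set \sum_(0 <= k <oo) hausdorff_gauge s (U k) |
    U in [set U : (set T)^nat | E `<=` \bigcup_k U k /\
                                forall k, diameter (U k) <= delta%:E]].

Definition hausdorff_measure (s : R) (E : set T) : \bar R :=
  ereal_sup [set hausdorff_premeasure s delta E |
    delta in [set delta : R | (0 < delta)%R]].

Definition hausdorff_dim (E : set T) : \bar R :=
  ereal_inf [set s%:E | s in [set s : R | (0 <= s)%R /\
                                          hausdorff_measure s E = 0]].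

End hausdorff.

Section complex_measures.
Context {d : measure_display} {T : measurableType d} {R : realType}.

(* A charge is finite, so a pair of charges is the same thing as a countably
   additive function from the measurable sets to R[i]. *)
Record complex_measure := ComplexMeasure {
  cmeasure_re : {charge set T -> \bar R} ;
  cmeasure_im : {charge set T -> \bar R} }.

Definition cmeasure (mu : complex_measure) (E : set T) : R[i] :=
  fine (cmeasure_re mu E) +i* fine (cmeasure_im mu E).

Definition cmeasure_variation (mu : complex_measure) (E : set T) : \bar R :=
  ereal_sup [set (\sum_(0 <= k <oo) (complex.Re `|cmeasure mu (F k)|)%:E)%E |
    F in [set F : (set T)^nat | [/\ forall k, measurable (F k),
                                    trivIset setT F & \bigcup_k F k = E]]].

(* The value does not depend on the Hahn decomposition that is picked. *)
Definition charge_integral (nu : {charge set T -> \bar R}) (f : T -> R) : R :=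
  let PN := cid (Hahn_decomposition nu) in
  let nuPN := svalP (cid (svalP PN)) in
  \int[jordan_pos nuPN]_x (f x) - \int[jordan_neg nuPN]_x (f x).

Definition cmeasure_integral (mu : complex_measure) (f : T -> R[i]) : R[i] :=
  (charge_integral (cmeasure_re mu) (fun x => complex.Re (f x)) -
   charge_integral (cmeasure_im mu) (fun x => complex.Im (f x))) +i*
  (charge_integral (cmeasure_re mu) (fun x => complex.Im (f x)) +
   charge_integral (cmeasure_im mu) (fun x => complex.Re (f x))).

Definition cintegral (sigma : {measure set T -> \bar R})
    (f : T -> R[i]) : R[i] :=
  (\int[sigma]_x (complex.Re (f x))) +i* (\int[sigma]_x (complex.Im (f x))).

Definition square_integrable (sigma : {measure set T -> \bar R})
    (f : T -> R[i]) : Prop :=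
  (fun x => complex.Re (f x)) \in Lfun sigma 2%:E /\
  (fun x => complex.Im (f x)) \in Lfun sigma 2%:E.

Definition orthogonal_projection (sigma : {measure set T -> \bar R})
    (H : set (T -> R[i])) (f g : T -> R[i]) : Prop :=
  H g /\ forall h, H h -> cintegral sigma (fun x => (f x - g x) * (h x)^*) = 0.

(* The second condition determines [K z], which the first one determines only up
   to a negligible set. *)
Definition is_reproducing_kernel (sigma : {measure set T -> \bar R})
    (H : set (T -> R[i])) (K : T -> T -> R[i]) : Prop :=
  (forall f, square_integrable sigma f ->
     orthogonal_projection sigma H f
       (fun z => cintegral sigma (fun w => K z w * f w))) /\
  (forall z, H (fun w => (K z w)^*)).

Definition reproducing_kernel (sigma : {measure set T -> \bar R})
    (H : set (T -> R[i])) : T -> T -> R[i] :=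
  xget (fun _ _ => 0) [set K | is_reproducing_kernel sigma H K].

Definition lower_hausdorff_dim (dist : T -> T -> R) (mu : complex_measure) :
    \bar R :=
  ereal_inf [set a%:E | a in [set a : R | exists E : set T,
    [/\ measurable E, (hausdorff_dim dist E <= a%:E)%E & cmeasure mu E != 0]]].

End complex_measures.
Arguments complex_measure {d} T R.

Section sphere.
Context {R : realType} {n : nat}.

Definition enorm (x : 'rV[R]_(n + n)) : R :=
  Num.sqrt (\sum_(k < n + n) x ord0 k ^+ 2).

(* C^n is 'rV[R]_(n + n): the coordinates of z are x_1, .., x_n, y_1, .., y_n
   with z_j = x_j + i y_j.  The proof that n is positive is only used to point
   the sphere, as a measurableType must be. *)
Definition sphere (n_gt0 : (0 < n)%N) : Type :=
  set_type [set x : 'rV[R]_(n + n) | enorm x = 1].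

Section instances.
Variable n_gt0 : (0 < n)%N.

Lemma enorm_delta :
  [set x : 'rV[R]_(n + n) | enorm x = 1]
    (delta_mx ord0 (lshift n (Ordinal n_gt0))).
Proof.
rewrite /= /enorm (bigD1 (lshift n (Ordinal n_gt0)))//= big1 ?addr0.
  by rewrite mxE !eqxx expr1n sqrtr1.
by move=> k /negPf kn; rewrite mxE kn andbF expr0n.
Qed.

HB.instance Definition _ := Topological.copy (sphere n_gt0)
  (set_type [set x : 'rV[R]_(n + n) | enorm x = 1]).
HB.instance Definition _ := isPointed.Build (sphere n_gt0)
  (SigSub (mem_set enorm_delta)).
HB.instance Definition _ := Measurable.copy (sphere n_gt0)
  (g_sigma_algebraType (@open (sphere n_gt0))).

Local Notation S := (sphere n_gt0).

Definition sphere_dist (x y : S) : R := enorm (set_val x - set_val y).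

Definition cmeasure_regular (mu : complex_measure S R) : Prop :=
  forall E : set S, measurable E ->
    cmeasure_variation mu E =
      ereal_inf [set cmeasure_variation mu U |
        U in [set U | open U /\ E `<=` U]] /\
    cmeasure_variation mu E =
      ereal_sup [set cmeasure_variation mu K |
        K in [set K | compact K /\ K `<=` E]].

Definition rotation_invariant (sigma : {measure set S -> \bar R}) : Prop :=
  forall A : 'M[R]_(n + n), A *m A^T = 1%:M -> \det A = 1 ->
  forall E : set S, measurable E ->
    sigma [set y | exists2 x, E x & set_val y = set_val x *m A] = sigma E.

Definition spherical_harmonics (p q : nat) : set (S -> R[i]) :=
  [set f | exists P, [/\ MPolyDefs.bihomogeneous p q P, MPolyDefs.harmonic P &
                         forall x, f x = MPolyDefs.poly_fun P (set_val x)]].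

Definition proj_measure (sigma : {measure set S -> \bar R}) (p q : nat)
    (mu : complex_measure S R) (z : S) : R[i] :=
  cmeasure_integral mu (reproducing_kernel sigma (spherical_harmonics p q) z).

Definition spectrum (sigma : {measure set S -> \bar R}) (mu : complex_measure S R) :
    set (nat * nat) :=
  [set pq | exists z, proj_measure sigma pq.1 pq.2 mu z != 0].

End instances.
End sphere.
Arguments sphere R {n} n_gt0.

Definition kappa (R : realType) (eps : R) : set (R * R) :=
  [set xy | [/\ 0 < xy.1, 0 < xy.2, 1 - eps < xy.2 / xy.1 &
                xy.2 / xy.1 < (1 - eps)^-1]].

(* Main.v *)
Require Import Defs.
From HB Require Import structures.
From mathcomp Require Import all_boot all_order all_algebra.
From mathcomp Require Import complex ring lra zify boolp.
From mathcomp Require mpoly.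

Set Implicit Arguments.
Unset Strict Implicit.
Unset Printing Implicit Defensive.

(** Let [mubar] be the conjugate of [mu], and write <z, w> for the Hermitian
product.  The kernel of H(p, q) is the sum of e_i(z) e_i(w)^* over an
orthonormal basis, so that [mubar] annihilates H(p, q) as soon as (p, q) is
outside the spectrum.  In a strip |p - q| <= t the ratio q / p tends to 1;
hence [mubar] annihilates H(p, q) when |p - q| <= t and p + q is large enough,
for every t.

A polynomial in z and its conjugate is balanced if each monomial has the same
degree in both, that is, if it is invariant under the circle z -> e^(it) z.  On
the sphere, a balanced polynomial is a sum of members of the spaces H(m, m).  If
[h] is in H(m, m) and [chi] is a monomial of bidegree (a, b), then a + b + 1
Laplacians kill [h * chi], since each of them moves a derivative onto [chi]
([iter_zlaplacian_harmonicM]).  By the Almansi decomposition ([almansi_ind]),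
[h * chi] is therefore on the sphere a sum of members of H(m + a - j, m + b - j)
with j <= a + b, all annihilated by [mubar] when m is large.  So the integral of
[g * chi] against [mubar], for [g] balanced, is a finite linear combination of
scalar products <g, e_i> in L^2(sigma) ([balanced_expansion]): against
circle-invariant functions, [chi * mubar] has a polynomial density with respect
to [sigma].

This identity passes to bounded pointwise limits of balanced polynomials.  If
[G] is a [sigma]-null set of the sigma-algebra that they generate, the integral
of [chi] over [G] against [mubar] is thus 0 for all polynomials [chi]
([baire_balanced_null]).  As the bounded pointwise limits of all polynomials
contain the indicators of the Borel sets ([measurable_baire]), [mu] vanishes on
the Borel subsets of [G] ([cmeasure_null]).

It remains to enclose a set of Hausdorff dimension less than 2n - 2 in such a
[G] ([null_hull]).  A set of small diameter d that contains w lies in the tube of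
all z with |<z, w>|^2 >= 1 - d^2.  This tube is defined by a balanced polynomial, and
its measure is at most a constant times d^(2n - 2) ([tube_measure_le]): this is
the Chebyshev inequality for the moments of |<z, w>|^2, the k-th of which is
k! (n - 1)! / (k + n - 1)!.

All that is needed about integrals of polynomials follows from the single
identity [sphere_divergence], an infinitesimal form of rotation invariance: the
mean of div V over the unit sphere of R^N is N - 1 + m times the mean of x . V
when V is homogeneous of degree m.  It gives the orthogonality of harmonic
polynomials of different degrees, the fact that only 0 has norm 0 among them
([mean_definite]), and the moments above. *)

Module Harmonics.
Import Order.TTheory GRing.Theory Num.Theory mpoly MPolyDefs.
Local Open Scope ring_scope.
Local Open Scope complex_scope.

(** * Euler field and infinitesimal rotations *)

Section Generalities.
Variables (K : comNzRingType) (N : nat).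
Implicit Types P Q : {mpoly K[N]}.

Lemma mpoly_ring_ind (Pr : {mpoly K[N]} -> Prop) :
  (forall c, Pr c%:MP) -> (forall k, Pr 'X_k) ->
  (forall P Q, Pr P -> Pr Q -> Pr (P + Q)) ->
  (forall P Q, Pr P -> Pr Q -> Pr (P * Q)) -> forall P, Pr P.
Proof.
move=> hC hX hD hM; elim/mpolyind => [|c m P _ _ hP]; first by rewrite -mpolyC0.
apply: (hD _ _) => //; rewrite -mul_mpolyC; apply: (hM _ _) => //.
rewrite mpolyXE_id; apply: (big_ind Pr) => [||i _]; [exact: hC|exact: hM|].
by elim: (m i) => [|d IH]; [exact: hC|rewrite exprS; apply: (hM _ _)].
Qed.

Lemma submm_eq0 (m : 'X_{1..N}) : (m - m)%MM = 0%MM.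
Proof. by rewrite -{1}[m]add0m addmK. Qed.

Definition euler P : {mpoly K[N]} := \sum_k 'X_k * P^`M(k).

Lemma mcoeff_euler P m : (euler P)@_m = (mdeg m)%:R * P@_m.
Proof.
elim/mpolyind: P => [|c m' P _ _ IH].
  by rewrite /euler big1 ?mcoeff0 ?mulr0 // => k _; rewrite mderiv0 mulr0.
have -> : euler (c *: 'X_[m'] + P) = c *: ((mdeg m')%:R *: 'X_[m']) + euler P.
  rewrite /euler; under eq_bigr => k _ do rewrite mderivD mderivZ mulrDr mderivX.
  rewrite big_split /=; congr (_ + _).
  rewrite mdegE natr_sum scaler_suml scaler_sumr; apply: eq_bigr => k _.
  case: (posnP (m' k)) => [->|mk]; first by rewrite !scale0r scaler0 mulr0.
  rewrite -!scalerAr -mpolyXD addmC submK //.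
  by apply/mnm_lepP => i; rewrite mnm1E; case: eqP => // <-.
rewrite !mcoeffD !mcoeffZ mulrDr IH mcoeffX; congr (_ + _).
by case: (eqVneq m' m) => [->|_] /=; [rewrite !mulr1 mulrC|rewrite !mulr0].
Qed.

Lemma eulerM P Q : euler (P * Q) = euler P * Q + P * euler Q.
Proof.
rewrite /euler mulr_suml mulr_sumr -big_split /=; apply: eq_bigr => k _.
by rewrite mderivM; ring.
Qed.

Lemma eulerB P Q : euler (P - Q) = euler P - euler Q.
Proof.
by rewrite /euler -sumrB; apply: eq_bigr => k _; rewrite mderivB mulrBr.
Qed.

Lemma mderiv_euler P k : (euler P)^`M(k) = P^`M(k) + euler P^`M(k).
Proof.
rewrite /euler linear_sum /=.
under eq_bigr => j _ do rewrite mderivM mderivX (mderiv_comm j k).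
rewrite big_split /=; congr (_ + _).
rewrite (bigD1 k) //= big1 ?addr0 => [|j jk].
  by rewrite mnm1E eqxx scale1r submm_eq0 mpolyX0 mul1r.
by rewrite mnm1E (negPf jk) scale0r mul0r.
Qed.

Lemma mderivXU j k : ('X_j : {mpoly K[N]})^`M(k) = (j == k)%:R.
Proof.
rewrite mderivX mnm1E; case: eqP => [->|_]; last by rewrite scale0r.
by rewrite submm_eq0 mpolyX0 scale1r.
Qed.

(** The derivative at 0 along the rotations of the plane of the coordinates
[j] and [k]. *)
Definition rot_deriv j k P : {mpoly K[N]} := 'X_j * P^`M(k) - 'X_k * P^`M(j).

Lemma rot_derivC j k c : rot_deriv j k c%:MP = 0.
Proof. by rewrite /rot_deriv (mderivC k) (mderivC j) !mulr0 subrr. Qed.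

Lemma rot_derivD j k P Q :
  rot_deriv j k (P + Q) = rot_deriv j k P + rot_deriv j k Q.
Proof.
rewrite /rot_deriv (mderivD k P Q) (mderivD j P Q).
by move: P^`M(k) P^`M(j) Q^`M(k) Q^`M(j) => a b c d; ring.
Qed.

Lemma rot_derivM j k P Q :
  rot_deriv j k (P * Q) = P * rot_deriv j k Q + rot_deriv j k P * Q.
Proof.
rewrite /rot_deriv (mderivM k P Q) (mderivM j P Q).
by move: P^`M(k) P^`M(j) Q^`M(k) Q^`M(j) => a b c d; ring.
Qed.

Lemma rot_derivX j k i : j != k -> rot_deriv j k 'X_i =
  if i == j then - 'X_k else if i == k then 'X_j else 0.
Proof.
move=> jk; rewrite /rot_deriv !mderivXU; have [->|ij] := eqVneq i j.
  by rewrite (negPf jk) mulr0 sub0r mulr1.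
by case: eqVneq => _; rewrite !mulr0 ?mulr1 subr0.
Qed.

End Generalities.

(** * Means of polynomials over the sphere *)

Section SphericalMean.
Variables (R : rcfType) (n : nat).
Local Notation C := R[i].
Local Notation N := (n + n)%N.
Local Notation poly := {mpoly C[N]}.

Fact conj_poly_key : unit. Proof. exact: tt. Qed.

(** The variables are real coordinates, so this conjugates the values of a
polynomial.  It is locked, as are [to_real] and [real_eval], because unification
would otherwise unfold it into a sum over monomials. *)
Definition conj_poly : poly -> poly :=
  locked_with conj_poly_key (map_mpoly conjc).

Lemma conj_polyE Q : conj_poly Q = map_mpoly conjc Q.
Proof. by rewrite /conj_poly unlock. Qed.

Lemma conj_polyM P Q : conj_poly (P * Q) = conj_poly P * conj_poly Q.
Proof. by rewrite !conj_polyE rmorphM. Qed.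

Lemma conj_polyD P Q : conj_poly (P + Q) = conj_poly P + conj_poly Q.
Proof. by rewrite !conj_polyE rmorphD. Qed.

Lemma conj_poly0 : conj_poly 0 = 0.
Proof. by rewrite conj_polyE raddf0. Qed.

Lemma conj_poly_sum (I : Type) (r : seq I) (p : pred I) (F : I -> poly) :
  conj_poly (\sum_(i <- r | p i) F i) = \sum_(i <- r | p i) conj_poly (F i).
Proof. exact: (big_morph conj_poly conj_polyD conj_poly0). Qed.

Lemma conj_polyZ c P : conj_poly (c *: P) = c^* *: conj_poly P.
Proof. by rewrite !conj_polyE map_mpolyZ. Qed.

Lemma conj_polyK : involutive conj_poly.
Proof.
by move=> P; apply/mpolyP => m; rewrite !conj_polyE !mcoeff_map_mpoly /= conjcK.
Qed.

Lemma conj_polyX m : conj_poly 'X_[m] = 'X_[m].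
Proof. by rewrite conj_polyE map_mpolyX. Qed.

Lemma conj_polyC c : conj_poly c%:MP = (c^*)%:MP.
Proof. by rewrite conj_polyE map_mpolyC. Qed.

Lemma mderiv_conj_poly P k : (conj_poly P)^`M(k) = conj_poly P^`M(k).
Proof.
apply/mpolyP => m; rewrite !conj_polyE mcoeff_mderiv !mcoeff_map_mpoly mcoeff_mderiv.
by rewrite raddfMn.
Qed.

Lemma euler_conj_poly P : euler (conj_poly P) = conj_poly (euler P).
Proof.
rewrite /euler conj_poly_sum; apply: eq_bigr => k _.
by rewrite conj_polyM mderiv_conj_poly conj_polyX.
Qed.

Lemma laplacian_conj_poly (P : poly) :
  laplacian (conj_poly P) = conj_poly (laplacian P).
Proof.
rewrite /laplacian conj_poly_sum; apply: eq_bigr => k _.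
by rewrite !mderiv_conj_poly.
Qed.

Lemma laplacianM (P Q : poly) :
  laplacian (P * Q) = laplacian P * Q + P * laplacian Q +
  2%:R *: \sum_k (P^`M(k) * Q^`M(k)).
Proof.
rewrite /laplacian mulr_suml mulr_sumr scaler_sumr -!big_split /=.
apply: eq_bigr => k _; rewrite mderivM mderivD (mderivM k P^`M(k)) (mderivM k P).
by move: P^`M(k)^`M(k) P^`M(k) Q^`M(k)^`M(k) Q^`M(k) => a b c d; rewrite scaler_nat; ring.
Qed.

(** These are the properties of integration against a rotation-invariant
probability that the algebra below relies on.  Invariance enters only through
its derivative, and neither definiteness nor any value is postulated besides
the mean of 1. *)
Record spherical_mean (T : poly -> C) : Prop := SphericalMean {
  mean_linear : forall c P Q, T (c *: P + Q) = c * T P + T Q;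
  mean_rot : forall j k Q, T (rot_deriv j k Q) = 0;
  mean_sphere : forall Q, T ((\sum_k 'X_k ^+ 2) * Q) = T Q;
  mean_conj : forall Q, T (conj_poly Q) = (T Q)^*;
  mean_ge0 : forall Q, 0 <= T (Q * conj_poly Q);
  mean1 : T 1 = 1 }.

Section Theory.
Variables (T : poly -> C) (HT : spherical_mean T).

Lemma mean0 : T 0 = 0.
Proof. by have := mean_linear HT (-1) 0 0; rewrite scaler0 addr0 mulN1r addNr. Qed.

Lemma meanD P Q : T (P + Q) = T P + T Q.
Proof. by rewrite -{1}[P]scale1r (mean_linear HT) mul1r. Qed.

Lemma meanZ c P : T (c *: P) = c * T P.
Proof. by rewrite -[c *: P]addr0 (mean_linear HT) mean0 addr0. Qed.

Lemma meanN P : T (- P) = - T P.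
Proof. by rewrite -scaleN1r meanZ mulN1r. Qed.

Lemma meanB P Q : T (P - Q) = T P - T Q.
Proof. by rewrite meanD meanN. Qed.

Lemma mean_sum (I : Type) (r : seq I) (P : pred I) (F : I -> poly) :
  T (\sum_(i <- r | P i) F i) = \sum_(i <- r | P i) T (F i).
Proof. by apply: (big_morph T meanD mean0). Qed.

(** The mean kills the rotation derivative of x_j V_k in the plane (j, k).
Summing over all j and k yields the mean of |x|^2 div V - (N - 1 + c) x . V, and
|x|^2 can be dropped. *)
Lemma sphere_divergence (V : 'I_N -> poly) (c : C) :
  (forall k, euler (V k) = c *: V k) ->
  T (\sum_k (V k)^`M(k)) = (N%:R - 1 + c) * T (\sum_k 'X_k * V k).
Proof.
move=> hV; set W := \sum_k 'X_k * V k; set D := \sum_k (V k)^`M(k).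
pose F j k := 'X_j * ('X_j * V k)^`M(k) - 'X_k * ('X_j * V k)^`M(j).
have: T (\sum_j \sum_k F j k) = 0.
  rewrite mean_sum big1 // => j _; rewrite mean_sum big1 // => k _.
  exact: mean_rot.
have -> : \sum_j \sum_k F j k
    = (\sum_k 'X_k ^+ 2) * D - (N%:R - 1 + c) *: W.
  have -> : \sum_j \sum_k F j k = \sum_j \sum_k ('X_j ^+ 2 * (V k)^`M(k))
     + \sum_j \sum_k ((j == k)%:R * ('X_j * V k))
     - \sum_(j < N) \sum_k ('X_k * V k) - \sum_k 'X_k * euler (V k).
    rewrite [X in _ - X](_ : _ = \sum_j \sum_k 'X_k * ('X_j * (V k)^`M(j))).
      rewrite -!big_split -!sumrB /=; apply: eq_bigr => j _.
      rewrite -!big_split -!sumrB /=; apply: eq_bigr => k _.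
      by rewrite /F !mderivM !mderivXU eqxx mul1r; ring.
    rewrite exchange_big /=; apply: eq_bigr => k _.
    by rewrite -mulr_sumr.
  rewrite [X in X + _ - _ - _](_ : _ = (\sum_k 'X_k ^+ 2) * D); last first.
    by rewrite mulr_suml; apply: eq_bigr => j _; rewrite mulr_sumr.
  rewrite [X in _ + X - _ - _](_ : _ = W); last first.
    apply: eq_bigr => j _; rewrite (bigD1 j) //= big1 ?eqxx ?mul1r ?addr0 //.
    by move=> k kj; rewrite eq_sym (negPf kj) mul0r.
  rewrite [X in _ - X - _](_ : _ = N%:R *: W); last first.
    by rewrite sumr_const card_ord scaler_nat.
  rewrite [X in _ - X](_ : _ = c *: W); last first.
    by rewrite scaler_sumr; apply: eq_bigr => k _; rewrite hV scalerAr.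
  by rewrite scalerDl scalerBl scale1r; ring.
by rewrite meanB meanZ (mean_sphere HT) => /subr0_eq.
Qed.

(** The divergence identity for the gradient of [P]. *)
Lemma mean_laplacian (P : poly) c : euler P = c *: P ->
  T (laplacian P) = (N%:R - 2 + c) * c * T P.
Proof.
move=> hP; rewrite /laplacian (@sphere_divergence (fun k => P^`M(k)) (c - 1)).
  by rewrite -/(euler P) hP meanZ mulrA; congr (_ * _ * _); ring.
by move=> k; have := mderiv_euler P k; rewrite hP mderivZ scalerBl scale1r => ->; ring.
Qed.

(** Green's identity: the field P grad Q - Q grad P has divergence 0. *)
Lemma mean_harmonicM (P Q : poly) d e : laplacian P = 0 -> laplacian Q = 0 ->
  euler P = d *: P -> euler Q = e *: Q ->
  (N%:R - 2 + d + e) * (e - d) * T (P * Q) = 0.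
Proof.
move=> lP lQ hP hQ.
have hk (S : poly) s k : euler S = s *: S -> euler S^`M(k) = (s - 1) *: S^`M(k).
  by move=> hS; have := mderiv_euler S k; rewrite hS mderivZ scalerBl scale1r => ->; ring.
have := @sphere_divergence (fun k => P * Q^`M(k) - Q * P^`M(k)) (d + e - 1).
have -> : \sum_k (P * Q^`M(k) - Q * P^`M(k))^`M(k) = P * laplacian Q - Q * laplacian P.
  rewrite /laplacian !mulr_sumr -sumrB; apply: eq_bigr => k _.
  rewrite mderivB (mderivM k P) (mderivM k Q) opprD addrACA [P^`M(k) * Q^`M(k)]mulrC
    subrr add0r.
  by [].
have -> : \sum_k 'X_k * (P * Q^`M(k) - Q * P^`M(k)) = (e - d) *: (P * Q).
  rewrite (_ : _ *: _ = P * euler Q - Q * euler P).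
    by rewrite /euler !mulr_sumr -sumrB; apply: eq_bigr => k _; ring.
  by rewrite hP hQ -!scalerAr [Q * P]mulrC scalerBl.
rewrite lP lQ !mulr0 subrr mean0 meanZ => -> //; first by ring.
move=> k; rewrite eulerB !eulerM hP hQ (hk Q e) // (hk P d) // -!mul_mpolyC.
by rewrite !(mpolyCD, mpolyCN, mpolyC1); ring.
Qed.

End Theory.
End SphericalMean.

Section Definite.
Variables (R : rcfType) (n : nat).
Local Notation C := R[i].
Local Notation N := (n + n)%N.
Local Notation poly := {mpoly C[N]}.
Variables (T : poly -> C) (HT : spherical_mean T).

(** The Laplacian of Q Q^* is 2 |grad Q|^2 when Q is harmonic, and its mean is a
multiple of the mean of Q Q^*.  So the partial derivatives of Q, which are
harmonic of lower degree, have norm 0 as well, and induction applies.  This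
replaces the argument that the measure has full support. *)
Lemma mean_definite d (Q : poly) : laplacian Q = 0 -> euler Q = d%:R *: Q ->
  T (Q * conj_poly Q) = 0 -> Q = 0.
Proof.
elim: d Q => [|d IH] Q lQ hQ TQ.
  have QE : Q = (Q@_0%MM)%:MP.
    apply/mpolyP => m; rewrite mcoeffC; case: eqVneq => [->|m0]; first by rewrite mulr1.
    have := congr1 (mcoeff m) hQ; rewrite mcoeff_euler scale0r mcoeff0 mulr0.
    by move=> /eqP; rewrite mulf_eq0 pnatr_eq0 mdeg_eq0 (negPf m0) => /eqP.
  move: TQ; rewrite QE conj_polyC -mpolyCM -[_%:MP]mulr1 mul_mpolyC.
  rewrite (meanZ HT) (mean1 HT) mulr1 => /eqP.
  by rewrite mulf_eq0 conjc_eq0 orbb => /eqP ->; rewrite mpolyC0.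
have hk k : euler Q^`M(k) = d%:R *: Q^`M(k).
  have := mderiv_euler Q k; rewrite hQ mderivZ mulrSr scalerDl scale1r.
  by rewrite addrC => /addrI.
have hQc : euler (conj_poly Q) = d.+1%:R *: conj_poly Q.
  by rewrite euler_conj_poly hQ conj_polyZ rmorph_nat.
have Qk0 k : T (Q^`M(k) * conj_poly Q^`M(k)) = 0.
  have : \sum_k T (Q^`M(k) * conj_poly Q^`M(k)) = 0.
    have hQQ : euler (Q * conj_poly Q) = (d.+1%:R + d.+1%:R) *: (Q * conj_poly Q).
      by rewrite eulerM hQ hQc -scalerAl -scalerAr -scalerDl.
    have : T (laplacian (Q * conj_poly Q)) = 0.
      by rewrite (mean_laplacian HT hQQ) TQ mulr0.
    rewrite laplacianM lQ laplacian_conj_poly lQ conj_poly0 mul0r mulr0 !add0r.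
    rewrite (meanZ HT) (mean_sum HT) => /eqP; rewrite mulf_eq0 pnatr_eq0 => /eqP E.
    by rewrite -[RHS]E; apply: eq_bigr => i _; rewrite mderiv_conj_poly.
  move=> /eqP; rewrite psumr_eq0 => [/allP/(_ k)|i _]; last exact: (mean_ge0 HT).
  by rewrite mem_index_enum => /(_ isT)/eqP.
have : euler Q = 0.
  have Q'0 k : Q^`M(k) = 0.
    apply: IH (hk k) (Qk0 k); have : (laplacian Q)^`M(k) = 0 by rewrite lQ mderiv0.
    rewrite /laplacian linear_sum /= => h; rewrite -[RHS]h; apply: eq_bigr => j _.
    by rewrite (mderiv_comm k j) (mderiv_comm k j).
  by rewrite /euler big1 // => k _; rewrite Q'0 mulr0.
by rewrite hQ => /eqP; rewrite scaler_eq0 pnatr_eq0 => /eqP.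
Qed.

End Definite.

(** * Complex coordinates *)

Section ComplexCoordinates.
Variables (R : rcfType) (n : nat).
Local Notation C := R[i].
Local Notation N := (n + n)%N.
Local Notation poly := {mpoly C[N]}.

Fact to_real_key : unit. Proof. exact: tt. Qed.

Definition to_real : poly -> poly :=
  locked_with to_real_key (@real_coordinates R n).

Lemma to_realE P : to_real P = real_coordinates P.
Proof. by rewrite /to_real unlock. Qed.

Implicit Types P Q : poly.

(** Variables and their conjugates are independent here, so that [dz] and [dzb]
are the Wirtinger derivatives. *)
Definition dz (j : 'I_n) P := P^`M(lshift n j).
Definition dzb (j : 'I_n) P := P^`M(rshift n j).
(** A quarter of the Laplacian; see [laplacian_to_real]. *)
Definition zlaplacian P : poly := \sum_j dzb j (dz j P).

Lemma to_realD P Q : to_real (P + Q) = to_real P + to_real Q.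
Proof. by rewrite !to_realE; exact: comp_mpolyD. Qed.

Lemma to_realB P Q : to_real (P - Q) = to_real P - to_real Q.
Proof. by rewrite !to_realE; exact: comp_mpolyB. Qed.

Lemma to_real0 : to_real 0 = 0.
Proof. by rewrite !to_realE; exact: comp_mpoly0. Qed.

Lemma to_realM P Q : to_real (P * Q) = to_real P * to_real Q.
Proof. by rewrite !to_realE; exact: rmorphM. Qed.

Lemma to_realZ c P : to_real (c *: P) = c *: to_real P.
Proof. by rewrite !to_realE; exact: comp_mpolyZ. Qed.

Lemma to_realC c : to_real c%:MP = c%:MP.
Proof. by rewrite !to_realE; exact: comp_mpolyC. Qed.

Lemma to_real_sum (I : Type) (r : seq I) (p : pred I) (F : I -> poly) :
  to_real (\sum_(i <- r | p i) F i) = \sum_(i <- r | p i) to_real (F i).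
Proof. exact: (big_morph to_real to_realD to_real0). Qed.

Lemma to_realXl j :
  to_real 'X_(lshift n j) = 'X_(lshift n j) + 'i%C *: 'X_(rshift n j).
Proof.
by rewrite to_realE /real_coordinates comp_mpolyXU -tnth_nth tnth_mktuple (unsplitK
  (inl j)).
Qed.

Lemma to_realXr j :
  to_real 'X_(rshift n j) = 'X_(lshift n j) - 'i%C *: 'X_(rshift n j).
Proof.
by rewrite to_realE /real_coordinates comp_mpolyXU -tnth_nth tnth_mktuple (unsplitK
  (inr j)).
Qed.

Lemma split_ord_ind (Pr : 'I_N -> Prop) :
  (forall j, Pr (lshift n j)) -> (forall j, Pr (rshift n j)) -> forall k, Pr k.
Proof. by move=> hl hr k; rewrite -(splitK k); case: (split k). Qed.

Lemma mderiv_to_reall j P :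
  (to_real P)^`M(lshift n j) = to_real (dz j P) + to_real (dzb j P).
Proof.
rewrite /dz /dzb; elim/mpoly_ring_ind: P => [c|k|P Q hP hQ|P Q hP hQ].
- by rewrite to_realC !mderivC to_real0 addr0.
- elim/split_ord_ind: k => i.
    rewrite to_realXl mderivD mderivZ !mderivXU !eq_shift scaler0 to_real0 !addr0.
    by case: eqP => _; rewrite ?to_real0 // -mpolyC1 to_realC.
  rewrite to_realXr mderivB mderivZ !mderivXU !eq_shift scaler0 to_real0 subr0 [in
    RHS]add0r.
  by case: eqP => _; rewrite ?to_real0 // -mpolyC1 to_realC.
- rewrite [to_real (P + Q)]to_realD 3!mderivD hP hQ.
  move: P^`M(lshift n j) P^`M(rshift n j) Q^`M(lshift n j) Q^`M(rshift n j) => a b c d.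
  by rewrite 2!to_realD addrACA.
- rewrite [to_real (P * Q)]to_realM mderivM (mderivM (lshift n j) P) (mderivM (rshift
    n j) P) hP hQ.
  move: P^`M(lshift n j) P^`M(rshift n j) Q^`M(lshift n j) Q^`M(rshift n j) => a b c d.
  by rewrite 2!to_realD 4!to_realM; ring.
Qed.

Lemma mderiv_to_realr j P :
  (to_real P)^`M(rshift n j) = 'i%C *: (to_real (dz j P) - to_real (dzb j P)).
Proof.
rewrite /dz /dzb; elim/mpoly_ring_ind: P => [c|k|P Q hP hQ|P Q hP hQ].
- by rewrite to_realC !mderivC to_real0 subr0 scaler0.
- elim/split_ord_ind: k => i.
    rewrite to_realXl mderivD mderivZ !mderivXU !eq_shift to_real0 subr0 add0r.
    by case: eqP => _; rewrite ?to_real0 // -mpolyC1 to_realC.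
  rewrite to_realXr mderivB mderivZ !mderivXU !eq_shift to_real0 !sub0r scalerN.
  by case: eqP => _; rewrite ?to_real0 // -mpolyC1 to_realC.
- rewrite [to_real (P + Q)]to_realD 3!mderivD hP hQ.
  move: P^`M(lshift n j) P^`M(rshift n j) Q^`M(lshift n j) Q^`M(rshift n j) => a b c d.
  by rewrite 2!to_realD -scalerDr opprD addrACA.
- rewrite [to_real (P * Q)]to_realM mderivM (mderivM (lshift n j) P) (mderivM (rshift
    n j) P) hP hQ.
  move: P^`M(lshift n j) P^`M(rshift n j) Q^`M(lshift n j) Q^`M(rshift n j) => a b c d.
  by rewrite 2!to_realD 4!to_realM -!mul_mpolyC; ring.
Qed.

Lemma laplacian_to_real P : laplacian (to_real P) = 4%:R *: to_real (zlaplacian P).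
Proof.
rewrite /laplacian big_split_ord /= -big_split /= /zlaplacian to_real_sum scaler_sumr.
apply: eq_bigr => j _; rewrite mderiv_to_reall mderivD 2!mderiv_to_reall.
rewrite mderiv_to_realr mderivZ mderivB 2!mderiv_to_realr -scalerBr scalerA -expr2 sqr_i.
have -> : dz j (dzb j P) = dzb j (dz j P) by rewrite /dz /dzb mderiv_comm.
by move: (to_real _) (to_real _) (to_real _) => a b c; rewrite scaleN1r scaler_nat; ring.
Qed.

Lemma euler_split P : euler P =
  \sum_(j < n) ('X_(lshift n j) * dz j P + 'X_(rshift n j) * dzb j P).
Proof. by rewrite /euler big_split_ord /= -big_split. Qed.

Lemma euler_to_real P : euler (to_real P) = to_real (euler P).
Proof.
rewrite !euler_split to_real_sum.
apply: eq_bigr => j _; rewrite (to_realD (_ * _) (_ * _)) (to_realM 'X_(lshift n j))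
  (to_realM 'X_(rshift n j)) to_realXl to_realXr.
rewrite {1}/dz {1}/dzb mderiv_to_reall mderiv_to_realr -!mul_mpolyC.
set I := ('i%C)%:MP_[N]; set a := to_real (dz j P); set b := to_real (dzb j P).
set x := 'X_(lshift n j); set y := 'X_(rshift n j).
have -> : (x + I * y) * a + (x - I * y) * b = x * (a + b) + y * (I * (a - b)) by ring.
by [].
Qed.

Lemma to_real_inj P : to_real P = 0 -> P = 0.
Proof.
pose inv (Q : poly) : poly := Q \mPo [tuple match split k with
    | inl j => 2^-1 *: ('X_(lshift n j) + 'X_(rshift n j))
    | inr j => - ('i%C / 2) *: ('X_(lshift n j) - 'X_(rshift n j)) end | k < N].
suff to_realK Q : inv (to_real Q) = Q by move=> P0;
  rewrite -(to_realK P) P0 /inv comp_mpoly0.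
have invl j : inv 'X_(lshift n j) = 2^-1 *: ('X_(lshift n j) + 'X_(rshift n j)).
  by rewrite /inv comp_mpolyXU -tnth_nth tnth_mktuple (unsplitK (inl j)).
have invr j : inv 'X_(rshift n j) = - ('i%C / 2) *: ('X_(lshift n j) - 'X_(rshift n j)).
  by rewrite /inv comp_mpolyXU -tnth_nth tnth_mktuple (unsplitK (inr j)).
have half : 2^-1 + 2^-1 = 1 :> C by rewrite -mulr2n -[_ *+ 2]mulr_natr mulVf ?pnatr_eq0.
have ii : 'i%C * - ('i%C / 2) = 2^-1 :> C.
  by rewrite mulrN mulrA -expr2 sqr_i mulN1r opprK.
elim/mpoly_ring_ind: Q => [c|k|Q1 Q2 h1 h2|Q1 Q2 h1 h2].
- by rewrite to_realC /inv comp_mpolyC.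
- elim/split_ord_ind: k => j.
    rewrite to_realXl /inv comp_mpolyD comp_mpolyZ -!/(inv _) invl invr scalerA ii.
    by rewrite -scalerDr addrACA subrr addr0 scalerDr -scalerDl half scale1r.
  rewrite to_realXr /inv comp_mpolyB comp_mpolyZ -!/(inv _) invl invr scalerA ii.
  rewrite -scalerBr opprB [X in _ + X]addrC addrACA subrr add0r.
  by rewrite scalerDr -scalerDl half scale1r.
- by rewrite to_realD /inv comp_mpolyD -!/(inv _) h1 h2.
- by rewrite to_realM /inv rmorphM /= -!/(inv _) h1 h2.
Qed.

End ComplexCoordinates.

(** * Bidegrees and the Almansi decomposition *)

Section Bidegrees.
Variables (R : rcfType) (n : nat).
Local Notation C := R[i].
Local Notation N := (n + n)%N.
Local Notation poly := {mpoly C[N]}.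
Local Notation to_real := (@to_real R n).
Local Notation zlaplacian := (@zlaplacian R n).
Implicit Types P Q : poly.

Definition zdeg (m : 'X_{1..N}) := (\sum_(j < n) m (lshift n j))%N.
Definition zbdeg (m : 'X_{1..N}) := (\sum_(j < n) m (rshift n j))%N.

Lemma zdegD m1 m2 : zdeg (m1 + m2)%MM = (zdeg m1 + zdeg m2)%N.
Proof. by rewrite /zdeg -big_split; apply: eq_bigr => j _; rewrite mnmDE. Qed.

Lemma zbdegD m1 m2 : zbdeg (m1 + m2)%MM = (zbdeg m1 + zbdeg m2)%N.
Proof. by rewrite /zbdeg -big_split; apply: eq_bigr => j _; rewrite mnmDE. Qed.

Lemma mdeg_zdeg m : mdeg m = (zdeg m + zbdeg m)%N.
Proof. by rewrite mdegE big_split_ord. Qed.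

Lemma zdegU k : zdeg U_(k)%MM = (k < n)%N.
Proof.
rewrite /zdeg; elim/split_ord_ind: k => i /=.
  rewrite ltn_ord (bigD1 i) //= big1 => [|j ji]; first by rewrite mnm1E eqxx.
  by rewrite mnm1E eq_shift eq_sym (negPf ji).
by rewrite ltnNge leq_addr big1 // => j _; rewrite mnm1E eq_shift.
Qed.

Lemma zbdegU k : zbdeg U_(k)%MM = (n <= k)%N.
Proof.
rewrite /zbdeg; elim/split_ord_ind: k => i /=; last first.
  rewrite leq_addr (bigD1 i) //= big1 => [|j ji]; first by rewrite mnm1E eqxx.
  by rewrite mnm1E eq_shift eq_sym (negPf ji).
by rewrite leqNgt ltn_ord big1 // => j _; rewrite mnm1E eq_shift.
Qed.

Local Notation bihom := (@bihomogeneous R n).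

Lemma bihom0 p q : bihom p q 0.
Proof. by move=> m; rewrite msupp0. Qed.

Lemma bihomD p q P Q : bihom p q P -> bihom p q Q -> bihom p q (P + Q).
Proof.
by move=> hP hQ m /msuppD_le; rewrite mem_cat => /orP[/hP|/hQ].
Qed.

Lemma bihomZ p q c P : bihom p q P -> bihom p q (c *: P).
Proof. by move=> hP m /msuppZ_le /hP. Qed.

Lemma bihom_sum p q (I : Type) (r : seq I) (F : I -> poly) :
  (forall i, bihom p q (F i)) -> bihom p q (\sum_(i <- r) F i).
Proof.
move=> h; apply: (big_ind (bihom p q)) => //; [exact: bihom0|exact: bihomD].
Qed.

Lemma bihomM p q p' q' P Q :
  bihom p q P -> bihom p' q' Q -> bihom (p + p') (q + q') (P * Q).
Proof.
move=> hP hQ m /msuppM_le /allpairsP [[m1 m2] /= [/hP [h1 h2] /hQ [h3 h4] ->]].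
by split; [rewrite -h1 -h3; exact: zdegD|rewrite -h2 -h4; exact: zbdegD].
Qed.

Lemma bihomX m : bihom (zdeg m) (zbdeg m) 'X_[m].
Proof. by move=> m' /mem_msuppXP <-. Qed.

Lemma msupp_mderiv P k m : m \in msupp P^`M(k) -> (m + U_(k))%MM \in msupp P.
Proof.
rewrite !mcoeff_msupp mcoeff_mderiv; apply: contraNneq => ->.
by rewrite mul0rn.
Qed.

Lemma bihom_zlaplacian p q P : bihom p q P ->
  zlaplacian P = 0 \/ [/\ (0 < p)%N, (0 < q)%N & bihom p.-1 q.-1 (zlaplacian P)].
Proof.
move=> hP; case: (eqVneq (zlaplacian P) 0) => [|nz]; [by left|right].
have hm m : m \in msupp (zlaplacian P) -> (zdeg m).+1 = p /\ (zbdeg m).+1 = q.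
  move=> /msupp_sum_le /flattenP [s /mapP [j _ ->]].
  rewrite /dzb /dz => /msupp_mderiv /msupp_mderiv /hP [h1 h2].
  by rewrite -h1 -h2 -/(zdeg _) -/(zbdeg _) !zdegD !zbdegD !zdegU !zbdegU
     /= ltn_ord leq_addr ltnNge leq_addr leqNgt ltn_ord !addn0 !addn1.
have [m hmP] : exists m, m \in msupp (zlaplacian P).
  case E : (msupp (zlaplacian P)) => [|m s]; last by exists m; rewrite inE eqxx.
  by move: nz; rewrite -msupp_eq0 E.
have [hp hq] := hm m hmP; split; [by rewrite -hp|by rewrite -hq|].
by move=> m' /hm [<- <-].
Qed.

Lemma bihom_iter_zlaplacian p q k P : bihom p q P ->
  iter k zlaplacian P = 0 \/
  [/\ (k <= p)%N, (k <= q)%N & bihom (p - k) (q - k) (iter k zlaplacian P)].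
Proof.
move=> hP; elim: k => [|k]; first by right; rewrite !subn0.
rewrite iterS => -[->|[kp kq hk]].
  by left; rewrite /zlaplacian big1 // => j _; rewrite /dzb /dz !mderiv0.
have [h|[h1 h2 h3]] := bihom_zlaplacian hk; first by left; exact: h.
right; rewrite -subn_gt0 -(subn_gt0 k q) !subnS; split; [exact: h1|exact: h2|exact: h3].
Qed.

Lemma euler_bihom p q P : bihom p q P -> euler P = (p + q)%:R *: P.
Proof.
move=> hP; apply/mpolyP => m; rewrite mcoeff_euler mcoeffZ.
case: (boolP (m \in msupp P)) => [/hP [hp hq]|]; last first.
  by move/memN_msupp_eq0 => ->; rewrite !mulr0.
by rewrite mdeg_zdeg /zdeg hp /zbdeg hq.
Qed.

(** The squared norm |z|^2, which is 1 on the sphere. *)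
Definition rho : poly := \sum_(j < n) 'X_(lshift n j) * 'X_(rshift n j).

Lemma bihom_rho : bihom 1 1 rho.
Proof.
apply: bihom_sum => j; have := bihomM (bihomX (m := U_(lshift n j))) (bihomX (m :=
  U_(rshift n j))).
by rewrite !zdegU !zbdegU /= ltn_ord leq_addr ltnNge leq_addr leqNgt ltn_ord.
Qed.

Lemma bihom1 : bihom 0 0 1.
Proof. by move=> m; rewrite msupp1 inE => /eqP ->; rewrite !big1 // => j _;
  rewrite mnm0E. Qed.

Lemma bihomXn p q P k : bihom p q P -> bihom (p * k) (q * k) (P ^+ k).
Proof.
move=> hP; elim: k => [|k IH]; first by rewrite !muln0; exact: bihom1.
by rewrite exprS !mulnS; exact: bihomM.
Qed.

Lemma to_real_rho : to_real rho = \sum_k 'X_k ^+ 2.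
Proof.
rewrite /rho to_real_sum big_split_ord /= -big_split /=; apply: eq_bigr => j _.
by rewrite to_realM to_realXl to_realXr mulrC -subr_sqr exprZn sqr_i scaleN1r opprK.
Qed.

Lemma zlaplacianD P Q : zlaplacian (P + Q) = zlaplacian P + zlaplacian Q.
Proof.
by rewrite /zlaplacian -big_split; apply: eq_bigr => j _; rewrite /dz /dzb !mderivD.
Qed.

Lemma zlaplacianZ c P : zlaplacian (c *: P) = c *: zlaplacian P.
Proof.
by rewrite /zlaplacian scaler_sumr; apply: eq_bigr => j _; rewrite /dz /dzb !mderivZ.
Qed.

Lemma zlaplacian0 : zlaplacian 0 = 0.
Proof. by rewrite /zlaplacian big1 // => j _; rewrite /dz /dzb !mderiv0. Qed.

Lemma iter_zlaplacianD k P Q :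
  iter k zlaplacian (P + Q) = iter k zlaplacian P + iter k zlaplacian Q.
Proof. by elim: k => //= k ->; rewrite zlaplacianD. Qed.

Lemma iter_zlaplacianZ k c P :
  iter k zlaplacian (c *: P) = c *: iter k zlaplacian P.
Proof. by elim: k => //= k ->; rewrite zlaplacianZ. Qed.

Lemma iter_zlaplacianB k P Q :
  iter k zlaplacian (P - Q) = iter k zlaplacian P - iter k zlaplacian Q.
Proof. by rewrite -[- Q]scaleN1r iter_zlaplacianD iter_zlaplacianZ scaleN1r. Qed.

Lemma iter_zlaplacian0 k : iter k zlaplacian 0 = 0.
Proof. by elim: k => //= k ->; rewrite zlaplacian0. Qed.

Lemma zlaplacianM P Q :
  zlaplacian (P * Q) = zlaplacian P * Q + P * zlaplacian Q +
  \sum_j (dz j P * dzb j Q + dzb j P * dz j Q).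
Proof.
rewrite /zlaplacian mulr_suml mulr_sumr -!big_split /=; apply: eq_bigr => j _.
rewrite /dz /dzb; move: (lshift n j) (rshift n j) => l r.
rewrite (mderivM l P Q) mderivD (mderivM r P^`M(l) Q) (mderivM r P Q^`M(l)).
move: P^`M(l)^`M(r) P^`M(l) P^`M(r) Q^`M(l)^`M(r) Q^`M(l) Q^`M(r) => a b c d e f.
by ring.
Qed.

Lemma harmonicP P : harmonic P <-> zlaplacian P = 0.
Proof.
rewrite /harmonic -to_realE laplacian_to_real; split=> [|->];
  last by rewrite to_real0 scaler0.
by move=> /eqP; rewrite scaler_eq0 pnatr_eq0 => /eqP; exact: to_real_inj.
Qed.

(** The cross terms of the Laplacian of a product add up to the Euler field,
and the Laplacian of [rho] is [n]. *)
Lemma zlaplacian_rhoM p q P : bihom p q P ->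
  zlaplacian (rho * P) = (n + p + q)%:R *: P + rho * zlaplacian P.
Proof.
move=> hP; rewrite zlaplacianM addrAC; congr (_ + _).
have dzr j : dz j rho = 'X_(rshift n j).
  rewrite /dz /rho linear_sum /= (bigD1 j) //= big1 => [|i ij].
    by rewrite mderivM !mderivXU !eq_shift eqxx mul1r mulr0 !addr0.
  by rewrite mderivM !mderivXU !eq_shift (negPf ij) mul0r mulr0 addr0.
have dzbr j : dzb j rho = 'X_(lshift n j).
  rewrite /dzb /rho linear_sum /= (bigD1 j) //= big1 => [|i ij].
    by rewrite mderivM !mderivXU !eq_shift eqxx mulr1 mul0r add0r addr0.
  by rewrite mderivM !mderivXU !eq_shift (negPf ij) mul0r mulr0 addr0.
have -> : zlaplacian rho = n%:R.
  rewrite /zlaplacian (eq_bigr (fun=> 1)) ?sumr_const ?card_ord // => j _.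
  by rewrite dzr /dzb mderivXU eqxx.
rewrite -addnA natrD scalerDl -(euler_bihom hP) euler_split mulr_natl scaler_nat.
set S1 := \sum_j _; suff -> : S1 = \sum_(j < n) ('X_(lshift n j) * dz j P +
  'X_(rshift n j) * dzb j P) by [].
by apply: eq_bigr => j _; rewrite dzr dzbr [LHS]addrC.
Qed.

Lemma zlaplacian_rhoX p q h k : (0 < n)%N -> bihom p q h -> zlaplacian h = 0 ->
  exists2 c : C, 0 < c & zlaplacian (rho ^+ k.+1 * h) = c *: (rho ^+ k * h).
Proof.
move=> n0 hh ch; elim: k => [|k [c c0 IH]].
  exists (n + p + q)%:R; first by rewrite ltr0n !addn_gt0 n0.
  by rewrite expr1 expr0 mul1r (zlaplacian_rhoM hh) ch mulr0 addr0.
have hk := bihomM (bihomXn (k := k.+1) bihom_rho) hh.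
exists ((n + (1 * k.+1 + p) + (1 * k.+1 + q))%:R + c).
  by rewrite addr_gt0 // ltr0n !addn_gt0 n0.
by rewrite exprS -mulrA (zlaplacian_rhoM hk) IH -scalerAr mulrA -exprS scalerDl.
Qed.

Lemma iter_zlaplacian_rhoX p q h k : (0 < n)%N -> bihom p q h -> zlaplacian h = 0 ->
  exists2 c : C, 0 < c & iter k zlaplacian (rho ^+ k * h) = c *: h.
Proof.
move=> n0 hh ch; elim: k => [|k [c c0 IH]].
  by exists 1; rewrite ?ltr01 // expr0 mul1r scale1r.
have [c' c'0 E] := zlaplacian_rhoX k n0 hh ch.
by exists (c' * c); rewrite ?mulr_gt0 // iterSr E iter_zlaplacianZ IH scalerA.
Qed.

(** The Almansi decomposition of a polynomial killed by [k] Laplacians, as an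
induction principle.  If k + 1 Laplacians kill P, then h, the result of k of
them, is harmonic, and k Laplacians multiply h rho^k by a positive scalar
([iter_zlaplacian_rhoX]).  Hence k Laplacians kill P minus a multiple of
h rho^k. *)
Lemma almansi_ind (K : poly -> Prop) p q k P : (0 < n)%N ->
  bihom p q P -> iter k zlaplacian P = 0 -> K 0 ->
  (forall P Q, K P -> K Q -> K (P + Q)) ->
  (forall j h, (j < k)%N -> (j <= p)%N -> (j <= q)%N ->
     bihom (p - j) (q - j) h -> harmonic h -> K (rho ^+ j * h)) ->
  K P.
Proof.
move=> n0 hP kP K0 KD; elim: k P hP kP => [|k IH] P hP kP KH.
  by move: kP => /= ->.
have IH' Q : bihom p q Q -> iter k zlaplacian Q = 0 -> K Q.
  by move=> hQ kQ; apply: IH hQ kQ _ => j h /ltnW jk; exact: KH.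
have [kP0|[kp kq hh]] := bihom_iter_zlaplacian k hP; first exact: IH'.
set h := iter k zlaplacian P in hh; have ch : zlaplacian h = 0 by exact: kP.
have [c c0 E] := iter_zlaplacian_rhoX k n0 hh ch.
rewrite -(subrK (rho ^+ k * (c^-1 *: h)) P); apply: KD.
  apply: IH'.
    apply: bihomD => //; rewrite -scaleN1r; apply: bihomZ.
    have := bihomM (bihomXn (k := k) bihom_rho) (bihomZ (c := c^-1) hh).
    by rewrite !mul1n !subnKC.
  rewrite iter_zlaplacianB -scalerAr iter_zlaplacianZ E scalerA.
  by rewrite mulVf ?gt_eqF // scale1r subrr.
apply: KH => //; first exact: bihomZ.
by apply/harmonicP; rewrite zlaplacianZ ch scaler0.
Qed.

Lemma iter_zlaplacian_eq0 p q k P : bihom p q P -> (p < k)%N ->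
  iter k zlaplacian P = 0.
Proof.
move=> hP pk; have [//|[kp]] := bihom_iter_zlaplacian k hP.
by rewrite leqNgt pk in kp.
Qed.

(** In the Laplacian of a product with a harmonic factor, each term has at least
one derivative on the other factor, and derivatives of [g] are again harmonic. *)
Lemma iter_zlaplacian_harmonicM d g chi : zlaplacian g = 0 ->
  (forall m, m \in msupp chi -> (mdeg m < d)%N) -> iter d zlaplacian (g * chi) = 0.
Proof.
elim: d g chi => [|d IH] g chi cg hchi.
  have -> : chi = 0 by apply/eqP; rewrite -msupp_eq0;
    case: (msupp chi) hchi => // m s /(_ m); rewrite inE eqxx => /(_ isT).
  by rewrite mulr0.
have hd k m : m \in msupp chi^`M(k) -> (mdeg m < d)%N.
  by move=> /msupp_mderiv /hchi; rewrite mdegD mdeg1 addn1 ltnS.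
have cgk k : zlaplacian g^`M(k) = 0.
  have : (zlaplacian g)^`M(k) = 0 by rewrite cg mderiv0.
  rewrite /zlaplacian linear_sum /= => h; rewrite -[RHS]h; apply: eq_bigr => j _.
  by rewrite /dz /dzb (mderiv_comm k) (mderiv_comm k).
rewrite iterSr zlaplacianM cg mul0r add0r iter_zlaplacianD.
rewrite IH // ?add0r; last first.
  move=> m /msupp_sum_le /flattenP [s /mapP [j _ ->]].
  by rewrite /dzb /dz => /msupp_mderiv /hd; rewrite mdegD mdeg1 addn1 => /ltnW.
apply: (big_ind (fun x => iter d zlaplacian x = 0)) => [|x y hx hy|j _].
- exact: iter_zlaplacian0.
- by rewrite iter_zlaplacianD hx hy addr0.
- by rewrite iter_zlaplacianD /dz /dzb !IH ?addr0 //; exact: hd.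
Qed.

End Bidegrees.

(** * Orthonormal bases of the spaces H(p, q) *)

Section InnerProduct.
Variables (R : rcfType) (n : nat).
Local Notation C := R[i].
Local Notation N := (n + n)%N.
Local Notation poly := {mpoly C[N]}.
Local Notation to_real := (@to_real R n).
Local Notation zlaplacian := (@zlaplacian R n).
Local Notation rho := (@rho R n).
Local Notation bihom := (@bihomogeneous R n).
Implicit Types P Q : poly.
Variables (T : poly -> C) (HT : spherical_mean T).

Definition poly_ip P Q : C := T (to_real P * conj_poly (to_real Q)).

Lemma poly_ipDl P Q S : poly_ip (P + Q) S = poly_ip P S + poly_ip Q S.
Proof. by rewrite /poly_ip to_realD mulrDl (meanD HT). Qed.

Lemma poly_ipZl c P S : poly_ip (c *: P) S = c * poly_ip P S.
Proof. by rewrite /poly_ip to_realZ -scalerAl (meanZ HT). Qed.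

Lemma poly_ipBl P Q S : poly_ip (P - Q) S = poly_ip P S - poly_ip Q S.
Proof. by rewrite -[- Q]scaleN1r poly_ipDl poly_ipZl mulN1r. Qed.

Lemma poly_ip0l S : poly_ip 0 S = 0.
Proof. by rewrite /poly_ip to_real0 mul0r (mean0 HT). Qed.

Lemma poly_ip_suml (I : Type) (r : seq I) (F : I -> poly) S :
  poly_ip (\sum_(i <- r) F i) S = \sum_(i <- r) poly_ip (F i) S.
Proof. exact: (big_morph (poly_ip^~ S) (fun P Q => poly_ipDl P Q S) (poly_ip0l S)). Qed.

Lemma poly_ip_conj P Q : poly_ip Q P = (poly_ip P Q)^*.
Proof. by rewrite /poly_ip -(mean_conj HT) conj_polyM conj_polyK mulrC. Qed.

Lemma poly_ip_ge0 P : 0 <= poly_ip P P.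
Proof. exact: (mean_ge0 HT). Qed.

Lemma poly_ip_rhoX k P Q : poly_ip (rho ^+ k * P) Q = poly_ip P Q.
Proof.
elim: k => [|k IH]; first by rewrite expr0 mul1r.
by rewrite exprS -mulrA -IH /poly_ip to_realM to_real_rho -mulrA (mean_sphere HT).
Qed.

Definition solid_harmonic p q P := bihom p q P /\ harmonic P.

Lemma solid_harmonicD p q P Q :
  solid_harmonic p q P -> solid_harmonic p q Q -> solid_harmonic p q (P + Q).
Proof.
move=> [hP /harmonicP cP] [hQ /harmonicP cQ]; split; first exact: bihomD.
by apply/harmonicP; rewrite zlaplacianD cP cQ addr0.
Qed.

Lemma solid_harmonicZ p q c P :
  solid_harmonic p q P -> solid_harmonic p q (c *: P).
Proof.
move=> [hP /harmonicP cP]; split; first exact: bihomZ.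
by apply/harmonicP; rewrite zlaplacianZ cP scaler0.
Qed.

Lemma solid_harmonicB p q P Q :
  solid_harmonic p q P -> solid_harmonic p q Q -> solid_harmonic p q (P - Q).
Proof.
move=> hP hQ; rewrite -[- Q]scaleN1r.
by apply: solid_harmonicD; [exact: hP|exact: solid_harmonicZ].
Qed.

Lemma solid_harmonic_sum p q (I : Type) (r : seq I) (F : I -> poly) :
  (forall i, solid_harmonic p q (F i)) -> solid_harmonic p q (\sum_(i <- r) F i).
Proof.
move=> h; apply: (big_ind (solid_harmonic p q)) => [|P Q|i _];
  [|exact: solid_harmonicD|exact: h].
by split; [exact: bihom0|apply/harmonicP; exact: zlaplacian0].
Qed.

Lemma euler_solid_harmonic p q P : solid_harmonic p q P ->
  euler (to_real P) = (p + q)%:R *: to_real P.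
Proof. by move=> [hP _]; rewrite euler_to_real (euler_bihom hP) to_realZ. Qed.

Lemma laplacian_solid_harmonic p q P :
  solid_harmonic p q P -> laplacian (to_real P) = 0.
Proof. by move=> [_ ]; rewrite /harmonic to_realE. Qed.

Lemma poly_ip_eq0 p q P : solid_harmonic p q P -> poly_ip P P = 0 -> P = 0.
Proof.
move=> hP h; apply: to_real_inj.
exact: (mean_definite HT (laplacian_solid_harmonic hP) (euler_solid_harmonic hP)).
Qed.

(** Green's identity separates total degrees only; this suffices to tell H(l, l)
from H(m, m). *)
Lemma poly_ip_ortho p q p' q' P Q : (0 < n)%N -> (p + q != p' + q')%N ->
  solid_harmonic p q P -> solid_harmonic p' q' Q -> poly_ip P Q = 0.
Proof.
move=> n0 pq hP hQ.
have lQ : laplacian (conj_poly (to_real Q)) = 0.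
  by rewrite laplacian_conj_poly (laplacian_solid_harmonic hQ) conj_poly0.
have eQ : euler (conj_poly (to_real Q)) = (p' + q')%:R *: conj_poly (to_real Q).
  by rewrite euler_conj_poly (euler_solid_harmonic hQ) conj_polyZ rmorph_nat.
have := mean_harmonicM HT (laplacian_solid_harmonic hP) lQ (euler_solid_harmonic hP) eQ.
rewrite -/(poly_ip P Q) => /eqP; rewrite mulf_eq0 => /orP[|/eqP //].
rewrite mulf_eq0 => /orP[/eqP h|]; last by rewrite subr_eq0 eqr_nat eq_sym (negPf pq).
suff : (0 : C) < N%:R - 2 + (p + q)%:R + (p' + q')%:R by rewrite h ltxx.
rewrite -addrA -natrD addrAC -natrD subr_gt0 ltr_nat.
case: (n) n0 pq => // n' _ pq; rewrite addSn addnS !addSn !ltnS lt0n.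
by apply: contraNneq pq; lia.
Qed.

Definition orthonormal p q k (e : 'I_k -> poly) :=
  (forall i, solid_harmonic p q (e i)) /\
  forall i j, poly_ip (e i) (e j) = (i == j)%:R.

(** The Gram matrix, which is the identity, factors through the space of all
polynomials of degree at most p + q. *)
Lemma orthonormal_card p q k (e : 'I_k -> poly) : orthonormal p q e ->
  (k <= #|{: 'X_{1..N < (p + q).+1}}|)%N.
Proof.
move=> [eH eo]; set D := #|_|.
pose A := \matrix_(i < k, l < D) (e i)@_(bmnm (enum_val l)).
pose B := \matrix_(l < D, j < k) poly_ip 'X_[bmnm (enum_val l)] (e j).
apply: (@mulmx1_min _ _ _ A B); apply/matrixP => i j; rewrite !mxE -eo.
have -> : e i = \sum_(m : 'X_{1..N < (p + q).+1}) (e i)@_m *: 'X_[m].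
  apply: mpolywE; rewrite msizeE; apply/bigmax_leqP_seq => m hm _.
  by have [<- <-] := (eH i).1 m hm; rewrite mdeg_zdeg.
rewrite poly_ip_suml; under [RHS]eq_bigr => m _ do rewrite poly_ipZl.
rewrite (reindex (@enum_val _ (mem {: 'X_{1..N < (p + q).+1}}))) /=.
  by apply: eq_bigr => l _; rewrite !mxE.
by exists enum_rank => x _; rewrite ?enum_valK ?enum_rankK.
Qed.

(** Gram-Schmidt: the residue of [P] is not 0, so by [poly_ip_eq0] it can be
normalized. *)
Lemma orthonormal_extend p q k (e : 'I_k -> poly) P : orthonormal p q e ->
  solid_harmonic p q P -> P != \sum_i poly_ip P (e i) *: e i ->
  exists e' : 'I_k.+1 -> poly, orthonormal p q e'.
Proof.
move=> [eH eo] hP; rewrite -subr_eq0; set Q := P - _ => Q0.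
have hQ : solid_harmonic p q Q.
  apply: solid_harmonicB; first exact: hP.
  by apply: solid_harmonic_sum => i; apply: solid_harmonicZ; exact: eH.
have Qe j : poly_ip Q (e j) = 0.
  rewrite /Q poly_ipBl poly_ip_suml (bigD1 j) //= poly_ipZl eo eqxx mulr1.
  rewrite big1 ?addr0 ?subrr // => i ij.
  by rewrite poly_ipZl eo (negPf ij) mulr0.
clearbody Q; set c := poly_ip Q Q.
have c0 : c != 0 by apply/eqP => h; move/eqP: Q0; apply; exact: (poly_ip_eq0 hQ h).
pose s := sqrtC c; pose u := s^-1 *: Q.
have s0 : 0 <= s by rewrite sqrtC_ge0; exact: poly_ip_ge0.
have ipue j : poly_ip u (e j) = 0 by rewrite poly_ipZl Qe mulr0.
have uu : poly_ip u u = 1.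
  rewrite poly_ipZl poly_ip_conj poly_ipZl -/c.
  have -> : (s^-1 * c)^* = s^-1 * c.
    by apply/CrealP/ger0_real; rewrite mulr_ge0 ?invr_ge0 //; exact: poly_ip_ge0.
  by rewrite mulrA -invfM -expr2 sqrtCK mulVf.
exists (fun i => if unlift ord_max i is Some j then e j else u).
split=> [i|i j]; first by case: (unlift _ _) => [j|]; [exact: eH|exact: solid_harmonicZ].
case: unliftP => [i'|] ->; case: unliftP => [j'|] ->.
- by rewrite eo (inj_eq (@lift_inj _ _)).
- by rewrite poly_ip_conj ipue rmorph0 eq_sym (negPf (neq_lift _ _)).
- by rewrite ipue (negPf (neq_lift _ _)).
- by rewrite uu eqxx.
Qed.

(** Orthonormal families have bounded size, so one that cannot be extended exists. *)
Lemma orthonormal_basis p q : exists k (e : 'I_k -> poly), orthonormal p q e /\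
  forall P, solid_harmonic p q P -> P = \sum_i poly_ip P (e i) *: e i.
Proof.
pose D := #|{: 'X_{1..N < (p + q).+1}}|.
suff H d k (e : 'I_k -> poly) : orthonormal p q e -> (D < k + d)%N ->
  exists k (e : 'I_k -> poly), orthonormal p q e /\
    forall P, solid_harmonic p q P -> P = \sum_i poly_ip P (e i) *: e i.
  apply: (H D.+1 0%N (fun=> 0)); last by rewrite add0n.
  by split; case.
elim: d k e => [|d IH] k e oe; rewrite ?addn0 ?addnS => Dk.
  by have := orthonormal_card oe; rewrite leqNgt Dk.
have [[P hP]|nP] := pselect (exists2 P, solid_harmonic p q P & P != \sum_i poly_ip P
  (e i) *: e i).
  by move=> /(orthonormal_extend oe hP) [e' oe']; apply: (IH k.+1 e' oe').
exists k, e; split=> // P hP; apply/eqP; apply: contra_notT nP => h.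
by exists P.
Qed.

End InnerProduct.

(** * Moments of the squared modulus of a linear form *)

Section Moments.
Variables (R : rcfType) (n : nat).
Local Notation C := R[i].
Local Notation N := (n + n)%N.
Local Notation poly := {mpoly C[N]}.
Variables (T : poly -> C) (HT : spherical_mean T).
Variable a : 'I_n -> C.
Hypothesis a1 : \sum_j a j * (a j)^* = 1.

Definition hermitian_square : poly :=
  (\sum_j a j *: 'X_(lshift n j)) * (\sum_j (a j)^* *: 'X_(rshift n j)).

Lemma mderiv_exp (P : poly) k i :
  (P ^+ k.+1)^`M(i) = k.+1%:R *: (P ^+ k * P^`M(i)).
Proof.
elim: k => [|k IH]; first by rewrite expr1 expr0 mul1r scale1r.
rewrite exprS mderivM IH -scalerAr [P * (_ * _)]mulrA -exprS [k.+2%:R]mulrS scalerDl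
  scale1r.
by rewrite [P^`M(i) * _]mulrC.
Qed.

(** With L the linear form and k + 1 the exponent, d/dz_j brings out (k + 1) a_j
and d/dzbar_j brings out (k + 1) a_j^*; the products a_j a_j^* add up to 1. *)
Lemma zlaplacian_hermitian_squareX k : zlaplacian (hermitian_square ^+ k.+1) =
  (k.+1%:R ^+ 2) *: hermitian_square ^+ k.
Proof.
rewrite /hermitian_square; set L := \sum_j _; set Lb := \sum_j _.
have Ll j : L^`M(lshift n j) = (a j)%:MP.
  rewrite /L linear_sum /= (bigD1 j) //= big1 => [|i ij].
    by rewrite mderivZ mderivXU eqxx addr0 -mul_mpolyC mulr1.
  by rewrite mderivZ mderivXU eq_shift (negPf ij) scaler0.
have Lr j : L^`M(rshift n j) = 0.
  by rewrite /L linear_sum /= big1 // => i _; rewrite mderivZ mderivXU eq_shift scaler0.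
have Lbl j : Lb^`M(lshift n j) = 0.
  by rewrite /Lb linear_sum /= big1 // => i _; rewrite mderivZ mderivXU eq_shift scaler0.
have Lbr j : Lb^`M(rshift n j) = ((a j)^*)%:MP.
  rewrite /Lb linear_sum /= (bigD1 j) //= big1 => [|i ij].
    by rewrite mderivZ mderivXU eqxx addr0 -mul_mpolyC mulr1.
  by rewrite mderivZ mderivXU eq_shift (negPf ij) scaler0.
move: L Lb Ll Lr Lbl Lbr => L Lb Ll Lr Lbl Lbr.
have z m (P : poly) i : P^`M(i) = 0 -> (P ^+ m)^`M(i) = 0.
  by case: m => [|m] h; rewrite ?expr0 ?mderiv_exp ?h ?mulr0 ?scaler0 // -mpolyC1 mderivC.
have der (A B dA dB : poly) i : A^`M(i) = dA -> B^`M(i) = dB ->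
    (A * B)^`M(i) = dA * B + A * dB by move=> <- <-; exact: mderivM.
have E1 j : dz j ((L * Lb) ^+ k.+1) = (k.+1%:R * a j) *: (L ^+ k * Lb ^+ k.+1).
  have hL := mderiv_exp L k (lshift n j); have hLb := z k.+1 _ _ (Lbl j).
  rewrite exprMn /dz (der _ _ _ _ _ hL hLb) Ll mulr0 addr0 -[_ * (a j)%:MP]mulrC
    mul_mpolyC.
  by rewrite scalerA -scalerAl.
have E2 j : dzb j (L ^+ k * Lb ^+ k.+1) = (k.+1%:R * (a j)^*) *: (L * Lb) ^+ k.
  have hLb := mderiv_exp Lb k (rshift n j); have hL := z k _ _ (Lr j).
  rewrite /dzb (der _ _ _ _ _ hL hLb) Lbr mul0r add0r -[_ * ((a j)^*)%:MP]mulrC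
    mul_mpolyC.
  by rewrite scalerA -scalerAr exprMn.
have E j : dzb j (dz j ((L * Lb) ^+ k.+1))
    = (k.+1%:R ^+ 2 * (a j * (a j)^*)) *: (L * Lb) ^+ k.
  by rewrite E1 /dzb mderivZ -/(dzb j _) E2 scalerA; congr (_ *: _); ring.
rewrite /zlaplacian (eq_bigr _ (fun j _ => E j)) -scaler_suml -mulr_sumr a1 mulr1 //.
Qed.

Lemma bihom_hermitian_squareX k : bihomogeneous k k (hermitian_square ^+ k).
Proof.
have -> : bihomogeneous k k = @bihomogeneous R n (1 * k) (1 * k) by rewrite mul1n.
apply: bihomXn; rewrite -[X in bihomogeneous X](addn0 1%N) -[X in bihomogeneous _
  X](add0n 1%N).
apply: bihomM; apply: bihom_sum => j; apply: bihomZ.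
  have := @bihomX R n U_(lshift n j).
  by rewrite zdegU zbdegU /= ltn_ord leqNgt ltn_ord.
have := @bihomX R n U_(rshift n j).
by rewrite zdegU zbdegU /= ltnNge leq_addr.
Qed.

(** By [mean_laplacian], the Laplacian above becomes a recurrence: if m_k is the
k-th moment, (k + n) m_(k+1) = (k + 1) m_k. *)
Lemma mean_hermitian_squareX k : (0 < n)%N ->
  ((k + n.-1)`!)%:R * T (to_real (hermitian_square ^+ k)) = (k`! * (n.-1)`!)%:R.
Proof.
move=> n0; elim: k => [|k IH].
  by rewrite expr0 -mpolyC1 to_realC mpolyC1 (mean1 HT) mulr1 add0n fact0 mul1n.
have hk := @bihom_hermitian_squareX k.+1.
have ek : euler (to_real (hermitian_square ^+ k.+1))
    = (k.+1 + k.+1)%:R *: to_real (hermitian_square ^+ k.+1).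
  by rewrite euler_to_real (euler_bihom hk) to_realZ.
have := mean_laplacian HT ek.
rewrite laplacian_to_real zlaplacian_hermitian_squareX to_realZ 2!(meanZ HT).
set tk1 := T (to_real (_ ^+ k.+1)); set tk := T (to_real _) in IH * => h.
have h' : (k.+1 + n.-1)%:R * tk1 = k.+1%:R * tk.
  apply: (@mulfI _ (4%:R * k.+1%:R)); first by rewrite mulf_neq0 ?pnatr_eq0.
  rewrite -[RHS]mulrA [k.+1%:R * (_ * _)]mulrA -expr2 h.
  have -> : N%:R - 2 = (n.-1)%:R * 2 :> C.
    by rewrite -[in LHS](prednK n0) natrD mulrS; ring.
  by rewrite !natrD; ring.
by rewrite addSn factS -addSn natrM -mulrA mulrCA h' mulrCA IH factS !natrM; ring.
Qed.

End Moments.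

(** * Functionals that vanish on H(p, q) near the diagonal *)

Section BalancedExpansion.
Variables (R : rcfType) (n : nat) (n_gt0 : (0 < n)%N).
Local Notation C := R[i].
Local Notation N := (n + n)%N.
Local Notation poly := {mpoly C[N]}.
Local Notation zlaplacian := (@zlaplacian R n).
Local Notation rho := (@rho R n).
Variables (T : poly -> C) (HT : spherical_mean T).
(** In the application, [Lam] integrates against the conjugate of the measure. *)
Variable Lam : poly -> C.
Hypothesis Lam_linear : forall c P Q, Lam (c *: P + Q) = c * Lam P + Lam Q.
Hypothesis Lam_sphere : forall Q, Lam (rho * Q) = Lam Q.
Hypothesis Lam_vanish : forall t, exists M, forall p q h,
  (p <= q + t)%N -> (q <= p + t)%N -> (M <= p + q)%N -> solid_harmonic p q h -> Lam h = 0.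

(** Invariance under the circle action z -> e^(it) z. *)
Definition balanced (g : poly) := forall m, m \in msupp g -> zdeg m = zbdeg m.

Lemma LamD P Q : Lam (P + Q) = Lam P + Lam Q.
Proof. by rewrite -{1}[P]scale1r Lam_linear mul1r. Qed.

Lemma Lam0 : Lam 0 = 0.
Proof. by apply: (@addrI _ (Lam 0)); rewrite -LamD !addr0. Qed.

Lemma LamZ c P : Lam (c *: P) = c * Lam P.
Proof. by rewrite -[c *: P]addr0 Lam_linear Lam0 addr0. Qed.

Lemma Lam_sum (I : Type) (r : seq I) (F : I -> poly) :
  Lam (\sum_(i <- r) F i) = \sum_(i <- r) Lam (F i).
Proof. exact: (big_morph Lam LamD Lam0). Qed.

Lemma Lam_rhoX k Q : Lam (rho ^+ k * Q) = Lam Q.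
Proof.
by elim: k => [|k IH]; rewrite ?expr0 ?mul1r // exprS -mulrA Lam_sphere.
Qed.

(** By the Almansi decomposition the product is, up to powers of [rho], a sum of
harmonic polynomials of bidegree (l + a - j, l + b - j) with j <= a + b.  These
stay within distance a + b of the diagonal and are far out when l is large. *)
Lemma Lam_harmonicMX m : exists M, forall l h,
  (M <= l)%N -> solid_harmonic l l h -> Lam (h * 'X_[m]) = 0.
Proof.
set a := zdeg m; set b := zbdeg m.
have [M hM] := Lam_vanish (a + b).
exists (M + (a + b))%N => l h lM [hh /harmonicP ch].
have hX : bihomogeneous (l + a) (l + b) (h * 'X_[m]).
  by apply: bihomM => //; exact: bihomX.
have kX : iter (a + b).+1 zlaplacian (h * 'X_[m]) = 0.
  apply: iter_zlaplacian_harmonicM => // m' /mem_msuppXP <-.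
  by rewrite mdeg_zdeg.
apply: (almansi_ind (K := fun P => Lam P = 0) n_gt0 hX kX) => [|P Q hP hQ|j g jk jp
  jq hg gg].
- exact: Lam0.
- by rewrite LamD hP hQ addr0.
rewrite Lam_rhoX; apply: hM; last by split; [exact: hg|exact: gg].
all: move: jp jq jk lM; clear; lia.
Qed.

(** A finite combination of scalar products, [s] listing the second arguments and
the coefficients. *)
Definition expansion (s : seq (poly * C)) (g : poly) : C :=
  \sum_(x <- s) x.2 * poly_ip T g x.1.

Lemma expansionD s P Q : expansion s (P + Q) = expansion s P + expansion s Q.
Proof.
by rewrite /expansion -big_split; apply: eq_bigr => x _; rewrite (poly_ipDl HT) mulrDr.
Qed.

Lemma expansion0 s : expansion s 0 = 0.
Proof. by rewrite /expansion big1 // => x _; rewrite (poly_ip0l HT) mulr0. Qed.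

Lemma expansionZ s c P : expansion s (c *: P) = c * expansion s P.
Proof.
by rewrite /expansion mulr_sumr; apply: eq_bigr => x _; rewrite (poly_ipZl HT) mulrCA.
Qed.

(** The coefficients are the values of [Lam (_ * chi)] on orthonormal bases of the
spaces H(l, l), l < M. *)
Lemma harmonic_expansion (chi : poly) M : exists s, forall l h, solid_harmonic l l h ->
  expansion s h = if (l < M)%N then Lam (h * chi) else 0.
Proof.
elim: M => [|M [s hs]]; first by exists [::] => l h _; rewrite /expansion big_nil.
have [k [e [[eH _] hb]]] := orthonormal_basis HT M M.
exists (s ++ [seq (e i, Lam (e i * chi)) | i <- index_enum 'I_k]) => l h hh.
rewrite /expansion big_cat big_map /= -/(expansion s h) (hs l h hh) ltnS.
case: (ltngtP l M) => lM.
- rewrite big1 ?addr0 // => i _; rewrite (poly_ip_ortho HT n_gt0 _ hh (eH i)) ?mulr0 //.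
  by move: lM; clear; lia.
- rewrite big1 ?addr0 // => i _; rewrite (poly_ip_ortho HT n_gt0 _ hh (eH i)) ?mulr0 //.
  by move: lM; clear; lia.
- rewrite add0r {2}(hb h) ?mulr_suml ?Lam_sum; last by rewrite -lM.
  by apply: eq_bigr => i _; rewrite -scalerAl LamZ mulrC.
Qed.

Lemma balanced_expansionX m :
  exists s, forall g, balanced g -> Lam (g * 'X_[m]) = expansion s g.
Proof.
have [M hM] := Lam_harmonicMX m.
have [s hs] := harmonic_expansion 'X_[m] M.
exists s => g hg; rewrite {1}[g]mpolyE mulr_suml Lam_sum [in RHS](mpolyE g).
rewrite (big_morph _ (expansionD s) (expansion0 s)).
rewrite !big_seq; apply: eq_bigr => m' /hg hm'.
rewrite -scalerAl LamZ expansionZ; congr (_ * _).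
have hX : @bihomogeneous R n (zdeg m') (zdeg m') 'X_[m'].
  have h := @bihomX R n m'; rewrite -hm' in h; exact: h.
have kX := @iter_zlaplacian_eq0 R n _ _ (zdeg m').+1 _ hX (ltnSn _).
apply: (almansi_ind (K := fun P => Lam (P * 'X_[m]) = expansion s P) n_gt0 hX kX).
- by rewrite mul0r Lam0 expansion0.
- by move=> P Q hP hQ; rewrite mulrDl LamD expansionD hP hQ.
move=> j h _ _ _ hh ch; have hH : solid_harmonic (zdeg m' - j) (zdeg m' - j) h by split.
rewrite -mulrA Lam_rhoX.
have -> : expansion s (rho ^+ j * h) = expansion s h.
  by apply: eq_bigr => x _; rewrite (poly_ip_rhoX HT).
rewrite (hs _ _ hH); case: ltnP => // lM.
by rewrite (hM _ _ lM hH).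
Qed.

(** Against balanced polynomials, [Lam (_ * chi)] is the scalar product with a
fixed polynomial.  Each monomial of [g] is decomposed into H(l, l), where only
finitely many l contribute. *)
Lemma balanced_expansion (chi : poly) :
  exists s, forall g, balanced g -> Lam (g * chi) = expansion s g.
Proof.
elim/mpolyind: chi => [|c m P _ _ [s hs]].
  by exists [::] => g _; rewrite mulr0 Lam0 /expansion big_nil.
have [s' hs'] := balanced_expansionX m.
exists ([seq (x.1, c * x.2) | x <- s'] ++ s) => g hg.
rewrite mulrDr LamD -scalerAr LamZ (hs g hg) (hs' g hg) /expansion big_cat big_map /=.
by congr (_ + _); rewrite mulr_sumr; apply: eq_bigr => x _; rewrite mulrA.
Qed.

End BalancedExpansion.

(** * Evaluation of polynomials and plane rotations *)

Section Evaluation.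
Variables (R : rcfType) (n : nat).
Local Notation C := R[i].
Local Notation N := (n + n)%N.
Local Notation poly := {mpoly C[N]}.
Local Notation to_real := (@to_real R n).
Implicit Types (P Q : poly) (x : 'rV[R]_N).

Fact real_eval_key : unit. Proof. exact: tt. Qed.

Definition real_eval : 'rV[R]_N -> poly -> C :=
  locked_with real_eval_key (fun x Q => Q.@[fun k => (x ord0 k)%:C]).

Lemma real_evalE x Q : real_eval x Q = Q.@[fun k => (x ord0 k)%:C].
Proof. by rewrite /real_eval unlock. Qed.

Lemma real_evalD x P Q : real_eval x (P + Q) = real_eval x P + real_eval x Q.
Proof. by rewrite !real_evalE; exact: mevalD. Qed.

Lemma real_evalM x P Q : real_eval x (P * Q) = real_eval x P * real_eval x Q.
Proof. by rewrite !real_evalE; exact: mevalM. Qed.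

Lemma real_evalB x P Q : real_eval x (P - Q) = real_eval x P - real_eval x Q.
Proof. by rewrite !real_evalE; exact: mevalB. Qed.

Lemma real_evalZ x c P : real_eval x (c *: P) = c * real_eval x P.
Proof. by rewrite !real_evalE; exact: mevalZ. Qed.

Lemma real_evalC x c : real_eval x c%:MP = c.
Proof. by rewrite !real_evalE; exact: mevalC. Qed.

Lemma real_eval1 x : real_eval x 1 = 1.
Proof. by rewrite !real_evalE; exact: meval1. Qed.

Lemma real_eval0 x : real_eval x 0 = 0.
Proof. by rewrite !real_evalE; exact: meval0. Qed.

Lemma real_evalX x k : real_eval x 'X_k = (x ord0 k)%:C.
Proof. by rewrite !real_evalE; exact: mevalXU. Qed.

Lemma real_eval_sum x (I : Type) (r : seq I) (F : I -> poly) :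
  real_eval x (\sum_(i <- r) F i) = \sum_(i <- r) real_eval x (F i).
Proof. exact: (big_morph (real_eval x) (real_evalD x) (real_eval0 x)). Qed.

Lemma real_eval_conj x Q : real_eval x (conj_poly Q) = (real_eval x Q)^*.
Proof.
elim/mpoly_ring_ind: Q => [c|k|P Q hP hQ|P Q hP hQ].
- by rewrite conj_polyC !real_evalC.
- by rewrite conj_polyX real_evalX conjc_real.
- by rewrite conj_polyD !real_evalD hP hQ rmorphD.
- by rewrite conj_polyM !real_evalM hP hQ rmorphM.
Qed.

Lemma poly_funE P x : poly_fun P x = real_eval x (to_real P).
Proof. by rewrite real_evalE to_realE. Qed.

Lemma real_eval_ind (Pr : ('rV[R]_N -> C) -> Prop) :
  (forall c, Pr (fun=> c)) -> (forall k, Pr (fun x => (x ord0 k)%:C)) ->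
  (forall f g, Pr f -> Pr g -> Pr (fun x => f x + g x)) ->
  (forall f g, Pr f -> Pr g -> Pr (fun x => f x * g x)) ->
  forall Q, Pr (real_eval^~ Q).
Proof.
move=> hC hX hD hM; elim/mpoly_ring_ind => [c|k|P Q hP hQ|P Q hP hQ].
- by under eq_fun do rewrite real_evalC; exact: hC.
- by under eq_fun do rewrite real_evalX; exact: hX.
- by under eq_fun do rewrite real_evalD; exact: hD.
- by under eq_fun do rewrite real_evalM; exact: hM.
Qed.

(** The modulus, as an element of [R]. *)
Definition cnorm (z : C) : R := complex.Re `|z|.

Lemma cnormE z : (cnorm z)%:C = `|z|.
Proof. by rewrite /cnorm normc_def. Qed.

Lemma cnormM z w : cnorm (z * w) = cnorm z * cnorm w.
Proof. by apply: (@complexI R); rewrite rmorphM /= !cnormE normrM. Qed.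

Lemma cnormD z w : cnorm (z + w) <= cnorm z + cnorm w.
Proof. by rewrite -lecR rmorphD /= !cnormE ler_normD. Qed.

Lemma cnorm_ge0 z : 0 <= cnorm z.
Proof. by rewrite -lecR cnormE; exact: normr_ge0. Qed.

Lemma cnorm_real (a : R) : cnorm a%:C = `|a|.
Proof. by apply: (@complexI R); rewrite cnormE normc_def /= expr0n addr0 sqrtr_sqr. Qed.

Lemma Re_le_cnorm z : `|complex.Re z| <= cnorm z.
Proof. by rewrite -lecR cnormE; exact: normc_ge_Re. Qed.

Lemma Im_le_cnorm z : `|complex.Im z| <= cnorm z.
Proof. by rewrite /cnorm normc_def /= -sqrtr_sqr ler_wsqrtr // lerDr sqr_ge0. Qed.

Definition plane_rot (j k : 'I_N) (c s : R) x : 'rV[R]_N :=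
  \row_i (if i == j then c * x ord0 j - s * x ord0 k
          else if i == k then s * x ord0 j + c * x ord0 k else x ord0 i).

Lemma real_eval_bounded Q : exists M : R,
  forall x, (forall i, `|x ord0 i| <= 1) -> cnorm (real_eval x Q) <= M.
Proof.
elim/mpoly_ring_ind: Q => [c|k|P Q [M hM] [M' hM']|P Q [M hM] [M' hM']].
- by exists (cnorm c) => x _; rewrite real_evalC.
- by exists 1 => x hx; rewrite real_evalX cnorm_real.
- exists (M + M') => x hx; rewrite real_evalD (le_trans (cnormD _ _)) // lerD //.
    exact: hM.
  exact: hM'.
- exists (M * M') => x hx; rewrite real_evalM cnormM ler_pM ?cnorm_ge0 //;
    [exact: hM|exact: hM'].
Qed.

Lemma taylorD (p q p' q' dp dq : C) (s M M' : R) :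
  cnorm (p' - p - s%:C * dp) <= M * s ^+ 2 ->
  cnorm (q' - q - s%:C * dq) <= M' * s ^+ 2 ->
  cnorm (p' + q' - (p + q) - s%:C * (dp + dq)) <= (M + M') * s ^+ 2.
Proof.
move=> hM hM'; rewrite (_ : _ - _ = (p' - p - s%:C * dp) + (q' - q - s%:C * dq));
  last by ring.
by rewrite mulrDl; apply: le_trans (cnormD _ _) (lerD hM hM').
Qed.

(** First-order expansions multiply, with a remainder of second order that depends
on the two factors only through bounds. *)
Lemma taylorM (p q p' q' dp dq : C) (s M M' B B' D D' : R) : s ^+ 2 <= 1 ->
  cnorm p <= B -> cnorm q <= B' -> cnorm dp <= D -> cnorm dq <= D' ->
  cnorm (p' - p - s%:C * dp) <= M * s ^+ 2 ->
  cnorm (q' - q - s%:C * dq) <= M' * s ^+ 2 ->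
  cnorm (p' * q' - p * q - s%:C * (p * dq + dp * q))
    <= (D * D' + (B + D + `|M|) * `|M'| + `|M| * (B' + D')) * s ^+ 2.
Proof.
move=> s1 hB hB' hD hD' hM hM'; have s2 : 0 <= s ^+ 2 := sqr_ge0 s.
have {}hM := le_trans hM (ler_wpM2r s2 (ler_norm M)).
have {}hM' := le_trans hM' (ler_wpM2r s2 (ler_norm M')).
move: `|M| `|M'| (normr_ge0 M) (normr_ge0 M') hM hM' => {}M {}M' M0 M'0.
set e := p' - p - s%:C * dp; set e' := q' - q - s%:C * dq => he he'.
have -> : p' * q' - p * q - s%:C * (p * dq + dp * q)
    = (s%:C * s%:C) * (dp * dq) + (p + s%:C * dp + e) * e' + e * (q + s%:C * dq).
  by rewrite /e /e'; ring.
have sn : cnorm s%:C <= 1.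
  by rewrite cnorm_real -(@ler_sqr R) ?nnegrE // real_normK ?num_real // expr1n.
have ss : cnorm s%:C * cnorm s%:C = s ^+ 2.
  by rewrite cnorm_real -expr2 real_normK ?num_real.
have := cnorm_ge0 s%:C; have := cnorm_ge0 p; have := cnorm_ge0 q.
have := cnorm_ge0 dp; have := cnorm_ge0 dq; have := cnorm_ge0 e; have := cnorm_ge0 e'.
move=> e'0 e0 dq0 dp0 q0 p0 s0.
apply: le_trans (cnormD _ _) _; rewrite [leRHS]mulrDl lerD //.
  apply: le_trans (cnormD _ _) _; rewrite [leRHS]mulrDl lerD //.
    by rewrite 3!cnormM ss mulrC ler_wpM2r // ler_pM.
  rewrite cnormM -mulrA ler_pM ?cnorm_ge0 //.
  apply: le_trans (cnormD _ _) _; rewrite lerD //.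
    apply: le_trans (cnormD _ _) _; rewrite lerD // cnormM -[leRHS]mul1r ler_pM //.
  by apply: le_trans he _; rewrite -[leRHS]mulr1 ler_wpM2l.
rewrite cnormM mulrAC ler_pM ?cnorm_ge0 //.
by apply: le_trans (cnormD _ _) _; rewrite lerD // cnormM -[leRHS]mul1r ler_pM.
Qed.

(** The bound M is uniform in x, as needed to integrate over the sphere.  The
cosine is taken nonnegative so that it differs from 1 by at most s^2. *)
Lemma plane_rot_taylor (j k : 'I_N) Q : j != k -> exists M : R,
  forall x c s, (forall i, `|x ord0 i| <= 1) -> 0 <= c -> c ^+ 2 + s ^+ 2 = 1 ->
  cnorm (real_eval (plane_rot j k c s x) Q - real_eval x Q
    - s%:C * real_eval x (rot_deriv j k Q)) <= M * s ^+ 2.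
Proof.
move=> jk; elim/mpoly_ring_ind: Q => [a|i|P Q [M hM] [M' hM']|P Q [M hM] [M' hM']].
- exists 0 => x c s _ _ _; rewrite rot_derivC real_eval0 !real_evalC mulr0 !subrr.
  by rewrite cnorm_real normr0 mul0r.
- exists 1 => x c s hx c0 cs; rewrite mul1r.
  have c1 : `|c - 1| <= s ^+ 2.
    have c1 : c <= 1 by have := sqr_ge0 s; nra.
    by rewrite ler0_norm; nra.
  have hc y : `|y| <= 1 -> `|(c - 1) * y| <= s ^+ 2.
    by move=> y1; rewrite normrM -[leRHS]mulr1 ler_pM.
  rewrite (rot_derivX _ _ jk) !real_evalX mxE; have [->|ij] := eqVneq i j.
    rewrite -[- 'X_k]sub0r real_evalB real_eval0 sub0r real_evalX.
    rewrite -!(rmorphM, rmorphB, rmorphN) /= cnorm_real.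
    by rewrite (_ : _ - _ = (c - 1) * x ord0 j) ?hc //; ring.
  have [->|ik] := eqVneq i k.
    rewrite real_evalX -!(rmorphM, rmorphB, rmorphN) /= cnorm_real.
    by rewrite (_ : _ - _ = (c - 1) * x ord0 k) ?hc //; ring.
  rewrite real_eval0 mulr0 !subrr cnorm_real normr0.
  exact: sqr_ge0.
- exists (M + M') => x c s hx c0 cs.
  rewrite (rot_derivD j k P Q) (real_evalD x (rot_deriv j k P)) (real_evalD x P)
    (real_evalD _ P).
  exact: taylorD (hM x c s hx c0 cs) (hM' x c s hx c0 cs).
- have [B hB] := real_eval_bounded P; have [B' hB'] := real_eval_bounded Q.
  have [D hD] := real_eval_bounded (rot_deriv j k P).
  have [D' hD'] := real_eval_bounded (rot_deriv j k Q).
  exists (D * D' + (B + D + `|M|) * `|M'| + `|M| * (B' + D')) => x c s hx c0 cs.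
  rewrite (rot_derivM j k P Q) (real_evalD x (P * _)) (real_evalM x P (rot_deriv _ _ _)).
  rewrite (real_evalM x (rot_deriv _ _ _) Q) (real_evalM x P) (real_evalM _ P).
  have s1 : s ^+ 2 <= 1 by have := sqr_ge0 c; lra.
  exact: (taylorM s1 (hB x hx) (hB' x hx) (hD x hx) (hD' x hx)
    (hM x c s hx c0 cs) (hM' x c s hx c0 cs)).
Qed.

End Evaluation.

(** * The algebra of balanced polynomials *)

Section Balanced.
Variables (R : rcfType) (n : nat).
Local Notation C := R[i].
Local Notation N := (n + n)%N.
Local Notation poly := {mpoly C[N]}.
Local Notation to_real := (@to_real R n).
Implicit Types P Q : poly.

Lemma to_real_surj Q : exists P, to_real P = Q.
Proof.
have half : 2^-1 + 2^-1 = 1 :> C by rewrite -mulr2n -[_ *+ 2]mulr_natr mulVf ?pnatr_eq0.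
elim/mpoly_ring_ind: Q => [c|k|P Q [P' hP] [Q' hQ]|P Q [P' hP] [Q' hQ]].
- by exists c%:MP; rewrite to_realC.
- elim/split_ord_ind: k => j.
    exists (2^-1 *: ('X_(lshift n j) + 'X_(rshift n j))).
    by rewrite to_realZ to_realD to_realXl to_realXr addrACA subrr addr0 scalerDr
      -scalerDl half scale1r.
  exists (- ('i%C / 2) *: ('X_(lshift n j) - 'X_(rshift n j))).
  have ii : - ('i%C / 2) * 'i%C = 2^-1 :> C.
    by rewrite mulNr mulrAC -expr2 sqr_i mulN1r opprK.
  rewrite to_realZ to_realB to_realXl to_realXr; set y := 'i%C *: _.
  have -> : 'X_(lshift n j) + y - ('X_(lshift n j) - y) = y + y by ring.
  by rewrite scalerDr scalerA ii -scalerDl half scale1r.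
- by exists (P' + Q'); rewrite to_realD hP hQ.
- by exists (P' * Q'); rewrite to_realM hP hQ.
Qed.

Lemma balancedC c : balanced (c%:MP : poly).
Proof.
move=> m; rewrite msuppC; case: eqP => // _; rewrite inE => /eqP ->.
by rewrite /zdeg /zbdeg !big1 // => j _; rewrite mnm0E.
Qed.

Lemma balancedD P Q : balanced P -> balanced Q -> balanced (P + Q).
Proof. by move=> hP hQ m /msuppD_le; rewrite mem_cat => /orP[/hP|/hQ]. Qed.

Lemma balancedM P Q : balanced P -> balanced Q -> balanced (P * Q).
Proof.
move=> hP hQ m /msuppM_le /allpairsP [[m1 m2] /= [/hP h1 /hQ h2 ->]].
by rewrite zdegD zbdegD h1 h2.
Qed.

Lemma balanced_bihom p P : bihomogeneous p p P -> balanced P.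
Proof. by move=> hP m /hP [h1 h2]; rewrite /zdeg /zbdeg h1 h2. Qed.

End Balanced.

End Harmonics.

From mathcomp Require Import all_classical all_reals all_analysis measurable_realfun.
Import (canonicals) mpoly.
Import Order.TTheory GRing.Theory Num.Theory.
Import numFieldNormedType.Exports.
Import Harmonics.
Local Open Scope classical_set_scope.
Local Open Scope ring_scope.

(** * Functionals continuous under bounded pointwise convergence *)

Section BoundedFunctionals.
Context {d : measure_display} {T : measurableType d} {R : realType}.
Implicit Types f g : T -> R.

Definition bounded_mfun f := measurable_fun setT f /\ exists M, forall x, `|f x| <= M.

Lemma bounded_mfun_cst (c : R) : bounded_mfun (fun=> c).
Proof. by split; [exact: measurable_cst|exists `|c|]. Qed.

Lemma bounded_mfunD f g :
  bounded_mfun f -> bounded_mfun g -> bounded_mfun (fun x => f x + g x).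
Proof.
move=> [mf [M hM]] [mg [M' hM']]; split; first exact: measurable_funD.
by exists (M + M') => x; rewrite (le_trans (ler_normD _ _))// lerD.
Qed.

Lemma bounded_mfunM f g :
  bounded_mfun f -> bounded_mfun g -> bounded_mfun (fun x => f x * g x).
Proof.
move=> [mf [M hM]] [mg [M' hM']]; split; first exact: measurable_funM.
by exists (M * M') => x; rewrite normrM ler_pM.
Qed.

Lemma bounded_mfunZ c f : bounded_mfun f -> bounded_mfun (fun x => c * f x).
Proof. by move=> hf; apply: bounded_mfunM => //; exact: bounded_mfun_cst. Qed.

Lemma bounded_mfunN f : bounded_mfun f -> bounded_mfun (fun x => - f x).
Proof.
by move=> /(bounded_mfunZ (-1)); under eq_fun do rewrite mulN1r.
Qed.

Lemma bounded_mfunB f g :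
  bounded_mfun f -> bounded_mfun g -> bounded_mfun (fun x => f x - g x).
Proof. by move=> hf /bounded_mfunN; exact: bounded_mfunD. Qed.

Lemma bounded_mfun_indic (E : set T) : measurable E -> bounded_mfun (\1_E).
Proof.
move=> mE; split; first exact: measurable_indic.
by exists 1 => x; rewrite indicE ger0_norm ?ler0n // lern1; case: (_ \in _).
Qed.

(** Integration against finite measures and against charges have these two
properties, which are stable under linear combinations and under multiplication
of the argument by a bounded function.  An identity between two such functionals
passes from an algebra to its bounded pointwise limits. *)
Record bounded_functional (Psi : (T -> R) -> R) : Prop := BoundedFunctional {
  bf_linear : forall a f g, bounded_mfun f -> bounded_mfun g ->
    Psi (fun x => a * f x + g x) = a * Psi f + Psi g;
  bf_dominated : forall (f_ : (T -> R)^nat) f M,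
    (forall k, measurable_fun setT (f_ k)) -> (forall k x, `|f_ k x| <= M) ->
    (forall x, f_ ^~ x @ \oo --> f x) -> Psi \o f_ @ \oo --> Psi f }.

Lemma bounded_mfun_integrable (m : {finite_measure set T -> \bar R}) f : bounded_mfun f ->
  m.-integrable setT (EFin \o f).
Proof.
move=> [mf [M hM]]; apply: measurable_bounded_integrable => //.
  exact: fin_num_fun_lty (@fin_num_measure _ _ _ m).
exists M; split; first exact: num_real.
by move=> x Mx y _; exact: le_trans (hM y) (ltW Mx).
Qed.

Lemma bf_Rintegral (m : {finite_measure set T -> \bar R}) :
  bounded_functional (fun f => \int[m]_x f x).
Proof.
split=> [a f g hf hg|f_ f M mf hM cf].
  by rewrite RintegralD ?RintegralZl//; apply: bounded_mfun_integrable => //;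
    exact: bounded_mfunZ.
have mlim : measurable_fun setT f.
  by apply: (measurable_fun_cvg mf) => x _; exact: cf.
have bM x : `|f x| <= M.
  by apply: (cvgr_to_le (cvg_norm (cf x))); apply: nearW => k; exact: hM.
have [|||||_ _ h] := @dominated_convergence _ T R m setT measurableT
  (fun k => EFin \o f_ k) (EFin \o f) (EFin \o cst M).
- by move=> k; exact/measurable_EFinP.
- exact/measurable_EFinP.
- by apply: aeW => x _; apply: cvg_EFin; [exact: nearW|exact: cf].
- exact/bounded_mfun_integrable/bounded_mfun_cst.
- by apply: aeW => x k _; rewrite /= lee_fin.
apply: fine_cvg; rewrite fineK //.
by apply: integrable_fin_num => //; apply: bounded_mfun_integrable; split=> //; exists M.
Qed.

Lemma bf0 Psi : bounded_functional Psi -> Psi (fun=> 0) = 0.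
Proof.
move=> h; have := bf_linear h 1 (bounded_mfun_cst 0) (bounded_mfun_cst 0).
under eq_fun do rewrite mulr0 addr0.
by rewrite mul1r -[LHS]addr0 => /addrI.
Qed.

Lemma bfZ_app Psi a f : bounded_functional Psi -> bounded_mfun f ->
  Psi (fun x => a * f x) = a * Psi f.
Proof.
move=> h hf; have := bf_linear h a hf (bounded_mfun_cst 0); rewrite (bf0 h) addr0 => <-.
by congr Psi; apply/funext => x; rewrite addr0.
Qed.

Lemma bf_add Psi Phi : bounded_functional Psi -> bounded_functional Phi ->
  bounded_functional (fun f => Psi f + Phi f).
Proof.
move=> h k; split=> [a f g hf hg|f_ f M mf hM cf].
  by rewrite (bf_linear h) // (bf_linear k) // mulrDr addrACA.
exact: cvgD (bf_dominated h mf hM cf) (bf_dominated k mf hM cf).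
Qed.

Lemma bf_scale c Psi : bounded_functional Psi ->
  bounded_functional (fun f => c * Psi f).
Proof.
move=> h; split=> [a f g hf hg|f_ f M mf hM cf].
  by rewrite (bf_linear h) // mulrDr mulrCA.
exact: cvgMr (bf_dominated h mf hM cf).
Qed.

Lemma bf_zero : bounded_functional (fun=> 0).
Proof. by split=> [*|*]; [rewrite mulr0 addr0|exact: cvg_cst]. Qed.

Lemma bf_sum (I : Type) (r : seq I) (Psi : I -> (T -> R) -> R) :
  (forall i, bounded_functional (Psi i)) ->
  bounded_functional (fun f => \sum_(i <- r) Psi i f).
Proof.
move=> h; elim: r => [|i r IH].
  by under eq_fun do rewrite big_nil; exact: bf_zero.
by under eq_fun do rewrite big_cons; exact: bf_add.
Qed.

Lemma bf_mulr Psi h : bounded_functional Psi -> bounded_mfun h ->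
  bounded_functional (fun f => Psi (fun x => f x * h x)).
Proof.
move=> hP hh; split=> [a f g hf hg|f_ f M mf hM cf].
  rewrite -(bf_linear hP); [|exact: bounded_mfunM|exact: bounded_mfunM].
  by congr Psi; apply/funext => x; rewrite mulrDl mulrA.
have [mh [M' hM']] := hh.
apply: (bf_dominated hP (f_ := fun k x => f_ k x * h x) (M := M * M')) => [k|k x|x].
- exact: measurable_funM.
- by rewrite normrM ler_pM.
- exact: cvgMl (cf x).
Qed.

Lemma bf_charge (nu : {charge set T -> \bar R}) :
  bounded_functional (charge_integral nu).
Proof.
(* [charge_integral] refers to a decomposition obtained by choice. *)
suff H P N (nuPN : hahn_decomposition nu P N) : bounded_functional
    (fun f => \int[jordan_pos nuPN]_x f x - \int[jordan_neg nuPN]_x f x) by exact: H.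
have := bf_add (bf_Rintegral (jordan_pos nuPN))
  (bf_scale (-1) (bf_Rintegral (jordan_neg nuPN))).
by under eq_fun do rewrite mulN1r.
Qed.

Lemma Rintegral_indic (m : {finite_measure set T -> \bar R}) E : measurable E ->
  \int[m]_x (\1_E x : R) = fine (m E).
Proof. by move=> mE; rewrite /Rintegral integral_indic // setIT. Qed.

Lemma charge_integral_indic (nu : {charge set T -> \bar R}) E : measurable E ->
  charge_integral nu (\1_E) = fine (nu E).
Proof.
move=> mE.
suff H P N (nuPN : hahn_decomposition nu P N) :
    \int[jordan_pos nuPN]_x (\1_E x : R) - \int[jordan_neg nuPN]_x (\1_E x : R)
    = fine (nu E) by exact: H.
rewrite !Rintegral_indic // (jordan_decomp nuPN mE) /cadd /= cscaleN1 fineB //.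
- exact: (@fin_num_measure _ _ _ (jordan_pos nuPN)).
- exact: (@fin_num_measure _ _ _ (jordan_neg nuPN)).
Qed.

End BoundedFunctionals.

(** * Bounded pointwise closure of an algebra of functions *)

Section BaireClosure.
Context {d : measure_display} {T : measurableType d} {R : realType}.
Implicit Types f g : T -> R.

(** Values are kept in the unit interval, which makes every limit a bounded one. *)
Inductive baire (A : set (T -> R)) : (T -> R) -> Prop :=
| baire_base f : A f -> (forall x, 0 <= f x <= 1) -> baire A f
| baire_lim (f_ : (T -> R)^nat) f : (forall k, baire A (f_ k)) ->
    (forall x, f_ ^~ x @ \oo --> f x) -> baire A f.

Variable A : set (T -> R).
Hypothesis A_bounded : forall f, A f -> bounded_mfun f.
Hypothesis A_cst : forall c, A (fun=> c).
Hypothesis AD : forall f g, A f -> A g -> A (fun x => f x + g x).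
Hypothesis AM : forall f g, A f -> A g -> A (fun x => f x * g x).

Lemma baire_itv f : baire A f -> forall x, 0 <= f x <= 1.
Proof.
elim=> // f_ {}f _ h cf x; apply/andP; split.
  by apply: (cvgr_to_ge (cf x)); apply: nearW => k; case/andP: (h k x).
by apply: (cvgr_to_le (cf x)); apply: nearW => k; case/andP: (h k x).
Qed.

Lemma baire_norm f : baire A f -> forall x, `|f x| <= 1.
Proof. by move=> hf x; case/andP: (baire_itv hf x) => f0 f1; rewrite ger0_norm. Qed.

Lemma baire_measurable f : baire A f -> measurable_fun setT f.
Proof.
elim=> [{}f /A_bounded [] //|f_ {}f _ h cf].
by apply: (measurable_fun_cvg h) => x _; exact: cf.
Qed.

Lemma baire_functional_eq0 Psi : bounded_functional Psi ->
  (forall f, A f -> Psi f = 0) -> forall f, baire A f -> Psi f = 0.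
Proof.
move=> hPsi h0 f; elim=> [{}f /h0 //|f_ {}f hf h cf].
have := bf_dominated hPsi (fun k => baire_measurable (hf k))
  (fun k => baire_norm (hf k)) cf.
under eq_cvg do rewrite /= h.
by move=> /(cvg_lim (@Rhausdorff R)) <-; rewrite lim_cst.
Qed.

Lemma baireM f g : baire A f -> baire A g -> baire A (fun x => f x * g x).
Proof.
move=> hf; elim: hf g => [{}f Af f01|f_ {}f hf h cf] g hg; last first.
  apply: (@baire_lim _ (fun k x => f_ k x * g x)) => [k|x]; first exact: h.
  exact: cvgMl (cf x).
elim: hg => [{}g Ag g01|g_ {}g hg h cg]; last first.
  apply: (@baire_lim _ (fun k x => f x * g_ k x)) => [k|x]; first exact: h.
  exact: cvgMr (cg x).
apply: baire_base; first exact: AM.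
move=> x; case/andP: (f01 x) => f0 f1; case/andP: (g01 x) => g0 g1.
by rewrite mulr_ge0 //= mulr_ile1.
Qed.

Lemma baire_compl f : baire A f -> baire A (fun x => 1 - f x).
Proof.
elim=> [{}f Af f01|f_ {}f hf h cf]; last first.
  apply: (@baire_lim _ (fun k x => 1 - f_ k x)) => [k|x]; first exact: h.
  by apply: cvgB; [exact: cvg_cst|exact: cf].
apply: baire_base => [|x]; last by have := f01 x; lra.
have := AD (A_cst 1) (AM (A_cst (-1)) Af).
by under eq_fun do rewrite mulN1r.
Qed.

Lemma baire1 : baire A (fun=> 1).
Proof. by apply: baire_base => [|x]; rewrite ?ler01 ?lexx. Qed.

Lemma baireX f k : baire A f -> baire A (fun x => f x ^+ k).
Proof.
move=> hf; elim: k => [|k IH]; first by under eq_fun do rewrite expr0; exact: baire1.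
by under eq_fun do rewrite exprS; exact: baireM.
Qed.

Definition baire_set (E : set T) := baire A (\1_E).

Lemma baire_setC E : baire_set E -> baire_set (~` E).
Proof.
move=> /baire_compl; rewrite /baire_set; congr (baire A).
by apply/funext => x; rewrite !indicE in_setC; case: (x \in E); rewrite ?subrr ?subr0.
Qed.

Lemma baire_setI E F : baire_set E -> baire_set F -> baire_set (E `&` F).
Proof. by move=> hE hF; rewrite /baire_set indicI; exact: baireM. Qed.

Lemma baire_setT : baire_set setT.
Proof. by rewrite /baire_set indicT; exact: baire1. Qed.

Lemma baire_bigcap (E : (set T)^nat) :
  (forall k, baire_set (E k)) -> baire_set (\bigcap_k E k).
Proof.
move=> hE; apply: (@baire_lim _ (fun k => \1_(\bigcap_(i < k) E i))).
  elim=> [|k IH]; first by rewrite bigcap_mkord big_ord0; exact: baire_setT.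
  by rewrite bigcap_mkord big_ord_recr /= -bigcap_mkord; exact: baire_setI.
move=> x; have [xE|] := pselect ((\bigcap_k E k) x).
  rewrite indicE mem_set //; apply: (cvg_near_cst); apply: nearW => k.
  by rewrite indicE mem_set // => i _; exact: xE.
move=> /[dup] nxE /existsNP [k /not_implyP [_ nEk]].
rewrite [X in _ --> X]indicE memNset //; apply: cvg_near_cst; near=> m.
rewrite indicE memNset // => /(_ k) h; apply: nEk; apply: h => /=.
by near: m; exact: nbhs_infty_gt.
Unshelve. all: by end_near. Qed.

Lemma baire_bigcup (E : (set T)^nat) :
  (forall k, baire_set (E k)) -> baire_set (\bigcup_k E k).
Proof.
move=> hE; rewrite -[\bigcup_k E k]setCK setC_bigcup; apply/baire_setC/baire_bigcap.
by move=> k; exact/baire_setC.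
Qed.

Lemma baire_set_measurable E : baire_set E -> measurable E.
Proof. by move=> h; apply/(@measurable_indicP _ _ R)/baire_measurable. Qed.

(** The powers of 1 - f^2 tend to the indicator. *)
Lemma baire_set_eq0 f : A f -> (forall x, `|f x| <= 1) ->
  baire_set [set x | f x = 0].
Proof.
move=> Af f1; apply: (@baire_lim _ (fun k x => (1 - f x * f x) ^+ k)) => [k|x].
  apply/baireX/baire_compl/baire_base => [|x]; first exact: AM.
  rewrite -expr2 sqr_ge0 -real_normK ?num_real //= exprn_ile1 //.
have [fx0|fx0] := pselect (f x = 0).
  rewrite indicE mem_set //; apply: cvg_near_cst; apply: nearW => k.
  by rewrite fx0 mul0r subr0 expr1n.
rewrite indicE memNset //; apply: cvg_expr; rewrite -expr2.
have f2 : 0 < f x ^+ 2 by rewrite exprn_even_gt0 //=; apply/eqP.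
have f21 : f x ^+ 2 <= 1 by rewrite -real_normK ?num_real // exprn_ile1.
by rewrite ger0_norm; lra.
Qed.

Lemma bernoulli_le (x : R) k : -1 <= x -> 1 + k%:R * x <= (1 + x) ^+ k.
Proof.
move=> x1; elim: k => [|k IH]; first by rewrite mul0r addr0 expr0.
rewrite exprS; have x0 : 0 <= 1 + x by lra.
apply: le_trans (ler_wpM2l x0 IH); rewrite mulrS.
have : 0 <= k%:R * x ^+ 2 by rewrite mulr_ge0 ?sqr_ge0 ?ler0n.
nra.
Qed.

(** 2^m g^m tends to 0 or to infinity according to whether g < 1/2 or g > 1/2;
Bernoulli's inequality turns this into the two limits. *)
Lemma cvg_threshold (g : R) : 0 <= g <= 1 -> g != 2^-1 ->
  (fun m => (1 - g ^+ m) ^+ (2 ^ m)) @ \oo --> (if g < 2^-1 then 1 else 0 : R).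
Proof.
move=> /andP[g0 g1]; rewrite neq_lt => /orP[glt|ggt].
  rewrite glt /=; have : (fun m => 1 - (2 * g) ^+ m) @ \oo --> (1 - 0 : R).
    apply: cvgB; first exact: cvg_cst.
    by apply: cvg_expr; rewrite ger0_norm; lra.
  rewrite subr0 => h; apply: (@squeeze_cvgr _ _ _ _ (fun m => 1 - (2 * g) ^+ m)
    (fun=> 1) _ _ _ h); last exact: cvg_cst.
  apply: nearW => m.
  have gm0 : 0 <= g ^+ m by rewrite exprn_ge0.
  have gm1 : g ^+ m <= 1 by rewrite exprn_ile1.
  apply/andP; split; last by rewrite exprn_ile1; lra.
  apply: le_trans (bernoulli_le _ _); last by lra.
  by rewrite exprMn natrX mulrN.
rewrite ltNge (ltW ggt) /=.
have [->|g_lt1] := eqVneq g 1.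
  under eq_fun => m do rewrite expr1n subrr expr0n -(subnKC (expn_gt0 2 m)).
  exact: cvg_cst.
have h0 : (fun m => ((2 * g)^-1) ^+ m) @ \oo --> (0 : R).
  apply: cvg_expr; rewrite ger0_norm ?invr_ge0 ?invf_lt1; lra.
apply: (@squeeze_cvgr _ _ _ _ (fun=> 0) _ _ _ _ _ h0); last exact: cvg_cst.
apply: nearW => m.
have gm0 : 0 <= g ^+ m by rewrite exprn_ge0.
have gm1 : g ^+ m <= 1 by rewrite exprn_ile1.
rewrite exprn_ge0 /=; last lra.
have g2 : 0 < (2 * g) ^+ m by rewrite exprn_gt0; lra.
rewrite exprVn -[_^-1]mul1r ler_pdivlMr //.
have b := @bernoulli_le (g ^+ m) (2 ^ m) _.
have b' : (2 * g) ^+ m <= (1 + g ^+ m) ^+ (2 ^ m).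
  by apply: le_trans (b _); [rewrite exprMn natrX; lra|lra].
apply: le_trans (ler_wpM2l _ b') _; first by rewrite exprn_ge0; lra.
rewrite -exprMn exprn_ile1 //; nra.
Qed.

(** Rescale f to g = (1 + f) / 2, with values in the unit interval, and apply
[cvg_threshold].  At g = 1/2 the limit there would be 1 / e, so that the zero
set of f has to be cut out by a factor. *)
Lemma baire_set_lt0 f : A f -> baire_set [set x | f x < 0].
Proof.
move=> Af; have [_ [M hM]] := A_bounded Af.
wlog hM1 : f M Af hM / M <= 1 => [H|].
  have M1 : 0 < `|M| + 1 by rewrite ltr_wpDl.
  suff : baire_set [set x | (`|M| + 1)^-1 * f x < 0].
    congr baire_set; apply/seteqP; split=> x /=.
      by rewrite pmulr_rlt0 ?invr_gt0.
    by rewrite pmulr_rlt0 ?invr_gt0.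
  apply: (H _ 1) => // [|x]; first exact: AM.
  rewrite normrM gtr0_norm ?invr_gt0 // ler_pdivrMl // mulr1.
  by rewrite (le_trans (hM x)) // (le_trans (ler_norm _)) // lerDl.
have hf x : `|f x| <= 1 := le_trans (hM x) hM1.
have f1 x : -1 <= f x <= 1 by rewrite -ler_norml.
pose g x := 2^-1 + 2^-1 * f x.
have Ag : A g by apply: AD => //; exact: AM.
have g01 x : 0 <= g x <= 1 by have := f1 x; rewrite /g; lra.
have hg : baire A g by exact: baire_base.
(* The zero set of f, where [cvg_threshold] says nothing. *)
have hZ : baire_set (~` [set x | f x = 0]) by apply/baire_setC/baire_set_eq0.
apply: (@baire_lim _ (fun m x => (1 - g x ^+ m) ^+ (2 ^ m) *
   \1_(~` [set x | f x = 0]) x)) => [k|x].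
  by apply: baireM => //; apply/baireX/baire_compl/baireX.
have [fx0|/eqP fx0] := pselect (f x = 0).
  rewrite [X in _ --> X]indicE memNset /=; last by rewrite fx0 ltxx.
  apply: cvg_near_cst; apply: nearW => k.
  by rewrite indicE memNset ?mulr0 //= fx0; apply.
have -> : \1_[set x0 | f x0 < 0] x = (if g x < 2^-1 then 1 else 0) * 1 :> R.
  rewrite indicE mulr1; case: ifPn => gx; [rewrite mem_set|rewrite memNset] => //=.
    by move: gx; rewrite /g; lra.
  by move: gx; rewrite /g -leNgt => ?; apply/negP; rewrite -leNgt; lra.
apply: cvgM.
  by apply: cvg_threshold => //; apply/eqP => h; move/eqP: fx0; apply; move: h;
    rewrite /g; lra.
by apply: cvg_near_cst; apply: nearW => k; rewrite indicE mem_set //=; exact/eqP.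
Qed.

End BaireClosure.

(** * Complex-valued functions *)

Section ComplexFunctionals.
Context {d : measure_display} {T : measurableType d} {R : realType}.
Implicit Types f g : T -> R[i].

Definition bounded_cfun f :=
  bounded_mfun (fun x => complex.Re (f x)) /\
  bounded_mfun (fun x => complex.Im (f x)).

Lemma ReD (a b : R[i]) : complex.Re (a + b) = complex.Re a + complex.Re b.
Proof. by case: a; case: b. Qed.

Lemma ImD (a b : R[i]) : complex.Im (a + b) = complex.Im a + complex.Im b.
Proof. by case: a; case: b. Qed.

Lemma ReM (a b : R[i]) : complex.Re (a * b) =
  complex.Re a * complex.Re b - complex.Im a * complex.Im b.
Proof. by case: a; case: b. Qed.

Lemma ImM (a b : R[i]) : complex.Im (a * b) =
  complex.Re a * complex.Im b + complex.Im a * complex.Re b.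
Proof. by case: a; case: b. Qed.

Lemma ReJ (a : R[i]) : complex.Re (conjc a) = complex.Re a.
Proof. by case: a. Qed.

Lemma ImJ (a : R[i]) : complex.Im (conjc a) = - complex.Im a.
Proof. by case: a. Qed.

Lemma bounded_cfun_cst (c : R[i]) : bounded_cfun (fun=> c).
Proof. by split; exact: bounded_mfun_cst. Qed.

Lemma bounded_cfunD f g :
  bounded_cfun f -> bounded_cfun g -> bounded_cfun (fun x => f x + g x).
Proof.
move=> [f1 f2] [g1 g2]; split.
  by under eq_fun do rewrite ReD; exact: bounded_mfunD.
by under eq_fun do rewrite ImD; exact: bounded_mfunD.
Qed.

Lemma bounded_cfunM f g :
  bounded_cfun f -> bounded_cfun g -> bounded_cfun (fun x => f x * g x).
Proof.
move=> [f1 f2] [g1 g2]; split.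
  by under eq_fun do rewrite ReM; apply: bounded_mfunB; exact: bounded_mfunM.
by under eq_fun do rewrite ImM; apply: bounded_mfunD; exact: bounded_mfunM.
Qed.

Lemma bounded_cfun_conj f : bounded_cfun f -> bounded_cfun (fun x => conjc (f x)).
Proof.
move=> [f1 f2]; split; first by under eq_fun do rewrite ReJ.
by under eq_fun do rewrite ImJ; exact: bounded_mfunN.
Qed.

Definition complexify (Psi : (T -> R) -> R) f : R[i] :=
  (Psi (fun x => complex.Re (f x)) +i* Psi (fun x => complex.Im (f x)))%C.

Lemma complexify_linear Psi c f g :
  bounded_functional Psi -> bounded_cfun f -> bounded_cfun g ->
  complexify Psi (fun x => c * f x + g x) = c * complexify Psi f + complexify Psi g.
Proof.
move=> h [f1 f2] [g1 g2]; apply/eqP; rewrite eq_complex; apply/andP; split; apply/eqP.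
  rewrite ReD ReM /=.
  under eq_fun do rewrite ReD ReM -mulNr -addrA.
  rewrite (bf_linear h) //; last by apply: bounded_mfunD => //; exact: bounded_mfunZ.
  by rewrite (bf_linear h) // mulNr addrA.
rewrite ImD ImM /=; under eq_fun do rewrite ImD ImM -addrA.
rewrite (bf_linear h) //; last by apply: bounded_mfunD => //; exact: bounded_mfunZ.
by rewrite (bf_linear h) // addrA.
Qed.

Lemma complexifyD Psi f g :
  bounded_functional Psi -> bounded_cfun f -> bounded_cfun g ->
  complexify Psi (fun x => f x + g x) = complexify Psi f + complexify Psi g.
Proof.
move=> h hf hg; have := complexify_linear 1 h hf hg; rewrite mul1r => <-.
by congr complexify; apply/funext => x; rewrite mul1r.
Qed.

Lemma complexify0 Psi : bounded_functional Psi -> complexify Psi (fun=> 0) = 0.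
Proof. by move=> h; rewrite /complexify !(bf0 h). Qed.

Lemma complexifyZ Psi c f : bounded_functional Psi -> bounded_cfun f ->
  complexify Psi (fun x => c * f x) = c * complexify Psi f.
Proof.
move=> h hf; have := complexify_linear c h hf (bounded_cfun_cst 0);
  rewrite (complexify0 h) addr0 => <-.
by congr complexify; apply/funext => x; rewrite addr0.
Qed.

Lemma complexify_conj Psi f : bounded_functional Psi -> bounded_cfun f ->
  complexify Psi (fun x => conjc (f x)) = conjc (complexify Psi f).
Proof.
move=> h [f1 f2]; apply/eqP; rewrite eq_complex /=; apply/andP; split; apply/eqP.
  by congr Psi; apply/funext => x; rewrite ReJ.
rewrite -mulN1r -(bfZ_app _ h f2); congr Psi; apply/funext => x.
by rewrite ImJ mulN1r.
Qed.

Lemma bounded_cfun_sum (I : Type) (r : seq I) (F : I -> T -> R[i]) :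
  (forall i, bounded_cfun (F i)) -> bounded_cfun (fun x => \sum_(i <- r) F i x).
Proof.
move=> h; elim: r => [|i r IH].
  by under eq_fun do rewrite big_nil; exact: bounded_cfun_cst.
by under eq_fun do rewrite big_cons; exact: bounded_cfunD.
Qed.

Lemma complexify_sum Psi (I : Type) (r : seq I) (F : I -> T -> R[i]) :
  bounded_functional Psi -> (forall i, bounded_cfun (F i)) ->
  complexify Psi (fun x => \sum_(i <- r) F i x) = \sum_(i <- r) complexify Psi (F i).
Proof.
move=> h hF; elim: r => [|i r IH].
  by under eq_fun do rewrite big_nil; rewrite (complexify0 h) big_nil.
under eq_fun do rewrite big_cons; rewrite complexifyD // ?IH ?big_cons //.
exact: bounded_cfun_sum.
Qed.

End ComplexFunctionals.

(** * Polynomials generate the Borel sets of the sphere *)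

Section SpherePolynomials.
Context {R : realType} {n : nat} (n_gt0 : (0 < n)%N).
Local Notation S := (sphere R n_gt0).
Local Notation N := (n + n)%N.
Local Notation C := R[i].
Local Notation poly := (mpoly.mpoly N C).

Definition coord k (z : S) : R := (set_val z : 'rV[R]_N) ord0 k.

Lemma coord_sqr_sum (z : S) : \sum_k coord k z ^+ 2 = 1.
Proof.
have h : 0 <= \sum_k coord k z ^+ 2 by apply: sumr_ge0 => k _; exact: sqr_ge0.
by rewrite -(sqr_sqrtr h); have /= := set_valP z; rewrite /enorm => ->; rewrite expr1n.
Qed.

Lemma coord_le1 (z : S) k : `|coord k z| <= 1.
Proof.
rewrite -(@ler_sqr R) ?nnegrE // real_normK ?num_real // expr1n -(coord_sqr_sum z).
by rewrite (bigD1 k) //= lerDl sumr_ge0 // => i _; exact: sqr_ge0.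
Qed.

Lemma coord_continuous_sphere k : continuous (coord k : S -> R).
Proof.
move=> z; apply: (@continuous_comp S 'rV[R]_N R set_val (fun M => M ord0 k)).
  exact: initial_continuous.
exact: coord_continuous.
Qed.

Lemma sphere_open_measurable (O : set S) : open O -> measurable O.
Proof. by move=> oO; exact: sub_sigma_algebra. Qed.

Lemma coord_measurable k : measurable_fun setT (coord k : S -> R).
Proof.
apply: (measurability _ (RGenOpens.measurableE R)).
move=> _ [_ [a [b ->] <-]]; rewrite setTI; apply: sphere_open_measurable.
by apply: open_comp => [x _|]; [exact: coord_continuous_sphere|exact: interval_open].
Qed.

Lemma bounded_mfun_coord k : bounded_mfun (coord k : S -> R).
Proof. by split; [exact: coord_measurable|exists 1 => z; exact: coord_le1]. Qed.

Definition sphere_eval (Q : poly) (z : S) : C := real_eval (set_val z) Q.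

Lemma bounded_sphere_eval Q : bounded_cfun (sphere_eval Q).
Proof.
apply: (real_eval_ind (Pr := fun f => bounded_cfun (fun z : S => f (set_val z)))) =>
  [c|k|f g|f g].
- exact: bounded_cfun_cst.
- by split; [exact: bounded_mfun_coord|exact: bounded_mfun_cst].
- exact: bounded_cfunD.
- exact: bounded_cfunM.
Qed.

Definition poly_alg : set (S -> R) :=
  [set f | exists Q, forall z, (f z)%:C%C = sphere_eval Q z].

Lemma poly_alg_bounded f : poly_alg f -> bounded_mfun f.
Proof.
move=> [Q hQ]; have [h _] := bounded_sphere_eval Q.
by move: h; under eq_fun do rewrite -hQ.
Qed.

Lemma poly_alg_cst c : poly_alg (fun=> c).
Proof. by exists (mpoly.mpolyC N c%:C%C) => z; rewrite /sphere_eval real_evalC. Qed.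

Lemma poly_algD f g : poly_alg f -> poly_alg g -> poly_alg (fun x => f x + g x).
Proof.
by move=> [P hP] [Q hQ]; exists (P + Q) => z;
  rewrite /sphere_eval real_evalD rmorphD /= hP hQ.
Qed.

Lemma poly_algM f g : poly_alg f -> poly_alg g -> poly_alg (fun x => f x * g x).
Proof.
by move=> [P hP] [Q hQ]; exists (P * Q) => z;
  rewrite /sphere_eval real_evalM rmorphM /= hP hQ.
Qed.

Lemma poly_alg_coord k : poly_alg (coord k).
Proof. by exists (mpoly.mpolyX C (mpoly.mnm1 k)) => z;
  rewrite /sphere_eval real_evalX. Qed.

Lemma poly_alg_sum (I : Type) (r : seq I) (F : I -> S -> R) :
  (forall i, poly_alg (F i)) -> poly_alg (fun x => \sum_(i <- r) F i x).
Proof.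
move=> h; elim: r => [|i r IH].
  by under eq_fun do rewrite big_nil; exact: poly_alg_cst.
by under eq_fun do rewrite big_cons; exact: poly_algD.
Qed.

Local Notation bset := (baire_set poly_alg).

Lemma ball_baire (c : 'I_N -> R) (r : R) :
  bset [set z : S | \sum_i (coord i z - c i) ^+ 2 - r < 0].
Proof.
apply: (baire_set_lt0 poly_alg_bounded poly_alg_cst poly_algD poly_algM).
apply: poly_algD; last exact: poly_alg_cst.
apply: poly_alg_sum => i; under eq_fun do rewrite expr2.
by apply: poly_algM; apply: poly_algD; exact: poly_alg_coord || exact: poly_alg_cst.
Qed.

(** An open set is the union of the balls with rational centres and radii
1 / (k + 1) that it contains, and these are countable in number. *)
Lemma open_baire (O : set S) : open O -> bset O.
Proof.
move=> oO.
have aux (a b : R) : 0 < b -> a = b * N.+1%:R -> b ^+ 2 *+ N < a ^+ 2.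
  move=> b0 ->; rewrite exprMn -[_ *+ N]mulr_natr ltr_pM2l ?exprn_gt0 //.
  by rewrite -natrX ltr_nat (leq_trans (ltnSn N)) // expnS leq_pmulr.
pose B (ck : {ffun 'I_N -> rat} * nat) : set S :=
  [set z | \sum_i (coord i z - ratr (ck.1 i)) ^+ 2 - (ck.2.+1%:R^-1) ^+ 2 < 0].
pose E m : set S := if pickle_inv m is Some ck then
  (if `[< B ck `<=` O >] then B ck else set0) else set0.
have b0 : bset set0.
  by rewrite -setCT; apply: (baire_setC poly_alg_cst poly_algD poly_algM);
    exact: (baire_setT poly_alg_cst).
have -> : O = \bigcup_m E m.
  apply/seteqP; split=> [z Oz|z [m _]]; last first.
    by rewrite /E; case: pickle_inv => // ck; case: asboolP => // h; exact: h.
  have [U oU UO] : exists2 U : set 'rV[R]_N, open U & set_val @^-1` U = O by exact: oO.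
  have Uz : U (set_val z) by move: Oz; rewrite -UO.
  have /nbhs_ballP [e /= e0 eU] : nbhs (set_val z) U by exact: open_nbhs_nbhs.
  have [k _ hk] := near_infty_natSinv_lt (PosNum (divr_gt0 e0 (ltr0n R 2))).
  have {}hk := hk k (leqnn k); rewrite /= in hk.
  set r : R := k.+1%:R^-1 in hk; have r0 : 0 < r by rewrite invr_gt0.
  (* A point within dl of z in each coordinate is within r of z. *)
  pose dl := r / N.+1%:R; have dl0 : 0 < dl by rewrite divr_gt0.
  have hc i : exists q : rat, `|coord i z - ratr q| < dl.
    have [|q] := @rat_in_itvoo R (coord i z - dl) (coord i z + dl); first lra.
    by rewrite in_itv /= => /andP[q1 q2]; exists q; rewrite ltr_norml; lra.
  have [c hc'] := choice hc.
  pose ck := ([ffun i => c i], k).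
  have Bz : B ck z.
    rewrite /B /ck /= -/r subr_lt0.
    apply: (@le_lt_trans _ _ (\sum_(i < N) dl ^+ 2)).
      apply: ler_sum => i _; rewrite ffunE -real_normK ?num_real //.
      by rewrite ler_sqr ?nnegrE // ltW.
    rewrite sumr_const card_ord; apply: aux => //.
    by rewrite /dl divfK ?pnatr_eq0.
  have BO : B ck `<=` O.
    move=> y By; rewrite -UO; apply: eU; split=> // i j.
    rewrite (ord1 i) /ball /= -/(coord j z) -/(coord j y).
    have hy : `|coord j y - ratr (c j)| < r.
      rewrite -(@ltr_sqr R) ?nnegrE //; last exact: ltW.
      rewrite real_normK ?num_real //; move: By; rewrite /B /ck /= -/r subr_lt0.
      apply: le_lt_trans; rewrite (bigD1 j) //= ffunE lerDl sumr_ge0 // => l _.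
      exact: sqr_ge0.
    have dr : dl <= r by rewrite ler_pdivrMr // ler_peMr ?ler1n ?(ltW r0).
    rewrite (_ : _ - _ = (coord j z - ratr (c j)) - (coord j y - ratr (c j)));
      last by ring.
    apply: le_lt_trans (ler_normB _ _) _; have := hc' j; lra.
  exists (pickle ck) => //; rewrite /E pickleK_inv; case: asboolP => //.
apply: (baire_bigcup poly_alg_cst poly_algD poly_algM) => m; rewrite /E.
case: pickle_inv => // ck; case: asboolP => // _.
exact: ball_baire.
Qed.

Lemma measurable_baire (E : set S) : measurable E -> bset E.
Proof.
move: E; apply: smallest_sub; last by move=> O; exact: open_baire.
split.
- by rewrite -setCT; apply: (baire_setC poly_alg_cst poly_algD poly_algM);
    exact: (baire_setT poly_alg_cst).
- by move=> E hE; rewrite setTD; apply: (baire_setC poly_alg_cst poly_algD poly_algM).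
- by move=> F hF; apply: (baire_bigcup poly_alg_cst poly_algD poly_algM).
Qed.

End SpherePolynomials.

(** * Rotation invariance of integrals of polynomials *)

Section RotationInvariance.
Context {R : realType} {n : nat} (n_gt0 : (0 < n)%N).
Local Notation S := (sphere R n_gt0).
Local Notation N := (n + n)%N.
Local Notation C := R[i].
Local Notation poly := (mpoly.mpoly N C).

Definition plane_mx (j k : 'I_N) (c s : R) : 'M[R]_N :=
  1%:M + (c - 1) *: (delta_mx j j + delta_mx k k)
  + s *: (delta_mx j k - delta_mx k j).

Lemma mul_plane_mx j k c s (x : 'rV[R]_N) : j != k ->
  x *m plane_mx j k c s = plane_rot j k c s x.
Proof.
move=> jk.
have xd a b l : (x *m delta_mx a b) ord0 l = x ord0 a * (l == b)%:R.
  rewrite mxE (bigD1 a) //= mxE eqxx big1 ?addr0 // => i ia.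
  by rewrite mxE (negPf ia) mulr0.
apply/rowP => l; rewrite /plane_mx !mulmxDr mulmx1 -!scalemxAr mulmxDr mulmxBr.
rewrite mxE mxE [X in _ + X + _]mxE [X in _ * X]mxE !xd.
rewrite [X in _ + _ + X]mxE [X in _ + _ + _ * X]mxE [X in _ + _ + _ * (_ + X)]mxE !xd
  [RHS]mxE.
have [->|lj] := eqVneq l j; first by rewrite (negPf jk) /=; ring.
by have [->|lk] := eqVneq l k; rewrite /=; ring.
Qed.

Lemma plane_rot_comp j k c s c' s' (x : 'rV[R]_N) : j != k ->
  plane_rot j k c s (plane_rot j k c' s' x) =
  plane_rot j k (c * c' - s * s') (s * c' + c * s') x.
Proof.
move=> jk; have kj : (k == j) = false by rewrite eq_sym (negPf jk).
apply/rowP => l; rewrite !mxE !eqxx kj.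
by case: (l == j); [ring|case: (l == k) => //; ring].
Qed.

Lemma plane_rot10 j k (x : 'rV[R]_N) : plane_rot j k 1 0 x = x.
Proof.
apply/rowP => l; rewrite !mxE.
case: eqVneq => [->|_]; first by rewrite mul1r mul0r subr0.
by case: eqVneq => [->|//]; rewrite mul1r mul0r add0r.
Qed.

Lemma tr_plane_mx j k c s : (plane_mx j k c s)^T = plane_mx j k c (- s).
Proof.
apply/matrixP => a b; rewrite !mxE (eq_sym b a) [(b == j) && (a == j)]andbC.
by rewrite [(b == k) && (a == k)]andbC [(b == j) && _]andbC [(b == k) && _]andbC; ring.
Qed.

Lemma mulmx_ext (A B : 'M[R]_N) : (forall x : 'rV_N, x *m A = x *m B) -> A = B.
Proof. by move=> h; apply/row_matrixP => i; rewrite !rowE h. Qed.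

Lemma plane_mx_orth j k c s : j != k -> c ^+ 2 + s ^+ 2 = 1 ->
  plane_mx j k c s *m (plane_mx j k c s)^T = 1%:M.
Proof.
move=> jk cs; rewrite tr_plane_mx; apply: mulmx_ext => x.
rewrite mulmxA !mul_plane_mx // plane_rot_comp // mulmx1 -[RHS](plane_rot10 j k).
by congr plane_rot; [rewrite -cs|]; ring.
Qed.

(** A rotation is the square of the rotation by half the angle, and the square of
the determinant of an orthogonal matrix is 1. *)
Lemma plane_mx_det j k c s : j != k -> 0 <= c -> c ^+ 2 + s ^+ 2 = 1 ->
  \det (plane_mx j k c s) = 1.
Proof.
move=> jk c0 cs; set a := Num.sqrt ((1 + c) / 2).
have a2 : a ^+ 2 = (1 + c) / 2 by rewrite sqr_sqrtr //; lra.
have a0 : 0 < a by rewrite sqrtr_gt0; lra.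
set b := s / (2 * a).
have ab : 2 * (b * a) = s by rewrite /b; field; lra.
have b2 : b ^+ 2 = (1 - c) / 2.
  apply: (@mulfI _ (4 * a ^+ 2)); first by rewrite mulf_neq0 // expf_neq0; lra.
  have -> : 4 * a ^+ 2 * b ^+ 2 = (2 * (b * a)) ^+ 2 by ring.
  by rewrite ab a2; nra.
have ab1 : a ^+ 2 + b ^+ 2 = 1 by rewrite a2 b2; lra.
have -> : plane_mx j k c s = plane_mx j k a b *m plane_mx j k a b.
  apply: mulmx_ext => x; rewrite mulmxA !mul_plane_mx // plane_rot_comp //.
  by congr plane_rot; [rewrite -!expr2 a2 b2|rewrite -ab]; lra.
have := plane_mx_orth jk ab1 => /(congr1 determinant).
by rewrite det_mulmx det_tr det1 -det_mulmx.
Qed.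

Section Rotate.
Variables (A : 'M[R]_N) (AA : A *m A^T = 1%:M).

Lemma enorm_mulmx (x : 'rV[R]_N) : enorm (x *m A) = enorm x.
Proof.
rewrite /enorm; congr Num.sqrt.
have E (y : 'rV[R]_N) : \sum_k y ord0 k ^+ 2 = (y *m y^T) ord0 ord0.
  by rewrite mxE; apply: eq_bigr => k _; rewrite mxE expr2.
by rewrite !E trmx_mul mulmxA -(mulmxA x) AA mulmx1.
Qed.

Lemma rotate_subproof (z : S) : [set x : 'rV[R]_N | enorm x = 1] (set_val z *m A).
Proof. by rewrite /= enorm_mulmx; exact: (set_valP z). Qed.

Definition rotate (z : S) : S := SigSub (mem_set (rotate_subproof z)).

Lemma rotateE z : set_val (rotate z) = set_val z *m A.
Proof. by []. Qed.

Lemma coord_rotate_measurable k : measurable_fun setT (fun z => coord k (rotate z)).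
Proof.
have -> : (fun z => coord k (rotate z)) = (fun z : S => \sum_i coord i z * A i k).
  by apply/funext => z; rewrite /coord rotateE mxE.
apply: measurable_sum => i; apply: measurable_funM; first exact: coord_measurable.
exact: measurable_cst.
Qed.

Lemma bounded_eval_rotate Q : bounded_cfun (fun z => sphere_eval Q (rotate z)).
Proof.
apply: (real_eval_ind (Pr := fun f => bounded_cfun (fun z : S => f (set_val (rotate
  z))))) => [c|k|f g|f g].
- exact: bounded_cfun_cst.
- split; last exact: bounded_mfun_cst.
  by split; [exact: coord_rotate_measurable|exists 1 => z; exact: coord_le1].
- exact: bounded_cfunD.
- exact: bounded_cfunM.
Qed.

(** Indicators of Borel sets are limits of polynomials, whose composites with a
rotation are polynomials too. *)
Lemma rotate_measurable : measurable_fun setT rotate.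
Proof.
move=> _ E mE; rewrite setTI.
have h : measurable_fun setT (fun z => \1_E (rotate z) : R).
  elim: (measurable_baire mE) => [f [Q hQ] _|f_ f _ hf cf]; last first.
    by apply: (measurable_fun_cvg hf) => z _; exact: cf.
  have [[h _] _] := bounded_eval_rotate Q.
  by move: h; under eq_fun do rewrite -hQ.
by apply/(@measurable_indicP _ _ R).
Qed.

End Rotate.

Variables (sigma : probability S R) (sigma_inv : rotation_invariant sigma).

Lemma rotate_integral (A : 'M[R]_N) (AA : A *m A^T = 1%:M) (f : S -> R) :
  \det A = 1 -> bounded_mfun f -> bounded_mfun (f \o rotate AA) ->
  \int[sigma]_z f (rotate AA z) = \int[sigma]_z f z.
Proof.
move=> dA hf hfA; rewrite /Rintegral; congr fine.
have mA := rotate_measurable AA.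
rewrite -[LHS](integral_pushforward mA (D := setT) (f := EFin \o f)) //.
- apply: eq_measure_integral => E mE _; rewrite /pushforward.
  (* Preimages under A are images under its transpose. *)
  have AA' : A^T *m (A^T)^T = 1%:M by rewrite trmxK; exact: mulmx1C.
  rewrite -[RHS](sigma_inv AA' _ mE) ?det_tr //; congr (sigma _).
  apply/seteqP; split=> [z Ez|z [x Ex zx]] /=.
    by exists (rotate AA z) => //; rewrite rotateE -mulmxA AA mulmx1.
  suff -> : rotate AA z = x by [].
  by apply: val_inj; rewrite [LHS](rotateE AA z) zx -mulmxA (mulmx1C AA) mulmx1.
- by apply/measurable_EFinP; case: hf.
- exact: (bounded_mfun_integrable sigma hfA).
Qed.

Definition sphere_mean (Q : poly) : C := cintegral sigma (sphere_eval Q).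

Let bfs := bf_Rintegral sigma.

Lemma sphere_meanE Q :
  sphere_mean Q = complexify (fun f => \int[sigma]_z f z) (sphere_eval Q).
Proof. by []. Qed.

Lemma sphere_mean_linear c P Q :
  sphere_mean (c *: P + Q) = c * sphere_mean P + sphere_mean Q.
Proof.
rewrite !sphere_meanE -complexify_linear //;
  [|exact: bounded_sphere_eval|exact: bounded_sphere_eval].
by congr complexify; apply/funext => z; rewrite /sphere_eval real_evalD real_evalZ.
Qed.

Lemma normr_Rintegral_le (f : S -> R) M : bounded_mfun f -> (forall z, `|f z| <= M) ->
  `|\int[sigma]_z f z| <= M.
Proof.
move=> hf fM; apply: le_trans (le_normr_Rintegral _ (bounded_mfun_integrable sigma
  hf)) _ => //.
have -> : M = \int[sigma]_z (cst M z).
  by rewrite Rintegral_cst //= probability_setT mulr1.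
apply: le_Rintegral => //.
  apply: (bounded_mfun_integrable sigma); split; last by exists M => z; rewrite normr_id.
  by apply: measurableT_comp => //; exact: hf.1.
exact: (bounded_mfun_integrable sigma (bounded_mfun_cst M)).
Qed.

(** As f and g have the same integral, s times the integral of h is at most M s^2
in absolute value, for all small s. *)
Lemma plane_mean_eq0 (f h : S -> R) M : bounded_mfun f -> bounded_mfun h ->
  (forall c s, 0 <= c -> c ^+ 2 + s ^+ 2 = 1 -> exists2 g : S -> R, bounded_mfun g &
    \int[sigma]_z g z = \int[sigma]_z f z /\
    forall z, `|g z - f z - s * h z| <= M * s ^+ 2) ->
  \int[sigma]_z h z = 0.
Proof.
move=> hf hh H; apply: contrapT => /eqP; rewrite -normr_gt0 => I0.
have M0 : 0 <= M.
  have [//|g' _ [_ hM]] := H 0 1 (lexx _); first by rewrite expr0n expr1n add0r.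
  by have := le_trans (normr_ge0 _) (hM point); rewrite expr1n mulr1.
set I := `|_| in I0; pose s := Num.min 1 (I / (2 * (M + 1))).
have s0 : 0 < s by rewrite lt_min ltr01 divr_gt0 //; lra.
have s1 : s <= 1 by rewrite ge_min lexx.
have sI : s * (2 * (M + 1)) <= I by rewrite -ler_pdivlMr ?ge_min ?lexx ?orbT //; lra.
have ss : s ^+ 2 <= 1 by rewrite exprn_ile1 // ltW.
have [||g' hg' [eg hM]] := H (Num.sqrt (1 - s ^+ 2)) s.
- exact: sqrtr_ge0.
- by rewrite sqr_sqrtr ?subr_ge0 // subrK.
have := normr_Rintegral_le _ hM; rewrite (_ : \int[sigma]_z _ = - s * \int[sigma]_z h z).
  rewrite normrM normrN (gtr0_norm s0) -/I => /(_ _).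
  have hb : bounded_mfun (fun z => g' z - f z - s * h z) by apply: bounded_mfunB;
    [exact: bounded_mfunB|exact: bounded_mfunZ].
  by move=> /(_ hb); rewrite expr2 mulrCA ler_pM2l // => ?; nra.
transitivity (\int[sigma]_z (- s * h z + (g' z - f z))).
  by congr Rintegral; apply/funext => z; ring.
rewrite (bf_linear bfs (- s)) //; last exact: bounded_mfunB.
rewrite -[X in _ + X](_ : 0 = _) ?addr0 //.
have := bf_linear bfs (-1) hf hg'; under eq_fun do rewrite mulN1r addrC.
by move=> ->; rewrite eg mulN1r addNr.
Qed.

Lemma sphere_mean_rot j k Q : sphere_mean (rot_deriv j k Q) = 0.
Proof.
have [->|jk] := eqVneq j k.
  rewrite /sphere_mean /rot_deriv subrr.
  have -> : sphere_eval 0 = (fun=> 0) :> (S -> C) by apply/funext => z;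
    rewrite /sphere_eval real_eval0.
  exact: (complexify0 bfs).
have [M hM] := plane_rot_taylor Q jk.
have [hQ1 hQ2] := @bounded_sphere_eval R n n_gt0 Q.
have [hD1 hD2] := @bounded_sphere_eval R n n_gt0 (rot_deriv j k Q).
apply/eqP; rewrite /sphere_mean /cintegral eq_complex /=; apply/andP; split; apply/eqP.
  apply: (plane_mean_eq0 (M := M) hQ1 hD1) => c s c0 cs.
  pose AA := plane_mx_orth jk cs; have [h1 h2] := bounded_eval_rotate AA Q.
  exists (fun z => complex.Re (sphere_eval Q (rotate AA z))) => //; split.
    by rewrite (rotate_integral (AA := AA) (f := fun z => complex.Re (sphere_eval Q
      z))) // plane_mx_det.
  move=> z; have := hM (set_val z) c s (coord_le1 z) c0 cs.
  apply: le_trans; apply: le_trans (Re_le_cnorm _).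
  by rewrite /sphere_eval rotateE mul_plane_mx // !raddfB /= ReM /= mul0r subr0.
apply: (plane_mean_eq0 (M := M) hQ2 hD2) => c s c0 cs.
pose AA := plane_mx_orth jk cs; have [h1 h2] := bounded_eval_rotate AA Q.
exists (fun z => complex.Im (sphere_eval Q (rotate AA z))) => //; split.
  by rewrite (rotate_integral (AA := AA) (f := fun z => complex.Im (sphere_eval Q
    z))) // plane_mx_det.
move=> z; have := hM (set_val z) c s (coord_le1 z) c0 cs.
apply: le_trans; apply: le_trans (Im_le_cnorm _).
by rewrite /sphere_eval rotateE mul_plane_mx // !raddfB /= ImM /= mul0r addr0.
Qed.

Lemma sphere_eval_rho (z : S) :
  sphere_eval (\sum_k mpoly.mpolyX C (mpoly.mnm1 k) ^+ 2) z = 1.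
Proof.
rewrite /sphere_eval real_eval_sum; under eq_bigr do rewrite expr2 real_evalM
  real_evalX -rmorphM -expr2.
by rewrite -rmorph_sum (coord_sqr_sum z).
Qed.

Lemma spherical_mean_sphere_mean : spherical_mean sphere_mean.
Proof.
split.
- exact: sphere_mean_linear.
- exact: sphere_mean_rot.
- move=> Q; rewrite !sphere_meanE; congr complexify; apply/funext => z.
  by rewrite {1}/sphere_eval real_evalM -/(sphere_eval _ z) sphere_eval_rho mul1r.
- move=> Q; rewrite !sphere_meanE -complexify_conj //; last exact: bounded_sphere_eval.
  by congr complexify; apply/funext => z; rewrite /sphere_eval real_eval_conj.
- move=> Q; rewrite sphere_meanE.
  have E z : sphere_eval (Q * conj_poly Q) z = (cnorm (sphere_eval Q z) ^+ 2)%:C%C.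
    by rewrite /sphere_eval real_evalM real_eval_conj rmorphXn /= cnormE sqr_normc.
  rewrite /complexify; under eq_fun do rewrite E /=;
    under [X in (_ +i* X)%C]eq_Rintegral do rewrite E.
  rewrite lecE /= [X in X == 0](bf0 bfs) eqxx /=.
  by apply: Rintegral_ge0 => z _; exact: sqr_ge0.
- rewrite sphere_meanE.
  have -> : sphere_eval 1 = (fun=> 1) :> (S -> C) by apply/funext => z;
    rewrite /sphere_eval real_eval1.
  rewrite /complexify /= (bf0 bfs) Rintegral_cst //= mul1r.
  by rewrite [X in fine X]probability_setT.
Qed.

End RotationInvariance.

(** * The reproducing kernel of H(p, q) *)

Section ReproducingKernel.
Context {R : realType} {n : nat} (n_gt0 : (0 < n)%N).
Local Notation S := (sphere R n_gt0).
Local Notation N := (n + n)%N.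
Local Notation C := R[i].
Local Notation poly := (mpoly.mpoly N C).
Variables (sigma : probability S R) (sigma_inv : rotation_invariant sigma).
Let bfs := bf_Rintegral sigma.
Let T := sphere_mean sigma.
Let HT : spherical_mean T := spherical_mean_sphere_mean sigma_inv.

Definition cintegrable (f : S -> C) :=
  sigma.-integrable setT (EFin \o (fun x => complex.Re (f x))) /\
  sigma.-integrable setT (EFin \o (fun x => complex.Im (f x))).

Lemma bounded_cintegrable f : bounded_cfun f -> cintegrable f.
Proof. by move=> [h1 h2]; split; exact: bounded_mfun_integrable. Qed.

Lemma integrable_mulr_bounded (f g : S -> R) : sigma.-integrable setT (EFin \o f) ->
  bounded_mfun g -> sigma.-integrable setT (EFin \o (fun x => f x * g x)).
Proof.
move=> hf [mg [M hM]].
have := integrableMl measurableT hf mg; apply.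
exists M; split; first exact: num_real.
by move=> x Mx y _; exact: le_trans (hM y) (ltW Mx).
Qed.

Lemma integrable_add (f g : S -> R) : sigma.-integrable setT (EFin \o f) ->
  sigma.-integrable setT (EFin \o g) ->
  sigma.-integrable setT (EFin \o (fun x => f x + g x)).
Proof. by move=> hf hg; have := integrableD measurableT hf hg. Qed.

Lemma integrable_sub (f g : S -> R) : sigma.-integrable setT (EFin \o f) ->
  sigma.-integrable setT (EFin \o g) ->
  sigma.-integrable setT (EFin \o (fun x => f x - g x)).
Proof. by move=> hf hg; have := integrableB measurableT hf hg. Qed.

Lemma cintegrableM f g : cintegrable f -> bounded_cfun g ->
  cintegrable (fun x => f x * g x).
Proof.
move=> [f1 f2] [g1 g2]; split.
  by under eq_fun do rewrite ReM; apply: integrable_sub; exact: integrable_mulr_bounded.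
by under eq_fun do rewrite ImM; apply: integrable_add; exact: integrable_mulr_bounded.
Qed.

Lemma cintegrableD f g : cintegrable f -> cintegrable g ->
  cintegrable (fun x => f x + g x).
Proof.
move=> [f1 f2] [g1 g2]; split.
  by under eq_fun do rewrite ReD; exact: integrable_add.
by under eq_fun do rewrite ImD; exact: integrable_add.
Qed.

Lemma cintegrableZ c f : cintegrable f -> cintegrable (fun x => c * f x).
Proof.
by move=> hf; under eq_fun do rewrite mulrC; apply: cintegrableM => //;
  exact: bounded_cfun_cst.
Qed.

Lemma cintegralD f g : cintegrable f -> cintegrable g ->
  cintegral sigma (fun x => f x + g x) = cintegral sigma f + cintegral sigma g.
Proof.
move=> [f1 f2] [g1 g2]; rewrite /cintegral; apply/eqP; rewrite eq_complex /=.
apply/andP; split; apply/eqP.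
  by rewrite -RintegralD //; congr Rintegral; apply/funext => x; rewrite ReD.
by rewrite -RintegralD //; congr Rintegral; apply/funext => x; rewrite ImD.
Qed.

Lemma cintegralZ c f : cintegrable f ->
  cintegral sigma (fun x => c * f x) = c * cintegral sigma f.
Proof.
move=> [f1 f2]; rewrite /cintegral; apply/eqP; rewrite eq_complex.
have z a g : sigma.-integrable setT (EFin \o g) ->
    sigma.-integrable setT (EFin \o (fun x => a * g x)).
  by move=> hg; under eq_fun do rewrite mulrC; apply: integrable_mulr_bounded => //;
    exact: bounded_mfun_cst.
rewrite ReM ImM /=; apply/andP; split; apply/eqP.
  rewrite -!RintegralZl // -RintegralB //; try exact: z.
  by congr Rintegral; apply/funext => x; rewrite ReM.
rewrite -!RintegralZl // -RintegralD //; try exact: z.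
by congr Rintegral; apply/funext => x; rewrite ImM.
Qed.

Lemma cintegral0 : cintegral sigma (fun=> 0) = 0.
Proof. exact: (complexify0 bfs). Qed.

Lemma cintegrable_sum (I : Type) (r : seq I) (F : I -> S -> C) :
  (forall i, cintegrable (F i)) -> cintegrable (fun x => \sum_(i <- r) F i x).
Proof.
move=> h; elim: r => [|i r IH].
  by under eq_fun do rewrite big_nil; apply: bounded_cintegrable; exact: bounded_cfun_cst.
by under eq_fun do rewrite big_cons; exact: cintegrableD.
Qed.

Lemma cintegral_sum (I : Type) (r : seq I) (F : I -> S -> C) :
  (forall i, cintegrable (F i)) ->
  cintegral sigma (fun x => \sum_(i <- r) F i x) =
  \sum_(i <- r) cintegral sigma (F i).
Proof.
move=> hF; elim: r => [|i r IH].
  by under eq_fun do rewrite big_nil; rewrite cintegral0 big_nil.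
by under eq_fun do rewrite big_cons; rewrite cintegralD ?IH ?big_cons //;
  exact: cintegrable_sum.
Qed.

Lemma square_integrable_cintegrable f : square_integrable sigma f -> cintegrable f.
Proof.
have s1 : sigma [set: S] \is a fin_num by exact: fin_num_measure.
by move=> [h1 h2]; split; apply/Lfun1_integrable; exact: (Lfun_subset12 s1).
Qed.

Definition sphere_fun (P : poly) : S -> C := sphere_eval (to_real P).

Lemma sphere_funD P Q z : sphere_fun (P + Q) z = sphere_fun P z + sphere_fun Q z.
Proof. by rewrite /sphere_fun /sphere_eval to_realD real_evalD. Qed.

Lemma sphere_funB P Q z : sphere_fun (P - Q) z = sphere_fun P z - sphere_fun Q z.
Proof. by rewrite /sphere_fun /sphere_eval to_realB real_evalB. Qed.

Lemma sphere_funZ c P z : sphere_fun (c *: P) z = c * sphere_fun P z.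
Proof. by rewrite /sphere_fun /sphere_eval to_realZ real_evalZ. Qed.

Lemma sphere_fun_sum (I : Type) (r : seq I) (F : I -> poly) z :
  sphere_fun (\sum_(i <- r) F i) z = \sum_(i <- r) sphere_fun (F i) z.
Proof. by rewrite /sphere_fun /sphere_eval to_real_sum real_eval_sum. Qed.

Lemma bounded_sphere_fun P : bounded_cfun (sphere_fun P).
Proof. exact: bounded_sphere_eval. Qed.

Lemma poly_ipE P Q : poly_ip T P Q =
  cintegral sigma (fun z => sphere_fun P z * conjc (sphere_fun Q z)).
Proof.
rewrite /poly_ip /T /sphere_mean; congr cintegral; apply/funext => z.
by rewrite /sphere_eval real_evalM real_eval_conj.
Qed.

Lemma spherical_harmonicsP p q f :
  spherical_harmonics p q f <-> exists2 P, solid_harmonic p q P & f = sphere_fun P.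
Proof.
split=> [[P [h1 h2 h3]]|[P [h1 h2] ->]].
  by exists P => //; apply/funext => z; rewrite h3 poly_funE.
by exists P; split=> // z; rewrite poly_funE.
Qed.

Section Basis.
Variables (p q k : nat) (e : 'I_k -> poly).
Hypotheses (eo : orthonormal T p q e)
  (eb : forall P, solid_harmonic p q P -> P = \sum_i poly_ip T P (e i) *: e i).
Local Notation H := (@spherical_harmonics R n n_gt0 p q).

Definition basis_kernel z w : C :=
  \sum_i sphere_fun (e i) z * conjc (sphere_fun (e i) w).

Lemma solid_harmonic_lincomb (a : 'I_k -> C) :
  solid_harmonic p q (\sum_i a i *: e i).
Proof. by apply: solid_harmonic_sum => i; apply: solid_harmonicZ; exact: eo.1. Qed.

Lemma basis_kernel_reproducing : is_reproducing_kernel sigma H basis_kernel.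
Proof.
split=> [f /square_integrable_cintegrable hf|z]; last first.
  apply/spherical_harmonicsP; exists (\sum_i conjc (sphere_fun (e i) z) *: e i).
    exact: solid_harmonic_lincomb.
  apply/funext => w; rewrite sphere_fun_sum rmorph_sum; apply: eq_bigr => i _.
  by rewrite sphere_funZ rmorphM /= conjcK.
have hfe i : cintegrable (fun w => f w * conjc (sphere_fun (e i) w)).
  by apply: cintegrableM => //; apply: bounded_cfun_conj; exact: bounded_sphere_fun.
pose a i := cintegral sigma (fun w => f w * conjc (sphere_fun (e i) w)).
pose G := \sum_i a i *: e i.
have -> : (fun z => cintegral sigma (fun w => basis_kernel z w * f w)) = sphere_fun G.
  apply/funext => z; rewrite sphere_fun_sum.
  under [RHS]eq_bigr => i _ do rewrite sphere_funZ mulrC -cintegralZ //.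
  rewrite -cintegral_sum; last by move=> i; exact: cintegrableZ.
  congr cintegral; apply/funext => w; rewrite mulr_suml; apply: eq_bigr => i _.
  by rewrite mulrAC mulrA.
split; first by apply/spherical_harmonicsP; exists G => //; exact: solid_harmonic_lincomb.
move=> h /spherical_harmonicsP [P hP ->].
have sP : bounded_cfun (fun z => conjc (sphere_fun P z)) by apply: bounded_cfun_conj;
  exact: bounded_sphere_fun.
transitivity (cintegral sigma (fun x => f x * conjc (sphere_fun P x)) - poly_ip T G P).
  rewrite poly_ipE -mulN1r -cintegralZ; last first.
    by apply: bounded_cintegrable; apply: bounded_cfunM => //; exact: bounded_sphere_fun.
  rewrite -cintegralD.
  - by congr cintegral; apply/funext => x; rewrite mulN1r mulrBl.
  - exact: cintegrableM.
  - by apply: cintegrableZ; apply: bounded_cintegrable; apply: bounded_cfunM => //;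
      exact: bounded_sphere_fun.
apply/eqP; rewrite subr_eq0; apply/eqP.
rewrite (poly_ip_suml HT) {1}(eb hP).
under [RHS]eq_bigr => i _ do rewrite (poly_ipZl HT) (poly_ip_conj HT) mulrC /a
  -cintegralZ //.
rewrite -cintegral_sum => [|i]; last exact: cintegrableZ.
congr cintegral; apply/funext => x; rewrite sphere_fun_sum rmorph_sum mulr_sumr.
apply: eq_bigr => i _; rewrite sphere_funZ rmorphM /=.
by rewrite mulrCA.
Qed.

Lemma sphere_fun_square_integrable P : square_integrable sigma (sphere_fun P).
Proof.
have s1 : sigma [set: S] \is a fin_num by exact: fin_num_measure.
have L2 (f : S -> R) : bounded_mfun f -> f \in Lfun sigma 2%:E.
  move=> [mf [M hM]]; rewrite inE; apply/andP; split; rewrite inE //=.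
  rewrite /finite_norm unlock poweR_lty //.
  have hf2 : bounded_mfun (fun x => `|f x| ^+ 2).
    under eq_fun do rewrite real_normK ?num_real // expr2.
    by apply: bounded_mfunM; split=> //; exists M.
  apply: integrable_lty => //; have := bounded_mfun_integrable sigma hf2.
  by apply: eq_integrable => // x _; rewrite /= powR_mulrn.
by have [h1 h2] := bounded_sphere_fun P; split; exact: L2.
Qed.

(** The second condition puts the conjugate of K(z, .) in H(p, q), where the first
one determines it, as the vector that represents the evaluation at z. *)
Lemma reproducing_kernel_unique (K : S -> S -> C) :
  is_reproducing_kernel sigma H K -> K = basis_kernel.
Proof.
move=> [K1 K2].
have hK z : exists2 P, solid_harmonic p q P & (fun w => conjc (K z w)) = sphere_fun P.
  by apply/spherical_harmonicsP; exact: K2.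
apply/funext => z; have [P hP KP] := hK z.
have KE w : K z w = conjc (sphere_fun P w) by rewrite -KP conjcK.
have rep Q : solid_harmonic p q Q -> sphere_fun Q z = poly_ip T Q P.
  move=> hQ; have [/spherical_harmonicsP [G hG gE] orth] := K1 _
    (sphere_fun_square_integrable Q).
  have gE' w : cintegral sigma (fun w' => K w w' * sphere_fun Q w') = sphere_fun G w.
    exact: (congr1 (@^~ w) gE).
  have hQG : solid_harmonic p q (Q - G) by exact: solid_harmonicB.
  have /(poly_ip_eq0 HT hQG) /subr0_eq QG : poly_ip T (Q - G) (Q - G) = 0.
    rewrite poly_ipE -[RHS](orth (sphere_fun (Q - G)));
      last by apply/spherical_harmonicsP; exists (Q - G).
    by congr cintegral; apply/funext => w; rewrite gE' -sphere_funB.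
  rewrite {1}QG -gE' poly_ipE; congr cintegral; apply/funext => w.
  by rewrite -KP conjcK mulrC.
apply/funext => w; rewrite KE {1}(eb hP) sphere_fun_sum rmorph_sum; apply: eq_bigr => i _.
by rewrite sphere_funZ rmorphM /= (rep _ (eo.1 i)) (poly_ip_conj HT P (e i)).
Qed.

End Basis.
End ReproducingKernel.

(** * Vanishing of the measure on H(p, q) off its spectrum *)

Section SpectralVanishing.
Context {R : realType} {n : nat} (n_gt0 : (0 < n)%N).
Local Notation S := (sphere R n_gt0).
Local Notation N := (n + n)%N.
Local Notation C := R[i].
Local Notation poly := (mpoly.mpoly N C).
Variables (sigma : probability S R) (sigma_inv : rotation_invariant sigma).
Variable mu : complex_measure S R.
Let T := sphere_mean sigma.
Let HT : spherical_mean T := spherical_mean_sphere_mean sigma_inv.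
Local Notation T1 := (charge_integral (cmeasure_re mu)).
Local Notation T2 := (charge_integral (cmeasure_im mu)).
Let b1 : bounded_functional T1 := bf_charge (cmeasure_re mu).
Let b2 : bounded_functional T2 := bf_charge (cmeasure_im mu).

Lemma cmeasure_integralE f :
  cmeasure_integral mu f = complexify T1 f + 'i%C * complexify T2 f.
Proof.
apply/eqP; rewrite eq_complex ReD ImD ReM ImM /= !mul0r !mul1r sub0r add0r.
by rewrite !eqxx.
Qed.

(** Integration against the conjugate of [mu].  The projection of [mu] has the
coefficients that [mu] assigns to the conjugates of a basis of H(p, q); up to
conjugation, these are the values of this linear functional at the basis itself. *)
Definition conj_integral (f : S -> C) : C :=
  complexify T1 f - 'i%C * complexify T2 f.
Local Notation L := conj_integral.
Local Notation sphere_fun := (@sphere_fun R n n_gt0).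

Lemma conj_integral_linear c f g : bounded_cfun f -> bounded_cfun g ->
  L (fun x => c * f x + g x) = c * L f + L g.
Proof.
move=> hf hg; rewrite /L.
rewrite (complexify_linear c b1 hf hg).
rewrite (complexify_linear c b2 hf hg).
by move: (complexify T1 f) (complexify T1 g) (complexify T2 f) (complexify T2 g) => u
  v w x; ring.
Qed.

Lemma cmeasure_integral_conj f : bounded_cfun f ->
  cmeasure_integral mu (fun x => conjc (f x)) = conjc (L f).
Proof.
move=> hf; rewrite cmeasure_integralE /L !complexify_conj //.
case: (complexify T1 f) (complexify T2 f) => a b [c d].
by apply/eqP; rewrite eq_complex /=; apply/andP; split; apply/eqP; ring.
Qed.

Lemma cmeasure_integral_sum (I : Type) (r : seq I) (a : I -> C) (F : I -> S -> C) :
  (forall i, bounded_cfun (F i)) ->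
  cmeasure_integral mu (fun x => \sum_(i <- r) a i * F i x) =
  \sum_(i <- r) a i * cmeasure_integral mu (F i).
Proof.
move=> hF; have hF' i : bounded_cfun (fun x => a i * F i x) by apply: bounded_cfunM
  => //; exact: bounded_cfun_cst.
rewrite cmeasure_integralE !complexify_sum // mulr_sumr -big_split;
  apply: eq_bigr => i _ /=.
rewrite (complexifyZ _ b1 (hF i)) (complexifyZ _ b2 (hF i)) cmeasure_integralE.
by move: (complexify T1 _) (complexify T2 _) => u v; ring.
Qed.

(** The projection of [mu] is the sum of the (L e_i)^* e_i, and the e_i are linearly
independent as functions. *)
Lemma spectrum_vanish p q P : (forall z, proj_measure sigma p q mu z = 0) ->
  solid_harmonic p q P -> L (sphere_fun P) = 0.
Proof.
move=> h0 hP; have [k [e [eo eb]]] := orthonormal_basis HT p q.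
have KE : reproducing_kernel sigma (spherical_harmonics p q) = @basis_kernel R n
  n_gt0 k e.
  apply: (reproducing_kernel_unique sigma_inv eo eb).
  exact: (xgetPex _ (ex_intro _ _ (basis_kernel_reproducing sigma_inv eo eb))).
pose a i := conjc (L (sphere_fun (e i))).
have sa z : sphere_fun (\sum_i a i *: e i) z = 0.
  rewrite -[RHS](h0 z) /proj_measure KE /basis_kernel cmeasure_integral_sum; last first.
    by move=> i; apply: bounded_cfun_conj; exact: bounded_sphere_fun.
  rewrite sphere_fun_sum; apply: eq_bigr => i _.
  by rewrite sphere_funZ cmeasure_integral_conj ?(mulrC (a i)) //;
    exact: bounded_sphere_fun.
have Q0 : \sum_i a i *: e i = 0.
  apply: (poly_ip_eq0 HT (solid_harmonic_lincomb eo a)); rewrite poly_ipE.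
  under eq_fun do rewrite sa mul0r.
  exact: (cintegral0 sigma).
have a0 j : a j = 0.
  have : poly_ip T (\sum_i a i *: e i) (e j) = 0 by rewrite Q0 (poly_ip0l HT).
  rewrite (poly_ip_suml HT) (bigD1 j) //= (poly_ipZl HT) eo.2 eqxx mulr1 big1 ?addr0
    // => i ij.
  by rewrite (poly_ipZl HT) eo.2 (negPf ij) mulr0.
have Le i : L (sphere_fun (e i)) = 0.
  by apply/eqP; rewrite -conjc_eq0; apply/eqP; exact: a0.
have -> : sphere_fun P = (fun z => \sum_i poly_ip T P (e i) * sphere_fun (e i) z).
  apply/funext => z; rewrite {1}(eb _ hP) sphere_fun_sum.
  by apply: eq_bigr => i _; rewrite sphere_funZ.
have he i : bounded_cfun (fun z => poly_ip T P (e i) * sphere_fun (e i) z).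
  by apply: bounded_cfunM; [exact: bounded_cfun_cst|exact: bounded_sphere_fun].
rewrite /L !complexify_sum // mulr_sumr -sumrB big1 // => i _.
rewrite !complexifyZ //; [|exact: bounded_sphere_fun|exact: bounded_sphere_fun].
by rewrite mulrCA -mulrBr -/(L _) Le mulr0.
Qed.

Variables (eps : R) (eps_gt0 : 0 < eps) (eps_lt1 : eps < 1).
Hypothesis spec_fin : finite_set
  (spectrum sigma mu `&` [set pq | kappa eps (pq.1%:R, pq.2%:R)]).

(** In the strip |p - q| <= t, both ratios are within t / min(p, q) of 1. *)
Lemma kappa_near_diagonal t : exists M, forall p q : nat,
  (p <= q + t)%N -> (q <= p + t)%N -> (M <= p + q)%N -> kappa eps (p%:R, q%:R).
Proof.
have [m hm] : exists m : nat, t%:R < m%:R * eps.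
  exists (Num.truncn (t%:R / eps)).+1; rewrite -ltr_pdivrMr //.
  exact: truncnS_gt.
exists (m + m + t).+1%N => p q pq qp Mpq.
have ep0 : 0 < 1 - eps by rewrite subr_gt0.
have pm : (m < p)%N by lia.
have qm : (m < q)%N by lia.
have p0 : 0 < p%:R :> R by rewrite ltr0n; lia.
have q0 : 0 < q%:R :> R by rewrite ltr0n; lia.
have pqR : p%:R <= q%:R + t%:R :> R by rewrite -natrD ler_nat.
have qpR : q%:R <= p%:R + t%:R :> R by rewrite -natrD ler_nat.
have mp : m%:R * eps < p%:R * eps by rewrite ltr_pM2r // ltr_nat.
have mq : m%:R * eps < q%:R * eps by rewrite ltr_pM2r // ltr_nat.
split=> //=.
  by rewrite ltr_pdivlMr //; lra.
rewrite ltr_pdivrMr // mulrC ltr_pdivlMr //; lra.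
Qed.

Lemma conj_integral_vanish t : exists M, forall p q P,
  (p <= q + t)%N -> (q <= p + t)%N -> (M <= p + q)%N -> solid_harmonic p q P ->
  L (sphere_fun P) = 0.
Proof.
have [M hM] := kappa_near_diagonal t.
have [s hs] := (finite_seqP _).1 spec_fin.
(* Beyond the largest p + q in the part of the spectrum inside kappa, and far
   enough for [kappa_near_diagonal]. *)
exists (maxn M (\max_(x <- s) (x.1 + x.2)).+1)%N => p q P pq qp; rewrite geq_max.
move=> /andP[Mpq spq] hP; apply: spectrum_vanish hP => z; apply: contrapT => /eqP hz.
have : (spectrum sigma mu `&` [set pq | kappa eps (pq.1%:R, pq.2%:R)]) (p, q).
  by split; [exists z|exact: hM].
rewrite hs /= => pqs.
by have := @leq_bigmax_seq _ s xpredT (fun x : nat * nat => (x.1 + x.2)%N) (p, q) pqs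
  isT; rewrite leqNgt spq.
Qed.

End SpectralVanishing.

(** * Null sets of the circle-invariant sigma-algebra *)

Section InvariantSets.
Context {R : realType} {n : nat} (n_gt0 : (0 < n)%N).
Local Notation S := (sphere R n_gt0).
Local Notation N := (n + n)%N.
Local Notation C := R[i].
Local Notation poly := (mpoly.mpoly N C).
Local Notation sphere_fun := (@sphere_fun R n n_gt0).

(** The real-valued circle-invariant polynomial functions. *)
Definition balanced_alg : set (S -> R) :=
  [set f | exists2 P, balanced P & forall z, (f z)%:C%C = sphere_fun P z].

Lemma balanced_alg_bounded f : balanced_alg f -> bounded_mfun f.
Proof.
move=> [P _ hP]; have [h _] := bounded_sphere_fun n_gt0 P.
by move: h; under eq_fun do rewrite -hP.
Qed.

Lemma balanced_alg_cst c : balanced_alg (fun=> c).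
Proof.
exists (mpoly.mpolyC N c%:C%C) => [|z]; first exact: balancedC.
by rewrite /sphere_fun /sphere_eval to_realC real_evalC.
Qed.

Lemma balanced_algD f g : balanced_alg f -> balanced_alg g ->
  balanced_alg (fun x => f x + g x).
Proof.
move=> [P bP hP] [Q bQ hQ]; exists (P + Q) => [|z]; first exact: balancedD.
by rewrite sphere_funD rmorphD /= hP hQ.
Qed.

Lemma sphere_funM P Q (z : S) :
  sphere_fun (P * Q) z = sphere_fun P z * sphere_fun Q z.
Proof. by rewrite /sphere_fun /sphere_eval to_realM real_evalM. Qed.

Lemma balanced_algM f g : balanced_alg f -> balanced_alg g ->
  balanced_alg (fun x => f x * g x).
Proof.
move=> [P bP hP] [Q bQ hQ]; exists (P * Q) => [|z]; first exact: balancedM.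
by rewrite sphere_funM rmorphM /= hP hQ.
Qed.

Variables (sigma : probability S R) (sigma_inv : rotation_invariant sigma).
Variable mu : complex_measure S R.
Let T := sphere_mean sigma.
Let HT : spherical_mean T := spherical_mean_sphere_mean sigma_inv.
Let bs := bf_Rintegral sigma.
Local Notation T1 := (charge_integral (cmeasure_re mu)).
Local Notation T2 := (charge_integral (cmeasure_im mu)).
Let b1 : bounded_functional T1 := bf_charge (cmeasure_re mu).
Let b2 : bounded_functional T2 := bf_charge (cmeasure_im mu).
Local Notation L := (conj_integral mu).
Hypothesis L_vanish : forall t, exists M, forall p q P,
  (p <= q + t)%N -> (q <= p + t)%N -> (M <= p + q)%N -> solid_harmonic p q P ->
  L (sphere_fun P) = 0.

Lemma conj_integral_expansion chi :
  exists s : seq (poly * C), forall g, balanced g ->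
  L (sphere_fun (g * chi)) = \sum_(x <- s) x.2 * poly_ip T g x.1.
Proof.
apply: (balanced_expansion n_gt0 HT (Lam := fun P => L (sphere_fun P)) _ _ _ chi).
- move=> c P Q; rewrite -conj_integral_linear;
    [|exact: bounded_sphere_fun|exact: bounded_sphere_fun].
  by congr conj_integral; apply/funext => z; rewrite sphere_funD sphere_funZ.
- move=> Q; congr conj_integral; apply/funext => z.
  by rewrite sphere_funM {1}/sphere_fun to_real_rho sphere_eval_rho mul1r.
- exact: L_vanish.
Qed.

Lemma conj_integral_real (u : S -> R) :
  L (fun z => (u z)%:C%C) = (T1 u +i* (- T2 u))%C.
Proof.
rewrite /conj_integral /complexify /= (bf0 b1) (bf0 b2); apply/eqP.
by rewrite eq_complex /=; apply/andP; split; apply/eqP; ring.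
Qed.

(** For u balanced, the integrals of u f against the two parts of [mu] equal
integrals of u against continuous densities with respect to [sigma].  This
extends to the indicator of [G], for which the latter integrals are 0. *)
Lemma baire_balanced_null (G : set S) (f : S -> R) :
  baire_set balanced_alg G -> sigma G = 0%E -> poly_alg f ->
  T1 (fun z => \1_G z * f z) = 0 /\ T2 (fun z => \1_G z * f z) = 0.
Proof.
move=> hG sG hf; have hfb := poly_alg_bounded hf; case: hf => Q hQ.
have [chi rchi] := to_real_surj Q.
have hchi z : sphere_fun chi z = (f z)%:C%C by rewrite /sphere_fun rchi hQ.
have [s hs] := conj_integral_expansion chi.
pose psi (x : poly * C) z := conjc (sphere_fun x.1 z).
have hpsi x : bounded_cfun (psi x) by apply: bounded_cfun_conj; exact: bounded_sphere_fun.
(* U u and V u are the real and imaginary parts of the expansion at u real. *)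
pose U u := \sum_(x <- s) (complex.Re x.2 * (\int[sigma]_z (u z * complex.Re (psi x z)))
  - complex.Im x.2 * (\int[sigma]_z (u z * complex.Im (psi x z)))).
pose V u := \sum_(x <- s) (complex.Re x.2 * (\int[sigma]_z (u z * complex.Im (psi x z)))
  + complex.Im x.2 * (\int[sigma]_z (u z * complex.Re (psi x z)))).
have bU : bounded_functional U.
  apply: bf_sum => x; have [h1 h2] := hpsi x.
  under eq_fun do rewrite -mulNr.
  by apply: bf_add; apply: bf_scale; exact: (bf_mulr bs).
have bV : bounded_functional V.
  apply: bf_sum => x; have [h1 h2] := hpsi x.
  by apply: bf_add; apply: bf_scale; exact: (bf_mulr bs).
have null (h : S -> R) : bounded_mfun h -> \int[sigma]_z (\1_G z * h z) = 0.
  move=> [mh [M hM]]; have mG := baire_set_measurable balanced_alg_bounded hG.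
  have hGb : bounded_mfun (\1_G : S -> R) := bounded_mfun_indic mG.
  have I0 c : \int[sigma]_z (c * \1_G z) = 0.
    rewrite (bfZ_app c bs hGb) Rintegral_indic // (_ : fine _ = 0) ?mulr0 //.
    exact: (congr1 fine sG).
  have i1 : bounded_mfun (fun z => \1_G z * h z) by apply: bounded_mfunM => //;
    split=> //; exists M.
  have b z : - M * \1_G z <= \1_G z * h z <= M * \1_G z.
    have := hM z; rewrite ler_norml indicE; case: (z \in G) => /=;
      last by rewrite !mulr0 mul0r lexx.
    by rewrite !mulr1 mul1r.
  apply/eqP; rewrite eq_le; apply/andP; split.
    rewrite -[leRHS](I0 M); apply: le_Rintegral => //.
    - exact: (bounded_mfun_integrable sigma i1).
    - exact: (bounded_mfun_integrable sigma (bounded_mfunZ M hGb)).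
    - by move=> z _; case/andP: (b z).
  rewrite -[leLHS](I0 (- M)); apply: le_Rintegral => //.
  - exact: (bounded_mfun_integrable sigma (bounded_mfunZ (- M) hGb)).
  - exact: (bounded_mfun_integrable sigma i1).
  - by move=> z _; case/andP: (b z).
have E g : balanced_alg g -> T1 (fun z => g z * f z) = U g /\
    T2 (fun z => g z * f z) = - V g.
  move=> [P bP hP]; have := hs P bP.
  have -> : sphere_fun (P * chi) = (fun z => (g z * f z)%:C%C).
    by apply/funext => z; rewrite sphere_funM rmorphM /= hP hchi.
  have -> : \sum_(x <- s) x.2 * poly_ip T P x.1 = (U g +i* V g)%C.
    rewrite /U /V; elim: (s) => [|x r IH]; first by rewrite !big_nil.
    rewrite !big_cons IH poly_ipE; apply/eqP; rewrite eq_complex ReD ImD ReM ImM /=.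
    by apply/andP; split; apply/eqP; congr (_ + _); congr (_ + _);
      do ?congr (- _); congr (_ * _); congr Rintegral; apply/funext => z;
      rewrite -hP ?ReM ?ImM /= mul0r ?subr0 ?addr0.
  by rewrite conj_integral_real => -[-> <-]; rewrite opprK.
have hA : forall u, baire balanced_alg u -> T1 (fun z => u z * f z) - U u = 0.
  apply: (@baire_functional_eq0 _ _ _ _ balanced_alg_bounded
    (fun u => T1 (fun z => u z * f z) - U u)) => [|u /E[-> _]]; last by rewrite subrr.
  under eq_fun do rewrite -mulN1r; apply: bf_add; first exact: bf_mulr.
  exact: bf_scale.
have hB : forall u, baire balanced_alg u -> T2 (fun z => u z * f z) + V u = 0.
  apply: (@baire_functional_eq0 _ _ _ _ balanced_alg_bounded
    (fun u => T2 (fun z => u z * f z) + V u)) => [|u /E[_ ->]]; last by rewrite addNr.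
  by apply: bf_add => //; exact: bf_mulr.
have U0 : U (\1_G) = 0.
  rewrite /U big1 // => x _; have [h1 h2] := hpsi x.
  by rewrite !null // !mulr0 subr0.
have V0 : V (\1_G) = 0.
  rewrite /V big1 // => x _; have [h1 h2] := hpsi x.
  by rewrite !null // !mulr0 addr0.
by split; [have := hA _ hG; rewrite U0 subr0|have := hB _ hG; rewrite V0 addr0].
Qed.

(** [mu] restricted to [G] annihilates all polynomials, hence all Borel sets. *)
Lemma cmeasure_null (G E : set S) : baire_set balanced_alg G -> sigma G = 0%E ->
  measurable E -> E `<=` G -> cmeasure mu E = 0.
Proof.
move=> hG sG mE EG.
have mG : measurable G := baire_set_measurable balanced_alg_bounded hG.
have key T0 : bounded_functional T0 ->
    (forall f, poly_alg f -> T0 (fun z => \1_G z * f z) = 0) -> T0 (\1_E) = 0.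
  move=> bT h0.
  have := @baire_functional_eq0 _ _ _ _ (@poly_alg_bounded R n n_gt0)
    (fun u => T0 (fun z => u z * \1_G z)) (bf_mulr bT (bounded_mfun_indic mG)) _ _
      (measurable_baire mE).
  rewrite (_ : (fun z => \1_E z * \1_G z) = \1_E).
    by apply=> f hf; rewrite -[RHS](h0 f hf); congr T0; apply/funext => z; rewrite mulrC.
  by rewrite -[in RHS](setIidl EG) indicI.
rewrite /cmeasure -!charge_integral_indic // (key T1) //.
  by rewrite (key T2) // => f hf; case: (baire_balanced_null hG sG hf).
by move=> f hf; case: (baire_balanced_null hG sG hf).
Qed.

End InvariantSets.

(** * Tubes around circles and sets of small dimension *)

Section Tubes.
Context {R : realType} {n : nat} (n_gt0 : (0 < n)%N).
Local Notation S := (sphere R n_gt0).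
Local Notation N := (n + n)%N.
Local Notation C := R[i].
Local Notation poly := (mpoly.mpoly N C).
Local Notation sphere_fun := (@sphere_fun R n n_gt0).

Definition conj_coord (w : S) (j : 'I_n) : C :=
  (coord (lshift n j) w -i* coord (rshift n j) w)%C.

Definition pairing (w z : S) : C := \sum_j conj_coord w j * conjc (conj_coord z j).

Definition tube_fun (w z : S) : R := cnorm (pairing w z) ^+ 2.

Lemma conj_coord_norm w : \sum_j conj_coord w j * conjc (conj_coord w j) = 1.
Proof.
transitivity ((\sum_k coord k w ^+ 2)%:C%C); last by rewrite coord_sqr_sum.
rewrite big_split_ord /= -big_split rmorph_sum; apply: eq_bigr => j _ /=.
by apply/eqP; rewrite eq_complex /=; apply/andP; split; apply/eqP; ring.
Qed.

Lemma sphere_fun_hermitian_squareX w k z :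
  sphere_fun (hermitian_square (conj_coord w) ^+ k) z = (tube_fun w z ^+ k)%:C%C.
Proof.
have X (P : poly) : sphere_fun (P ^+ k) z = sphere_fun P z ^+ k.
  elim: k => [|k IH]; first by rewrite !expr0 /sphere_fun /sphere_eval -mpoly.mpolyC1
    to_realC real_evalC.
  by rewrite !exprS sphere_funM IH.
rewrite X rmorphXn /=; congr (_ ^+ k).
rewrite /tube_fun rmorphXn /= cnormE sqr_normc /hermitian_square sphere_funM
  !sphere_fun_sum.
congr (_ * _).
  apply: eq_bigr => j _; rewrite sphere_funZ; congr (_ * _).
  rewrite /sphere_fun /sphere_eval to_realXl real_evalD real_evalZ !real_evalX; apply/eqP.
  by rewrite eq_complex /=; apply/andP; split; apply/eqP; rewrite /coord; ring.
rewrite rmorph_sum; apply: eq_bigr => j _; rewrite sphere_funZ rmorphM /=; congr (_ * _).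
rewrite /sphere_fun /sphere_eval to_realXr real_evalB real_evalZ !real_evalX; apply/eqP.
by rewrite eq_complex /=; apply/andP; split; apply/eqP; rewrite /coord; ring.
Qed.

Lemma tube_fun_balanced w : balanced_alg (tube_fun w).
Proof.
exists (hermitian_square (conj_coord w)).
  have := @bihom_hermitian_squareX R n (conj_coord w) 1%N.
  by rewrite expr1 => /balanced_bihom.
by move=> z; rewrite -[X in sphere_fun X](expr1) sphere_fun_hermitian_squareX expr1.
Qed.

Lemma Re_pairing w z : complex.Re (pairing w z) = \sum_k coord k w * coord k z.
Proof.
rewrite big_split_ord /= -big_split raddf_sum /=; apply: eq_bigr => j _ /=.
by ring.
Qed.

Lemma sphere_dist_sqr (w z : S) :
  sphere_dist w z ^+ 2 = 2 - 2 * \sum_k coord k w * coord k z.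
Proof.
rewrite /sphere_dist /enorm sqr_sqrtr; last by apply: sumr_ge0 => k _; exact: sqr_ge0.
have -> : 2 = \sum_k coord k w ^+ 2 + \sum_k coord k z ^+ 2 :> R.
  by rewrite !coord_sqr_sum -[2]natr1.
rewrite coord_sqr_sum (coord_sqr_sum z) -[1 + 1]/(2).
transitivity (\sum_k coord k w ^+ 2 + \sum_k coord k z ^+ 2 - 2 * \sum_k coord k w *
  coord k z).
  rewrite mulr_sumr -big_split -sumrB /=; apply: eq_bigr => k _.
  by rewrite !mxE /coord; ring.
by rewrite !coord_sqr_sum.
Qed.

Lemma sphere_dist_ge0 (w z : S) : 0 <= sphere_dist w z.
Proof. exact: sqrtr_ge0. Qed.

(** The real part of <z, w> is 1 - |z - w|^2 / 2 on the sphere. *)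
Lemma tube_fun_ge w z (d : R) : d <= 1 -> sphere_dist w z <= d ->
  1 - d ^+ 2 <= tube_fun w z.
Proof.
move=> d1 wz; have wz0 := sphere_dist_ge0 w z.
have := Re_le_cnorm (pairing w z); rewrite Re_pairing /tube_fun.
have h := sphere_dist_sqr w z; set p := \sum_k _ in h * => pc.
have wz2 : sphere_dist w z ^+ 2 <= d ^+ 2 by rewrite ler_sqr // nnegrE; lra.
have d2 : d ^+ 2 <= 1 by rewrite exprn_ile1 //; lra.
have pd : 1 - d ^+ 2 / 2 <= p by lra.
have pc' : p <= cnorm (pairing w z) := le_trans (ler_norm p) pc.
by nra.
Qed.

(** For small [d], a neighbourhood of the circle through [w], of width of
order [d]. *)
Definition tube (w : S) (d : R) : set S := [set z | 1 - d ^+ 2 <= tube_fun w z].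

Lemma tube_baire w d : baire_set (@balanced_alg R n n_gt0) (tube w d).
Proof.
have -> : tube w d = ~` [set z | tube_fun w z + (d ^+ 2 - 1) < 0].
  by apply/seteqP; split=> z /=; rewrite /tube /=; lra.
apply: (baire_setC (@balanced_alg_cst R n n_gt0) (@balanced_algD R n n_gt0)
  (@balanced_algM R n n_gt0)).
apply: (baire_set_lt0 (@balanced_alg_bounded R n n_gt0) (@balanced_alg_cst R n n_gt0)
  (@balanced_algD R n n_gt0) (@balanced_algM R n n_gt0)).
by apply: balanced_algD; [exact: tube_fun_balanced|exact: balanced_alg_cst].
Qed.

Lemma tube_measurable w d : measurable (tube w d).
Proof. exact: (baire_set_measurable (@balanced_alg_bounded R n n_gt0) (tube_baire w
  d)). Qed.

Variables (sigma : probability S R) (sigma_inv : rotation_invariant sigma).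
Let bs := bf_Rintegral sigma.
Let HT := spherical_mean_sphere_mean sigma_inv.

Lemma bounded_mfun_tube_funX w k : bounded_mfun (fun z => tube_fun w z ^+ k).
Proof.
have [h _] := bounded_sphere_fun n_gt0 (hermitian_square (conj_coord w) ^+ k).
by move: h; under eq_fun do rewrite sphere_fun_hermitian_squareX.
Qed.

Lemma tube_fun_moment w k :
  (k + n.-1)`!%:R * (\int[sigma]_z (tube_fun w z ^+ k)) = (k`! * n.-1`!)%:R.
Proof.
have := mean_hermitian_squareX HT (conj_coord_norm w) k n_gt0.
rewrite /sphere_mean /cintegral -/(sphere_fun _).
have -> : sphere_fun (hermitian_square (conj_coord w) ^+ k) = (fun z => (tube_fun w z
  ^+ k)%:C%C).
  by apply/funext => z; exact: sphere_fun_hermitian_squareX.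
rewrite /= (bf0 bs) => /(congr1 (@complex.Re R)).
rewrite -!(rmorph_nat (real_complex R)) /= => <-.
by rewrite mul0r subr0.
Qed.

Lemma fact_addn_ge k m : (k`! * k ^ m <= (k + m)`!)%N.
Proof.
elim: m => [|m IH]; first by rewrite expn0 muln1 addn0.
rewrite expnS mulnCA addnS factS leq_mul //; lia.
Qed.

(** On the tube, the k-th power of [tube_fun] is at least
(1 - d^2)^k >= 1 - k d^2 >= 1/2. *)
Lemma tube_chebyshev w d k : (0 < k)%N -> k%:R * d ^+ 2 <= 2^-1 -> d ^+ 2 <= 1 ->
  fine (sigma (tube w d)) * k%:R ^+ n.-1 <= 2 * (n.-1)`!%:R.
Proof.
move=> k0 kd d1; set I := \int[sigma]_z (tube_fun w z ^+ k).
have mt := tube_measurable w d.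
have h1 : 2^-1 * fine (sigma (tube w d)) <= I.
  have hi : bounded_mfun (\1_(tube w d) : S -> R) := bounded_mfun_indic mt.
  have <- : \int[sigma]_z (2^-1 * \1_(tube w d) z) = 2^-1 * fine (sigma (tube w d)).
    by rewrite (bfZ_app _ bs hi) Rintegral_indic.
  apply: le_Rintegral => //.
  - exact: (bounded_mfun_integrable sigma (bounded_mfunZ _ hi)).
  - exact: (bounded_mfun_integrable sigma (bounded_mfun_tube_funX w k)).
  move=> z _; rewrite indicE; have [/set_mem zt|_] := boolP (z \in _); last first.
    by rewrite mulr0 exprn_ge0 // sqr_ge0.
  rewrite mulr1; apply: le_trans (_ : (1 - d ^+ 2) ^+ k <= _).
    have := @bernoulli_le R (- d ^+ 2) k; lra.
  by rewrite lerXn2r ?nnegrE ?subr_ge0 // sqr_ge0.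
have hm := tube_fun_moment w k; rewrite -/I in hm.
have I0 : 0 <= I by apply: Rintegral_ge0 => z _; rewrite exprn_ge0 // sqr_ge0.
have h2 : I * k%:R ^+ n.-1 <= (n.-1)`!%:R.
  have kf : 0 < k`!%:R :> R by rewrite ltr0n fact_gt0.
  rewrite -(ler_pM2l kf) -natrM -hm mulrCA [leRHS]mulrC ler_wpM2l //.
  by rewrite -natrX -natrM ler_nat fact_addn_ge.
have kn : 0 <= k%:R ^+ n.-1 :> R by rewrite exprn_ge0.
nra.
Qed.

(** The best k in [tube_chebyshev] is the integer part of 1 / (2 d^2). *)
Lemma tube_measure_le w d : (1 < n)%N -> 0 <= d <= 2^-1 ->
  fine (sigma (tube w d)) <= 2 * (n.-1)`!%:R * 4 ^+ n.-1 * (d ^+ 2) ^+ n.-1.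
Proof.
move=> n1 /andP[d0 d12]; set x := fine _; set K := 2 * _.
have x0 : 0 <= x by apply: fine_ge0.
have n10 : n.-1 != 0%N by rewrite -lt0n -ltnS prednK.
have K0 : 0 <= K by rewrite mulr_ge0.
have hk k : (0 < k)%N -> k%:R * d ^+ 2 <= 2^-1 -> x * k%:R ^+ n.-1 <= K.
  by move=> k0 kd; apply: tube_chebyshev => //; nra.
(* When d = 0, every k is admissible and K / k^(n - 1) tends to 0. *)
have [dE|dn0] := eqVneq d 0.
  rewrite dE expr0n /= expr0n (negPf n10) mulr0 leNgt; apply/negP => xp.
  set m := (Num.truncn (K / x)).+1.
  have h : x * m%:R ^+ n.-1 <= K.
    by apply: hk => //; rewrite dE expr0n /= mulr0 invr_ge0.
  have hK : K < x * m%:R by rewrite mulrC -ltr_pdivrMr // truncnS_gt.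
  have hp : m%:R <= m%:R ^+ n.-1 :> R by rewrite ler_eXnr ?lt0n // ler1n.
  by have := lt_le_trans hK (le_trans (ler_wpM2l x0 hp) h); rewrite ltxx.
have dp : 0 < d by rewrite lt_neqAle eq_sym dn0.
have d2p : 0 < d ^+ 2 by rewrite exprn_gt0.
pose k := Num.truncn ((2 * d ^+ 2)^-1).
have inv0 : 0 <= (2 * d ^+ 2)^-1 by rewrite invr_ge0; lra.
have /andP[k1 k2] := truncn_itv inv0; rewrite -/k in k1 k2.
have d4 : d ^+ 2 <= 4^-1 by nra.
have two : 2 <= (2 * d ^+ 2)^-1.
  by rewrite -[leLHS]invrK lef_pV2 ?posrE; lra.
have k0 : (0 < k)%N.
  by rewrite lt0n; apply/eqP => kz; move: k2; rewrite kz; lra.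
have kd : k%:R * d ^+ 2 <= 2^-1.
  move: k1; rewrite -[(_ * _)^-1]mul1r ler_pdivlMr; lra.
have kd4 : 1 <= k%:R * (4 * d ^+ 2).
  have kk : 1 <= k%:R :> R by rewrite ler1n.
  move: k2; rewrite -[(_ * _)^-1]mul1r ltr_pdivrMr; last lra.
  rewrite -natr1; nra.
rewrite -[leRHS]mulrA -exprMn.
apply: le_trans (_ : x * (k%:R * (4 * d ^+ 2)) ^+ n.-1 <= _).
  by rewrite ler_peMr // exprn_ege1.
rewrite (exprMn _ k%:R) mulrA ler_wpM2r ?hk //.
by rewrite exprn_ge0 //; lra.
Qed.

(** As d < 1 and s <= 2n - 2, the bound d^(2n - 2) is at most d^s. *)
Lemma tube_gauge_le (U : set S) w (s : R) : (1 < n)%N -> 0 <= s <= 2 * n%:R - 2 ->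
  U w -> (diameter (@sphere_dist R n n_gt0) U <= (2^-1)%:E)%E ->
  exists2 d, U `<=` tube w d & (sigma (tube w d) <=
    (2 * (n.-1)`!%:R * 4 ^+ n.-1)%:E * hausdorff_gauge (@sphere_dist R n n_gt0) s U)%E.
Proof.
move=> n1 /andP[s0 sn] Uw hd; set D := diameter _ _ in hd.
have Dge x y : U x -> U y -> ((sphere_dist x y)%:E <= D)%E.
  by move=> Ux Uy; apply: ereal_sup_ubound; exists (x, y).
have D0 : (0 <= D)%E.
  by apply: le_trans (Dge w w Uw Uw); rewrite lee_fin sphere_dist_ge0.
have Dfin : D \is a fin_num by rewrite ge0_fin_numE //; exact: le_lt_trans hd (ltry _).
pose d := fine D; have DE : D = d%:E by rewrite fineK.
have d0 : 0 <= d by exact: fine_ge0.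
have d12 : d <= 2^-1 by rewrite -lee_fin -DE.
exists d => [z Uz|].
  by apply: tube_fun_ge; [lra|rewrite -lee_fin -DE; exact: Dge].
have U0 : (U == set0) = false.
  by apply/negP => /eqP U0; move: Uw; rewrite U0.
rewrite /hausdorff_gauge U0 -/D DE /= -EFinM.
have -> : sigma (tube w d) = (fine (sigma (tube w d)))%:E.
  by rewrite fineK // fin_num_measure //; exact: tube_measurable.
rewrite lee_fin; apply: le_trans (tube_measure_le w n1 _) _; first by rewrite d0.
rewrite ler_wpM2l // ?mulr_ge0 // -exprM.
have n10 : (n.-1 == 0%N) = false by apply/negbTE; rewrite -lt0n -ltnS prednK.
have [->|dn0] := eqVneq d 0; first by rewrite expr0n muln_eq0 n10 powR_ge0.
have dp : 0 < d by rewrite lt_neqAle eq_sym dn0.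
rewrite -powR_mulrn //; apply: ger_powR; first by rewrite dp; lra.
apply: le_trans sn _; rewrite natrM mulrC.
by rewrite -[in leLHS](prednK n_gt0) -natr1; lra.
Qed.

(** Covers of [E] whose gauges have small sum give unions of tubes of small
measure; [G] is the intersection of countably many of them. *)
Lemma null_hull (E : set S) (s : R) : (1 < n)%N -> 0 <= s <= 2 * n%:R - 2 ->
  hausdorff_measure (@sphere_dist R n n_gt0) s E = 0%E ->
  exists G, [/\ baire_set (@balanced_alg R n n_gt0) G, sigma G = 0%E & E `<=` G].
Proof.
move=> n1 hs hE; set K : R := 2 * (n.-1)`!%:R * 4 ^+ n.-1.
have K0 : 0 < K by rewrite !mulr_gt0 ?ltr0n ?fact_gt0 ?exprn_gt0.
have Acst := @balanced_alg_cst R n n_gt0.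
have AD := @balanced_algD R n n_gt0; have AM := @balanced_algM R n n_gt0.
have Abounded := @balanced_alg_bounded R n n_gt0.
have step (m : nat) : exists G, [/\ baire_set (@balanced_alg R n n_gt0) G,
    (sigma G <= (m.+1%:R^-1)%:E)%E & E `<=` G].
  have e0 : 0 < m.+1%:R^-1 / K by rewrite divr_gt0 ?invr_gt0.
  have : (hausdorff_premeasure (@sphere_dist R n n_gt0) s 2^-1 E < (m.+1%:R^-1 / K)%:E)%E.
    apply: (@le_lt_trans _ _ 0%E); last by rewrite lte_fin.
    by rewrite -hE; apply: ereal_sup_ubound; exists 2^-1 => //=; rewrite invr_gt0.
  move=> /ereal_inf_lt [_ [U [EU Ud] <-] Usum].
  have /choice [G hG] k : exists G, [/\ baire_set (@balanced_alg R n n_gt0) G,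
      (sigma G <= K%:E * hausdorff_gauge (@sphere_dist R n n_gt0) s (U k))%E & U k
        `<=` G].
    have [[w Uw]|Uk0] := pselect (exists w, U k w).
      have [d Ut st] := tube_gauge_le n1 hs Uw (Ud k).
      by exists (tube w d); split=> //; exact: tube_baire.
    have Uk : U k = set0 by apply/seteqP; split=> // x Ux; apply: Uk0; exists x.
    exists set0; split; last by rewrite Uk.
    - by rewrite -setCT; apply: (baire_setC Acst AD AM); exact: (baire_setT Acst).
    - by rewrite measure0 /hausdorff_gauge Uk eqxx mule0.
  exists (\bigcup_k G k); split.
  - by apply: (baire_bigcup Acst AD AM) => k; have [] := hG k.
  - apply: (@le_trans _ _ (\sum_(0 <= k <oo) sigma (G k))%E).
      apply: measure_sigma_subadditive => //.
        by move=> k; have [h _ _] := hG k; exact: baire_set_measurable h.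
      apply: bigcup_measurable => k _; have [h _ _] := hG k;
        exact: baire_set_measurable h.
    apply: (@le_trans _ _ (K%:E * \sum_(0 <= k <oo)
        hausdorff_gauge (@sphere_dist R n n_gt0) s (U k))%E).
      have g0 k : (0 <= hausdorff_gauge (@sphere_dist R n n_gt0) s (U k))%E.
        rewrite /hausdorff_gauge; case: ifP => // _; exact: poweR_ge0.
      rewrite -nneseriesZl; last by move=> i _; exact: g0.
      by apply: lee_nneseries => // k _; have [] := hG k.
    apply: (@le_trans _ _ (K%:E * (m.+1%:R^-1 / K)%:E)%E).
      by apply: lee_wpmul2l; [rewrite lee_fin ltW|exact: ltW].
    by rewrite -EFinM lee_fin mulrC divfK // gt_eqF.
  - by move=> x /EU [k _ Ux]; exists k => //; have [_ _] := hG k; exact.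
have [G hG] := choice step; exists (\bigcap_m G m); split.
- by apply: (baire_bigcap Acst AM) => m; have [] := hG m.
- apply/eqP; rewrite eq_le measure_ge0 andbT.
  apply/lee_addgt0Pr => e e0; rewrite add0e.
  have [m _ hm] := near_infty_natSinv_lt (PosNum e0).
  have {}hm := hm m (leqnn m); rewrite /= in hm.
  have mG k : measurable (G k) by have [h _ _] := hG k; exact: baire_set_measurable h.
  apply: (@le_trans _ _ (sigma (G m))).
    apply: le_measure; rewrite ?inE //; first exact: bigcapT_measurable.
    by move=> x; apply.
  have [_ h _] := hG m; apply: le_trans h _; rewrite lee_fin; exact: ltW.
- by move=> x Ex m _; have [_ _] := hG m; exact.
Qed.

End Tubes.

Theorem corollary1p8 (R : realType) (n : nat) (n_gt0 : (0 < n)%N)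
    (sigma : probability (sphere R n_gt0) R)
    (sigma_inv : rotation_invariant sigma)
    (mu : complex_measure (sphere R n_gt0) R) (mu_reg : cmeasure_regular mu)
    (eps : R) (eps_gt0 : 0 < eps) (eps_lt1 : eps < 1)
    (spec_fin : finite_set
      (spectrum sigma mu `&` [set pq | kappa eps (pq.1%:R, pq.2%:R)])) :
  ((2 * n%:R - 2)%:E <= lower_hausdorff_dim (@sphere_dist R n n_gt0) mu)%E.
Proof.
apply: le_ereal_inf_tmp => _ [a [E [mE Ea muE]] <-]; rewrite leNgt.
apply/negP => an; have := le_lt_trans Ea an.
move=> /ereal_inf_lt [_ [s [s0 hs] <-]]; rewrite lte_fin => sn.
(* 0 <= s < 2n - 2 excludes n = 1, where the bound to prove is trivial. *)
have n1 : (1 < n)%N.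
  rewrite ltnNge; apply/negP => n1; have : n%:R <= 1 :> R by rewrite lern1.
  lra.
have [|G [hG sG EG]] := null_hull sigma_inv n1 _ hs; first by rewrite s0 ltW.
move/eqP: muE; apply.
exact: (cmeasure_null sigma_inv (conj_integral_vanish sigma_inv eps_gt0 eps_lt1
  spec_fin) hG sG mE EG).
Qed.
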